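(* Let $\mathtt T$ be a semi-free tricategory, $C_2$ the collection of its coherence 2-morphisms, and $C_3$ a coherence-(2,3)-system of $\mathtt T$. 1. There is a tricategory $\mathtt T/C_3$ whose objects are those of $\mathtt T$, and whose 1-, 2- and 3-morphisms are the equivalence classes $[f]$, $[\alpha]$, $[\Lambda]$ with respect to the relations $\sim_1,\sim_2,\sim_3$ determined by $C_3$, with the following remaining data. Sources and targets: $s[f]=sf$, $t[f]=tf$, $s[\alpha]=[s\alpha]$, $t[\alpha]=[t\alpha]$, $s[\Lambda]=[s\Lambda]$, $t[\Lambda]=[t\Lambda]$. Composition along objects: $[f]\otimes[g]=[f\otimes g]$, $[\alpha]\otimes[\beta]=[\alpha\otimes\beta]$, $[\Lambda]\otimes[\Pi]=[\Lambda\otimes\Pi]$. Composition along 1-morphisms: $[\alpha]*[\beta]=[\alpha'*\beta']$ for any $*$-composable $\alpha',\beta'$ with $[\alpha']=[\alpha]$, $[\beta']=[\beta]$, and $[\Lambda]*[\Pi]=[\Lambda'*\Pi']$ for any $*$-composable $\Lambda',\Pi'$ with $[\Lambda']=[\Lambda]$, $[\Pi']=[\Pi]$. Composition along 2-morphisms: $[\Lambda]\circ[\Pi]=[\Lambda'\circ\Pi']$ for any $\circ$-composable $\Lambda',\Pi'$ with $[\Lambda']=[\Lambda]$, $[\Pi']=[\Pi]$. Units and constraint cells are the classes of the corresponding cells of $\mathtt T$: $1_{[a]}=[1_a]$, $1_{[f]}=[1_f]$, $a_{[\alpha][\beta][\gamma]}=[a_{\alpha\beta\gamma}]$, $\rho_{[f],[g]}=[\rho_{f,g}]$,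 and likewise for all others, where in $a^{loc}_{[\alpha_1][\alpha_2][\alpha_3]}=[a^{loc}_{\alpha_1\alpha_2\alpha_3}]$ and $\phi^\otimes_{([\alpha_1],[\beta_1])([\alpha_2],[\beta_2])}=[\phi^\otimes_{(\alpha_1,\beta_1)(\alpha_2,\beta_2)}]$ the representatives are chosen such that the right-hand side is defined. 2. Mapping each morphism of $\mathtt T$ to its equivalence class defines a virtually strict triequivalence $[-]:\mathtt T\to\mathtt T/C_3$.
   Context: Tricategories are in the fully algebraic sense of Gurski: objects, local bicategories $\mathtt T(a,b)$, weak functors $\otimes$ (composition) and $I_a:\mathtt 1\to\mathtt T(a,a)$ (units), adjoint equivalences $a\dashv a^{\blacksquare}$, $l\dashv l^{\blacksquare}$, $r\dashv r^{\blacksquare}$ (with units $\eta^a,\eta^l,\eta^r$ and counits $\epsilon^a,\epsilon^l,\epsilon^r$) in functor bicategories, and invertible modifications $\pi,\mu,\lambda,\rho$, subject to the usual three axioms. Composition along objects, 1-morphisms, 2-morphisms is written $\otimes,*,\circ$; $s,t$ denote source and target; morphisms are parallel if they have the same source and target. Write $1_a=I_a(\bullet)$, $i_a=I_a(1_\bullet):1_a\to 1_a$, $\phi_a:1_{1_a}\to i_a$. The constraint cells are $i_a$, $\phi_a$, components of the local constraints $a^{loc},l^{loc},r^{loc}$, the interchangers $\phi^\otimes_{(\alpha,\beta)(\alpha',\beta')}:(\alpha\otimes\beta)*(\alpha'\otimes\beta')\to(\alpha*\alpha')\otimes(\beta*\beta')$, the cells $\phi^\otimes_{(f,g)}:1_{f\otimes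 g}\to 1_f\otimes 1_g$, and all components of $a,a^\blacksquare,l,l^\blacksquare,r,r^\blacksquare,\eta^a,\epsilon^a,\eta^l,\epsilon^l,\eta^r,\epsilon^r,\pi,\mu,\lambda,\rho$ (and inverses of constraint 3-cells). A coherence 2- (resp. 3-) morphism is a 2- (resp. 3-) morphism that is a composite (under $\otimes,*$, resp. $\otimes,*,\circ$) of constraint cells and units. $\mathtt T$ is semi-free if any two parallel coherence 2-morphisms are isomorphic via a uniquely determined coherence 3-morphism. A coherence-3-system is a collection $C$ of 3-morphisms such that: $C$ is closed under $\otimes,*,\circ$; $1_\alpha\in C$ for all 2-morphisms $\alpha$; every $\Gamma\in C$ is invertible with $\Gamma^{-1}\in C$; parallel elements of $C$ are equal. For semi-free $\mathtt T$ with coherence 2-morphisms $C_2$, a coherence-(2,3)-system is a collection $C_3$ of 3-morphisms such that: (1) $C_3$ is a coherence-3-system; (2) for parallel $\gamma,\gamma'\in C_2$ the unique coherence 3-morphism $\gamma\to\gamma'$ lies in $C_3$; (3) all interchangers $\phi^\otimes_{(\gamma,\gamma')(\alpha,\alpha')}$ and $\phi^\otimes_{(\alpha,\alpha')(\gamma,\gamma')}$ with $\gamma,\gamma'\in C_2$ and $\alpha,\alpha'$ arbitrary 2-morphisms lie in $C_3$; (4) all components of $a^{loc},l^{loc},r^{loc}$ lie in $C_3$. It determines relations: for 1-morphisms, $f\sim_1 g$ iff there is $\gamma:f\to g$ in $C_2$; for 2-morphisms, $\alpha\sim_2\alpha'$ iff there are $\gamma,\gamma'\in C_2$ and $\Gamma:\gamma*\alpha\to\alpha'*\gamma'$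 in $C_3$; for 3-morphisms, $\Lambda\sim_3\Lambda'$ iff there are $\gamma,\gamma'\in C_2$ and $\Gamma,\Gamma'\in C_3$ with $\Gamma\circ(1_\gamma*\Lambda)=(\Lambda'*1_{\gamma'})\circ\Gamma'$. Virtually strict functor $F:\mathtt T\to\mathtt T'$: assignments on objects, 1-, 2-, 3-morphisms preserving sources and targets, strictly preserving $\otimes,*,\circ$, all units and all constraint cells. It is a virtually strict triequivalence if every object $a'$ of $\mathtt T'$ admits an object $a$ of $\mathtt T$ and a biequivalence $Fa\to a'$ in $\mathtt T'$, and each $\mathtt T(a,b)\to\mathtt T'(Fa,Fb)$ is a strict functor of bicategories which is a biequivalence (surjective on objects up to equivalence, essentially surjective on local categories, bijective on sets of 2-cells). *)

(* Defs.v *)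
From Stdlib Require Import RelationClasses.

(* Composition is written in functional order throughout: f acts first in
   g * f, and C acts first in D \o C. *)

Set Implicit Arguments.
Unset Strict Implicit.
Unset Printing Implicit Defensive.

Declare Scope cell_scope.
Delimit Scope cell_scope with cell.
Open Scope cell_scope.

Record globset2 := Globset2 {
  cell0 :> Type;
  cell1 : cell0 -> cell0 -> Type;
  cell2 : forall x y : cell0, cell1 x y -> cell1 x y -> Type }.
Arguments cell1 {g} _ _.
Arguments cell2 {g x y} _ _.

Class bicat_ops (G : globset2) := BicatOps {
  id1 : forall x : G, cell1 x x;
  comp1 : forall x y z : G, cell1 y z -> cell1 x y -> cell1 x z;
  id2 : forall (x y : G) (f : cell1 x y), cell2 f f;
  vcomp : forall (x y : G) (f g h : cell1 x y),
    cell2 g h -> cell2 f g -> cell2 f h;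
  hcomp : forall (x y z : G) (g g' : cell1 y z) (f f' : cell1 x y),
    cell2 g g' -> cell2 f f' -> cell2 (comp1 g f) (comp1 g' f') }.
Arguments id1 {G _} x.
Arguments comp1 {G _ x y z} _ _.
Arguments id2 {G _ x y} f.
Arguments vcomp {G _ x y f g h} _ _.
Arguments hcomp {G _ x y z g g' f f'} _ _.

Notation "g * f" := (comp1 g f) (at level 40, left associativity) : cell_scope.
Notation "D ** C" := (hcomp D C) (at level 40, left associativity) : cell_scope.
Notation "f <| C" := (hcomp (id2 f) C)
  (at level 44, right associativity) : cell_scope.
Notation "C |> f" := (hcomp C (id2 f))
  (at level 43, left associativity) : cell_scope.
Notation "D \o C" := (vcomp D C) (at level 48, right associativity) : cell_scope.

Definition inverse2 {G : globset2} {O : bicat_ops G} {x y : G}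
    {f g : cell1 x y} (C : cell2 f g) (D : cell2 g f) : Prop :=
  D \o C = id2 f /\ C \o D = id2 g.

Definition invertible2 {G : globset2} {O : bicat_ops G} {x y : G}
    {f g : cell1 x y} (C : cell2 f g) : Prop :=
  exists D : cell2 g f, inverse2 C D.

Class bicat (G : globset2) := Bicat {
  bops :: bicat_ops G;
  assoc : forall (x y z w : G) (h : cell1 z w) (g : cell1 y z) (f : cell1 x y),
    cell2 (h * g * f) (h * (g * f));
  assoc_inv : forall (x y z w : G)
    (h : cell1 z w) (g : cell1 y z) (f : cell1 x y),
    cell2 (h * (g * f)) (h * g * f);
  lunitor : forall (x y : G) (f : cell1 x y), cell2 (id1 y * f) f;
  lunitor_inv : forall (x y : G) (f : cell1 x y), cell2 f (id1 y * f);
  runitor : forall (x y : G) (f : cell1 x y), cell2 (f * id1 x) f;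
  runitor_inv : forall (x y : G) (f : cell1 x y), cell2 f (f * id1 x);
  vcompA : forall (x y : G) (f g h k : cell1 x y)
    (E : cell2 h k) (D : cell2 g h) (C : cell2 f g),
    (E \o D) \o C = E \o D \o C;
  vcomp1l : forall (x y : G) (f g : cell1 x y) (C : cell2 f g), id2 g \o C = C;
  vcomp1r : forall (x y : G) (f g : cell1 x y) (C : cell2 f g), C \o id2 f = C;
  hcomp_id : forall (x y z : G) (g : cell1 y z) (f : cell1 x y),
    id2 g ** id2 f = id2 (g * f);
  interchange : forall (x y z : G) (g g' g'' : cell1 y z) (f f' f'' : cell1 x y)
    (D' : cell2 g' g'') (D : cell2 g g') (C' : cell2 f' f'') (C : cell2 f f'),
    (D' \o D) ** (C' \o C) = D' ** C' \o D ** C;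
  assocK : forall (x y z w : G)
    (h : cell1 z w) (g : cell1 y z) (f : cell1 x y),
    inverse2 (assoc h g f) (assoc_inv h g f);
  lunitorK : forall (x y : G) (f : cell1 x y),
    inverse2 (lunitor f) (lunitor_inv f);
  runitorK : forall (x y : G) (f : cell1 x y),
    inverse2 (runitor f) (runitor_inv f);
  assoc_natural : forall (x y z w : G) (h h' : cell1 z w) (g g' : cell1 y z)
    (f f' : cell1 x y) (E : cell2 h h') (D : cell2 g g') (C : cell2 f f'),
    assoc h' g' f' \o (E ** D) ** C = E ** (D ** C) \o assoc h g f;
  lunitor_natural : forall (x y : G) (f f' : cell1 x y) (C : cell2 f f'),
    lunitor f' \o (id1 y <| C) = C \o lunitor f;
  runitor_natural : forall (x y : G) (f f' : cell1 x y) (C : cell2 f f'),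
    runitor f' \o (C |> id1 x) = C \o runitor f;
  pentagon : forall (x y z w v : G) (k : cell1 w v) (h : cell1 z w)
    (g : cell1 y z) (f : cell1 x y),
    assoc k h (g * f) \o assoc (k * h) g f
    = (k <| assoc h g f) \o assoc k (h * g) f \o (assoc k h g |> f);
  triangle : forall (x y z : G) (g : cell1 y z) (f : cell1 x y),
    (g <| lunitor f) \o assoc g (id1 y) f = runitor g |> f }.
Arguments assoc {G _ x y z w} h g f.
Arguments assoc_inv {G _ x y z w} h g f.
Arguments lunitor {G _ x y} f.
Arguments lunitor_inv {G _ x y} f.
Arguments runitor {G _ x y} f.
Arguments runitor_inv {G _ x y} f.

Definition unitg : globset2 :=
  @Globset2 unit (fun _ _ => unit) (fun _ _ _ _ => unit).

Definition unit_ops : bicat_ops unitg :=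
  @BicatOps unitg (fun _ => tt) (fun _ _ _ _ _ => tt) (fun _ _ _ => tt)
    (fun _ _ _ _ _ _ _ => tt) (fun _ _ _ _ _ _ _ _ _ => tt).

#[export] Instance unit_bicat : bicat unitg.
Proof.
refine (@Bicat unitg unit_ops
  (fun _ _ _ _ _ _ _ => tt) (fun _ _ _ _ _ _ _ => tt)
  (fun _ _ _ => tt) (fun _ _ _ => tt) (fun _ _ _ => tt) (fun _ _ _ => tt)
  _ _ _ _ _ _ _ _ _ _ _ _ _);
  intros; try split; simpl; try reflexivity; destruct C; reflexivity.
Defined.

Definition prodg (G H : globset2) : globset2 :=
  @Globset2 (G * H)
    (fun x y => (cell1 (fst x) (fst y) * cell1 (snd x) (snd y))%type)
    (fun _ _ f g => (cell2 (fst f) (fst g) * cell2 (snd f) (snd g))%type).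

Definition prod_ops (G H : globset2) (OG : bicat_ops G) (OH : bicat_ops H) :
    bicat_ops (prodg G H) :=
  @BicatOps (prodg G H)
    (fun x => (id1 (fst x), id1 (snd x)))
    (fun _ _ _ g f => (fst g * fst f, snd g * snd f))
    (fun _ _ f => (id2 (fst f), id2 (snd f)))
    (fun _ _ _ _ _ D C => (fst D \o fst C, snd D \o snd C))
    (fun _ _ _ _ _ _ _ D C => (fst D ** fst C, snd D ** snd C)).

#[export] Instance prod_bicat (G H : globset2) (BG : bicat G) (BH : bicat H) :
  bicat (prodg G H).
Proof.
refine (@Bicat (prodg G H) (prod_ops bops bops)
  (fun _ _ _ _ h g f =>
    (assoc (fst h) (fst g) (fst f), assoc (snd h) (snd g) (snd f)))
  (fun _ _ _ _ h g f =>
    (assoc_inv (fst h) (fst g) (fst f), assoc_inv (snd h) (snd g) (snd f)))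
  (fun _ _ f => (lunitor (fst f), lunitor (snd f)))
  (fun _ _ f => (lunitor_inv (fst f), lunitor_inv (snd f)))
  (fun _ _ f => (runitor (fst f), runitor (snd f)))
  (fun _ _ f => (runitor_inv (fst f), runitor_inv (snd f)))
  _ _ _ _ _ _ _ _ _ _ _ _ _); intros; try split; simpl;
  try (destruct C); simpl;
  rewrite ?vcompA, ?vcomp1l, ?vcomp1r, ?hcomp_id, ?interchange,
    ?assoc_natural, ?lunitor_natural, ?runitor_natural, ?pentagon, ?triangle,
    ?(proj1 (assocK _ _ _)), ?(proj2 (assocK _ _ _)),
    ?(proj1 (lunitorK _)), ?(proj2 (lunitorK _)),
    ?(proj1 (runitorK _)), ?(proj2 (runitorK _)); reflexivity.
Defined.

Record gmap (G H : globset2) := Gmap {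
  map0 :> G -> H;
  map1 : forall x y : G, cell1 x y -> cell1 (map0 x) (map0 y);
  map2 : forall (x y : G) (f g : cell1 x y),
    cell2 f g -> cell2 (map1 f) (map1 g) }.
Arguments map1 {G H} F {x y} _ : rename.
Arguments map2 {G H} F {x y f g} _ : rename.

Definition gid (G : globset2) : gmap G G :=
  @Gmap G G (fun x => x) (fun _ _ f => f) (fun _ _ _ _ C => C).

Definition gcomp (G H K : globset2) (F : gmap H K) (E : gmap G H) : gmap G K :=
  @Gmap G K (fun x => F (E x)) (fun _ _ f => map1 F (map1 E f))
    (fun _ _ _ _ C => map2 F (map2 E C)).

Definition gprod (G G' H H' : globset2) (F : gmap G H) (F' : gmap G' H') :
    gmap (prodg G G') (prodg H H') :=
  @Gmap (prodg G G') (prodg H H')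
    (fun x => (F (fst x), F' (snd x)))
    (fun _ _ f => (map1 F (fst f), map1 F' (snd f)))
    (fun _ _ _ _ C => (map2 F (fst C), map2 F' (snd C))).

Definition gpair (G H H' : globset2) (F : gmap G H) (F' : gmap G H') :
    gmap G (prodg H H') :=
  @Gmap G (prodg H H') (fun x => (F x, F' x))
    (fun _ _ f => (map1 F f, map1 F' f))
    (fun _ _ _ _ C => (map2 F C, map2 F' C)).

Definition greassoc (G H K : globset2) :
    gmap (prodg (prodg G H) K) (prodg G (prodg H K)) :=
  @Gmap (prodg (prodg G H) K) (prodg G (prodg H K))
    (fun x => (fst (fst x), (snd (fst x), snd x)))
    (fun _ _ f => (fst (fst f), (snd (fst f), snd f)))
    (fun _ _ _ _ C => (fst (fst C), (snd (fst C), snd C))).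

Definition gbang (G : globset2) : gmap G unitg :=
  @Gmap G unitg (fun _ => tt) (fun _ _ _ => tt) (fun _ _ _ _ _ => tt).

(* The data of a weak functor; the laws are in [functor] below.  Composites of
   weak functors are only needed as boundaries of transformations, and there
   only their data enters. *)
Record prefunctor (G H : globset2) (BG : bicat G) (BH : bicat H) :=
  Prefunctor {
  fmap :> gmap G H;
  fcomp : forall (x y z : G) (g : cell1 y z) (f : cell1 x y),
    cell2 (map1 fmap g * map1 fmap f) (map1 fmap (g * f));
  funit : forall x : G, cell2 (id1 (fmap x)) (map1 fmap (id1 x)) }.
Arguments prefunctor G H {BG BH}.
Arguments Prefunctor {G H BG BH} _ _ _.
Arguments fcomp {G H BG BH} F {x y z} g f : rename.
Arguments funit {G H BG BH} F x : rename.

Record functor (G H : globset2) (BG : bicat G) (BH : bicat H) := Functor {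
  fpre :> prefunctor G H;
  fcomp_inv : forall (x y z : G) (g : cell1 y z) (f : cell1 x y),
    cell2 (map1 fpre (g * f)) (map1 fpre g * map1 fpre f);
  funit_inv : forall x : G, cell2 (map1 fpre (id1 x)) (id1 (fpre x));
  fcompK : forall (x y z : G) (g : cell1 y z) (f : cell1 x y),
    inverse2 (fcomp fpre g f) (fcomp_inv g f);
  funitK : forall x : G, inverse2 (funit fpre x) (funit_inv x);
  map2_id : forall (x y : G) (f : cell1 x y),
    map2 fpre (id2 f) = id2 (map1 fpre f);
  map2_vcomp : forall (x y : G) (f g h : cell1 x y)
    (D : cell2 g h) (C : cell2 f g),
    map2 fpre (D \o C) = map2 fpre D \o map2 fpre C;
  fcomp_natural : forall (x y z : G) (g g' : cell1 y z) (f f' : cell1 x y)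
    (D : cell2 g g') (C : cell2 f f'),
    fcomp fpre g' f' \o map2 fpre D ** map2 fpre C
    = map2 fpre (D ** C) \o fcomp fpre g f;
  fcomp_assoc : forall (x y z w : G)
    (h : cell1 z w) (g : cell1 y z) (f : cell1 x y),
    map2 fpre (assoc h g f) \o fcomp fpre (h * g) f
      \o (fcomp fpre h g |> map1 fpre f)
    = fcomp fpre h (g * f) \o (map1 fpre h <| fcomp fpre g f)
      \o assoc (map1 fpre h) (map1 fpre g) (map1 fpre f);
  fcomp_lunit : forall (x y : G) (f : cell1 x y),
    map2 fpre (lunitor f) \o fcomp fpre (id1 y) f
      \o (funit fpre y |> map1 fpre f)
    = lunitor (map1 fpre f);
  fcomp_runit : forall (x y : G) (f : cell1 x y),
    map2 fpre (runitor f) \o fcomp fpre f (id1 x)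
      \o (map1 fpre f <| funit fpre x)
    = runitor (map1 fpre f) }.
Arguments functor G H {BG BH}.
Arguments fcomp_inv {G H BG BH} F {x y z} g f : rename.
Arguments funit_inv {G H BG BH} F x : rename.

Section Prefunctors.
Context {G G' H H' K : globset2} {BG : bicat G} {BG' : bicat G'}
  {BH : bicat H} {BH' : bicat H'} {BK : bicat K}.

Definition pf_id : prefunctor G G :=
  Prefunctor (gid G) (fun _ _ _ g f => id2 (g * f)) (fun x => id2 (id1 x)).

Definition pf_comp (F : prefunctor H K) (E : prefunctor G H) :
    prefunctor G K :=
  Prefunctor (gcomp F E)
    (fun _ _ _ g f => map2 F (fcomp E g f) \o fcomp F (map1 E g) (map1 E f))
    (fun x => map2 F (funit E x) \o funit F (E x)).

Definition pf_prod (F : prefunctor G H) (F' : prefunctor G' H') :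
    prefunctor (prodg G G') (prodg H H') :=
  @Prefunctor (prodg G G') (prodg H H') _ _ (gprod F F')
    (fun _ _ _ g f => (fcomp F (fst g) (fst f), fcomp F' (snd g) (snd f)))
    (fun x => (funit F (fst x), funit F' (snd x))).

Definition pf_pair (F : prefunctor G H) (F' : prefunctor G H') :
    prefunctor G (prodg H H') :=
  @Prefunctor G (prodg H H') _ _ (gpair F F')
    (fun _ _ _ g f => (fcomp F g f, fcomp F' g f))
    (fun x => (funit F x, funit F' x)).

Definition pf_reassoc :
    prefunctor (prodg (prodg G H) K) (prodg G (prodg H K)) :=
  Prefunctor (greassoc G H K)
    (fun _ _ _ g f => id2 (map1 (greassoc G H K) (g * f)))
    (fun x => id2 (map1 (greassoc G H K) (id1 x))).

Definition pf_bang : prefunctor G unitg :=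
  @Prefunctor G unitg _ _ (gbang G) (fun _ _ _ _ _ => tt) (fun _ => tt).

End Prefunctors.
Arguments pf_id G {BG}.
Arguments pf_reassoc G H K {BG BH BK}.
Arguments pf_bang G {BG}.

(* The naturality cell points from E f * s_x to s_y * F f.  As it is invertible
   this is only a choice of orientation. *)
Record pretrans (G H : globset2) (BH : bicat H) (F E : gmap G H) := Pretrans {
  tob :> forall x : G, cell1 (F x) (E x);
  tnat : forall (x y : G) (f : cell1 x y),
    cell2 (map1 E f * tob x) (tob y * map1 F f) }.
Arguments pretrans {G H BH} F E.
Arguments Pretrans {G H BH F E} _ _.
Arguments tnat {G H BH F E} s {x y} f : rename.

Record trans (G H : globset2) (BG : bicat G) (BH : bicat H)
    (F E : prefunctor G H) := Trans {
  tpre :> pretrans F E;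
  tnat_inv : forall (x y : G) (f : cell1 x y),
    cell2 (tpre y * map1 F f) (map1 E f * tpre x);
  tnatK : forall (x y : G) (f : cell1 x y),
    inverse2 (tnat tpre f) (tnat_inv f);
  tnat_natural : forall (x y : G) (f g : cell1 x y) (C : cell2 f g),
    tnat tpre g \o (map2 E C |> tpre x) = (tpre y <| map2 F C) \o tnat tpre f;
  tnat_comp : forall (x y z : G) (g : cell1 y z) (f : cell1 x y),
    tnat tpre (g * f) \o (fcomp E g f |> tpre x)
    = (tpre z <| fcomp F g f)
      \o assoc (tpre z) (map1 F g) (map1 F f)
      \o (tnat tpre g |> map1 F f)
      \o assoc_inv (map1 E g) (tpre y) (map1 F f)
      \o (map1 E g <| tnat tpre f)
      \o assoc (map1 E g) (map1 E f) (tpre x);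
  tnat_unit : forall x : G,
    tnat tpre (id1 x) \o (funit E x |> tpre x)
    = (tpre x <| funit F x) \o runitor_inv (tpre x) \o lunitor (tpre x) }.
Arguments trans {G H BG BH} F E.
Arguments tnat_inv {G H BG BH F E} s {x y} f : rename.

Section Pretransformations.
Context {A G H G' H' : globset2} {BG : bicat G} {BH : bicat H}
  {BG' : bicat G'} {BH' : bicat H'}.

Definition tid (F : gmap G H) : pretrans F F :=
  Pretrans (fun x => id1 (F x))
    (fun _ _ f => lunitor_inv (map1 F f) \o runitor (map1 F f)).

Definition tcomp {F E D : gmap G H} (t : pretrans E D) (s : pretrans F E) :
    pretrans F D :=
  @Pretrans G H _ F D (fun x => t x * s x)
    (fun x y f =>
      assoc_inv (t y) (s y) (map1 F f)
      \o (t y <| tnat s f)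
      \o assoc (t y) (map1 E f) (s x)
      \o (tnat t f |> s x)
      \o assoc_inv (map1 D f) (t x) (s x)).

Definition whiskR {F E : gmap G H} (s : pretrans F E) (P : gmap A G) :
    pretrans (gcomp F P) (gcomp E P) :=
  @Pretrans A H _ (gcomp F P) (gcomp E P)
    (fun x => s (P x)) (fun _ _ f => tnat s (map1 P f)).

Definition whiskL (T : functor G H) {F E : gmap A G} (s : pretrans F E) :
    pretrans (gcomp T F) (gcomp T E) :=
  @Pretrans A H _ (gcomp T F) (gcomp T E)
    (fun x => map1 T (s x))
    (fun x y f =>
      fcomp_inv T (s y) (map1 F f) \o map2 T (tnat s f)
      \o fcomp T (map1 E f) (s x)).

Definition tprod {F E : gmap G H} {F' E' : gmap G' H'}
    (s : pretrans F E) (s' : pretrans F' E') :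
    pretrans (gprod F F') (gprod E E') :=
  @Pretrans (prodg G G') (prodg H H') _ (gprod F F') (gprod E E')
    (fun x => (s (fst x), s' (snd x)))
    (fun _ _ f => (tnat s (fst f), tnat s' (snd f))).

End Pretransformations.

Record imod (G H : globset2) (BH : bicat H) (F E : gmap G H)
    (s t : pretrans F E) := Imod {
  mob :> forall x : G, cell2 (s x) (t x);
  mob_inv : forall x : G, cell2 (t x) (s x);
  mobK : forall x : G, inverse2 (mob x) (mob_inv x);
  mob_natural : forall (x y : G) (f : cell1 x y),
    tnat t f \o (map1 E f <| mob x) = (mob y |> map1 F f) \o tnat s f }.
Arguments imod {G H BH F E} s t.
Arguments mob_inv {G H BH F E s t} m x : rename.

(* Adjoint equivalences in the functor bicategory from G to H; the constraint
   cells of that bicategory are computed componentwise in H. *)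
Record adjeq (G H : globset2) (BG : bicat G) (BH : bicat H)
    (F E : prefunctor G H) := Adjeq {
  adj_l :> trans F E;
  adj_r : trans E F;
  adj_unit : imod (tid F) (tcomp adj_r adj_l);
  adj_counit : imod (tcomp adj_l adj_r) (tid E);
  adj_triangle_l : forall x : G,
    lunitor (adj_l x) \o (adj_counit x |> adj_l x)
      \o assoc_inv (adj_l x) (adj_r x) (adj_l x)
      \o (adj_l x <| adj_unit x) \o runitor_inv (adj_l x)
    = id2 (adj_l x);
  adj_triangle_r : forall x : G,
    runitor (adj_r x) \o (adj_r x <| adj_counit x)
      \o assoc (adj_r x) (adj_l x) (adj_r x)
      \o (adj_unit x |> adj_r x) \o lunitor_inv (adj_r x)
    = id2 (adj_r x) }.
Arguments adjeq {G H BG BH} F E.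

Section Paste.
Context {G : globset2} {B : bicat G}.

Definition front2 {v x y z : G} {g : cell1 y z} {f : cell1 x y} {u : cell1 x z}
    (C : cell2 (g * f) u) (w : cell1 v x) : cell2 (g * (f * w)) (u * w) :=
  (C |> w) \o assoc_inv g f w.

Definition front3 {v x y z t : G} {h : cell1 z t} {g : cell1 y z}
    {f : cell1 x y} {u : cell1 x t}
    (C : cell2 (h * (g * f)) u) (w : cell1 v x) :
    cell2 (h * (g * (f * w))) (u * w) :=
  (C |> w) \o assoc_inv h (g * f) w \o (h <| assoc_inv g f w).

End Paste.

Record globset3 := Globset3 {
  obj :> Type;
  hom : obj -> obj -> globset2 }.
Arguments hom {g} _ _.

(* An n-morphism of the tricategory from a to b is an (n-1)-cell of
   [hom a b]. *)
Class tricat_data (X : globset3) := TricatData {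
  loc :: forall a b : X, bicat (hom a b);
  tens : forall a b c : X, functor (prodg (hom b c) (hom a b)) (hom a c);
  unt : forall a : X, functor unitg (hom a a);
  asc : forall a b c d : X,
    adjeq (pf_comp (tens a b d) (pf_prod (tens b c d) (pf_id (hom a b))))
      (pf_comp (tens a c d)
        (pf_comp (pf_prod (pf_id (hom c d)) (tens a b c))
          (pf_reassoc (hom c d) (hom b c) (hom a b))));
  lft : forall a b : X,
    adjeq (pf_comp (tens a b b)
        (pf_pair (pf_comp (unt b) (pf_bang (hom a b))) (pf_id (hom a b))))
      (pf_id (hom a b));
  rgt : forall a b : X,
    adjeq (pf_comp (tens a a b)
        (pf_pair (pf_id (hom a b)) (pf_comp (unt a) (pf_bang (hom a b)))))
      (pf_id (hom a b));
  (* (1_k (x) a_{h,g,f}) * a_{k,hg,f} * (a_{k,h,g} (x) 1_f)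
     -> a_{k,h,gf} * a_{kh,g,f} *)
  pi : forall a b c d e : X,
    imod
      (tcomp
        (whiskR (whiskL (tens a d e) (tprod (tid (gid (hom d e))) (asc a b c d)))
          (gcomp (greassoc _ _ _) (gprod (greassoc _ _ _) (gid (hom a b)))))
        (tcomp
          (whiskR (asc a b d e)
            (gprod (gcomp (gprod (gid (hom d e)) (tens b c d))
              (greassoc _ _ _)) (gid (hom a b))))
          (whiskL (tens a b e) (tprod (asc b c d e) (tid (gid (hom a b)))))))
      (tcomp
        (whiskR (asc a c d e)
          (gcomp (gprod (gid (prodg (hom d e) (hom c d))) (tens a b c))
            (greassoc _ _ _)))
        (whiskR (asc a b c e)
          (gprod (gprod (tens c d e) (gid (hom b c))) (gid (hom a b)))));
  (* (1_g (x) l_f) * a_{g,1,f} * (r'_g (x) 1_f) -> 1_{gf}, with r' right adjoint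
     to r.  Here and below (x) is precomposed with [gprod gid gid], which
     only replaces a pair by the pair of its projections. *)
  mu : forall a b c : X,
    imod
      (tcomp
        (whiskL (tens a b c) (tprod (tid (gid (hom b c))) (lft a b)))
        (tcomp
          (whiskR (asc a b b c)
            (gprod (gpair (gid (hom b c)) (gcomp (unt b) (gbang (hom b c))))
              (gid (hom a b))))
          (whiskL (tens a b c)
            (tprod (adj_r (rgt b c)) (tid (gid (hom a b)))))))
      (tid (gcomp (tens a b c) (gprod (gid (hom b c)) (gid (hom a b)))));
  (* l_g (x) 1_f -> l_{gf} * a_{1,g,f} *)
  lam : forall a b c : X,
    imod
      (whiskL (tens a b c) (tprod (lft b c) (tid (gid (hom a b)))))
      (tcomp
        (whiskR (lft a c)
          (gcomp (tens a b c) (gprod (gid (hom b c)) (gid (hom a b)))))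
        (whiskR (asc a b c c)
          (gprod (gpair (gcomp (unt c) (gbang (hom b c))) (gid (hom b c)))
            (gid (hom a b)))));
  (* 1_g (x) r'_f -> a_{g,f,1} * r'_{gf} *)
  rho : forall a b c : X,
    imod
      (whiskL (tens a b c) (tprod (tid (gid (hom b c))) (adj_r (rgt a b))))
      (tcomp
        (whiskR (asc a a b c)
          (gpair (gprod (gid (hom b c)) (gid (hom a b)))
            (gcomp (unt a) (gbang (prodg (hom b c) (hom a b))))))
        (whiskR (adj_r (rgt a c))
          (gcomp (tens a b c) (gprod (gid (hom b c)) (gid (hom a b)))))) }.
Arguments tens {X _} a b c.
Arguments unt {X _} a.
Arguments asc {X _} a b c d.
Arguments lft {X _} a b.
Arguments rgt {X _} a b.
Arguments pi {X _} a b c d e.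
Arguments mu {X _} a b c.
Arguments lam {X _} a b c.
Arguments rho {X _} a b c.

Section Components.
Context {X : globset3} {T : tricat_data X}.

Definition tens1 {a b c : X} (g : hom b c) (f : hom a b) : hom a c :=
  tens a b c (g, f).

Definition tens2 {a b c : X} {g g' : hom b c} {f f' : hom a b}
    (s : cell1 g g') (t : cell1 f f') : cell1 (tens1 g f) (tens1 g' f') :=
  @map1 _ _ (tens a b c) (g, f) (g', f') (s, t).

Definition tens3 {a b c : X} {g g' : hom b c} {f f' : hom a b}
    {s s' : cell1 g g'} {t t' : cell1 f f'} (C : cell2 s s') (D : cell2 t t') :
    cell2 (tens2 s t) (tens2 s' t') :=
  @map2 _ _ (tens a b c) (g, f) (g', f') (s, t) (s', t') (C, D).

End Components.

Notation "g ⊗1 f" := (tens1 g f) (at level 38, left associativity) : cell_scope.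
Notation "s ⊗2 t" := (tens2 s t) (at level 38, left associativity) : cell_scope.
Notation "C ⊗3 D" := (tens3 C D) (at level 38, left associativity) : cell_scope.

Section TricatLaws.
Context {X : globset3} {T : tricat_data X}.

Definition u1 (a : X) : hom a a := unt a tt.

Definition u2 (a : X) : cell1 (u1 a) (u1 a) := @map1 _ _ (unt a) tt tt tt.

Definition phi_unit (a : X) : cell2 (id1 (u1 a)) (u2 a) := funit (unt a) tt.

Definition phi {a b c : X} {h h' h'' : hom b c} {f f' f'' : hom a b}
    (s' : cell1 h' h'') (t' : cell1 f' f'') (s : cell1 h h') (t : cell1 f f') :
    cell2 (s' ⊗2 t' * (s ⊗2 t)) ((s' * s) ⊗2 (t' * t)) :=
  @fcomp _ _ _ _ (tens a b c) (h, f) (h', f') (h'', f'') (s', t') (s, t).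

Definition phi_inv {a b c : X} {h h' h'' : hom b c} {f f' f'' : hom a b}
    (s' : cell1 h' h'') (t' : cell1 f' f'') (s : cell1 h h') (t : cell1 f f') :
    cell2 ((s' * s) ⊗2 (t' * t)) (s' ⊗2 t' * (s ⊗2 t)) :=
  @fcomp_inv _ _ _ _ (tens a b c) (h, f) (h', f') (h'', f'') (s', t') (s, t).

Definition phi_id {a b c : X} (g : hom b c) (f : hom a b) :
    cell2 (id1 (g ⊗1 f)) (id1 g ⊗2 id1 f) :=
  funit (tens a b c) (g, f).

Definition phi_id_inv {a b c : X} (g : hom b c) (f : hom a b) :
    cell2 (id1 g ⊗2 id1 f) (id1 (g ⊗1 f)) :=
  funit_inv (tens a b c) (g, f).

Definition ac {a b c d : X} (h : hom c d) (g : hom b c) (f : hom a b) :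
    cell1 (h ⊗1 g ⊗1 f) (h ⊗1 (g ⊗1 f)) :=
  asc a b c d (h, g, f).

Definition ac_nat {a b c d : X} {h h' : hom c d} {g g' : hom b c}
    {f f' : hom a b} (s : cell1 h h') (t : cell1 g g') (u : cell1 f f') :
    cell2 (s ⊗2 (t ⊗2 u) * ac h g f) (ac h' g' f' * (s ⊗2 t ⊗2 u)) :=
  @tnat _ _ _ _ _ (asc a b c d) (h, g, f) (h', g', f') (s, t, u).

Definition ac_nat_inv {a b c d : X} {h h' : hom c d} {g g' : hom b c}
    {f f' : hom a b} (s : cell1 h h') (t : cell1 g g') (u : cell1 f f') :
    cell2 (ac h' g' f' * (s ⊗2 t ⊗2 u)) (s ⊗2 (t ⊗2 u) * ac h g f) :=
  @tnat_inv _ _ _ _ _ _ (asc a b c d) (h, g, f) (h', g', f') (s, t, u).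

Definition lc {a b : X} (f : hom a b) : cell1 (u1 b ⊗1 f) f := lft a b f.

Definition rc {a b : X} (f : hom a b) : cell1 f (f ⊗1 u1 a) :=
  adj_r (rgt a b) f.

Definition pic {a b c d e : X}
    (k : hom d e) (h : hom c d) (g : hom b c) (f : hom a b) :
    cell2 (id1 k ⊗2 ac h g f * (ac k (h ⊗1 g) f * (ac k h g ⊗2 id1 f)))
      (ac k h (g ⊗1 f) * ac (k ⊗1 h) g f) :=
  pi a b c d e (k, h, g, f).

Definition muc {a b c : X} (g : hom b c) (f : hom a b) :
    cell2 (id1 g ⊗2 lc f * (ac g (u1 b) f * (rc g ⊗2 id1 f)))
      (id1 (g ⊗1 f)) :=
  mu a b c (g, f).

Definition lamc_inv {a b c : X} (g : hom b c) (f : hom a b) :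
    cell2 (lc (g ⊗1 f) * ac (u1 c) g f) (lc g ⊗2 id1 f) :=
  mob_inv (lam a b c) (g, f).

Definition rhoc_inv {a b c : X} (g : hom b c) (f : hom a b) :
    cell2 (ac g f (u1 a) * rc (g ⊗1 f)) (id1 g ⊗2 rc f) :=
  mob_inv (rho a b c) (g, f).

(* Comparison cells of the functors - (x) f and k (x) -, obtained from phi by
   absorbing 1 * 1 into 1. *)
Section OneSided.
Context {a b c : X}.

Definition rcomp2 {g g' g'' : hom b c} (s' : cell1 g' g'') (s : cell1 g g')
    (f : hom a b) :
    cell2 (s' ⊗2 id1 f * (s ⊗2 id1 f)) ((s' * s) ⊗2 id1 f) :=
  id2 (s' * s) ⊗3 lunitor (id1 f) \o phi s' (id1 f) s (id1 f).

Definition rcomp2_inv {g g' g'' : hom b c} (s' : cell1 g' g'') (s : cell1 g g')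
    (f : hom a b) :
    cell2 ((s' * s) ⊗2 id1 f) (s' ⊗2 id1 f * (s ⊗2 id1 f)) :=
  phi_inv s' (id1 f) s (id1 f) \o id2 (s' * s) ⊗3 lunitor_inv (id1 f).

Definition rcomp3 {g g' g'' g3 : hom b c} (s'' : cell1 g'' g3)
    (s' : cell1 g' g'') (s : cell1 g g') (f : hom a b) :
    cell2 (s'' ⊗2 id1 f * (s' ⊗2 id1 f * (s ⊗2 id1 f)))
      ((s'' * (s' * s)) ⊗2 id1 f) :=
  rcomp2 s'' (s' * s) f \o (s'' ⊗2 id1 f <| rcomp2 s' s f).

Definition lcomp2 {f f' f'' : hom a b} (k : hom b c) (s' : cell1 f' f'')
    (s : cell1 f f') :
    cell2 (id1 k ⊗2 s' * (id1 k ⊗2 s)) (id1 k ⊗2 (s' * s)) :=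
  lunitor (id1 k) ⊗3 id2 (s' * s) \o phi (id1 k) s' (id1 k) s.

Definition lcomp2_inv {f f' f'' : hom a b} (k : hom b c) (s' : cell1 f' f'')
    (s : cell1 f f') :
    cell2 (id1 k ⊗2 (s' * s)) (id1 k ⊗2 s' * (id1 k ⊗2 s)) :=
  phi_inv (id1 k) s' (id1 k) s \o lunitor_inv (id1 k) ⊗3 id2 (s' * s).

Definition lcomp3 {f f' f'' f3 : hom a b} (k : hom b c) (s'' : cell1 f'' f3)
    (s' : cell1 f' f'') (s : cell1 f f') :
    cell2 (id1 k ⊗2 s'' * (id1 k ⊗2 s' * (id1 k ⊗2 s)))
      (id1 k ⊗2 (s'' * (s' * s))) :=
  lcomp2 k s'' (s' * s) \o (id1 k ⊗2 s'' <| lcomp2 k s' s).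

End OneSided.

(* The associahedron axiom: both sides are 3-morphisms from
   (1 (x) (1 (x) a)) * (1 (x) a) * a * ((1 (x) a) (x) 1) * (a (x) 1)
     * ((a (x) 1) (x) 1)
   to a_{p,q,r(st)} * a_{pq,r,st} * a_{(pq)r,s,t}. *)
Definition associahedron_axiom : Prop :=
  forall (a0 a1 a2 a3 a4 a5 : X) (p : hom a4 a5) (q : hom a3 a4)
    (r : hom a2 a3) (s : hom a1 a2) (t : hom a0 a1),
  let x6 := id1 p ⊗2 (id1 q ⊗2 ac r s t) in
  let x5 := id1 p ⊗2 ac q (r ⊗1 s) t in
  let x4 := ac p (q ⊗1 (r ⊗1 s)) t in
  let x3 := id1 p ⊗2 ac q r s ⊗2 id1 t in
  let x2 := ac p (q ⊗1 r) s ⊗2 id1 t in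
  let x1 := ac p q r ⊗2 id1 s ⊗2 id1 t in
  (* pi_{p,q,r,s} (x) 1_t *)
  let pi_t : cell2 (x3 * (x2 * x1))
      (ac p q (r ⊗1 s) ⊗2 id1 t * (ac (p ⊗1 q) r s ⊗2 id1 t)) :=
    rcomp2_inv _ _ t \o pic p q r s ⊗3 id2 (id1 t) \o rcomp3 _ _ _ t in
  (* 1_p (x) pi_{q,r,s,t} *)
  let p_pi : cell2 (x6 * (x5 * (id1 p ⊗2 (ac q r s ⊗2 id1 t))))
      (id1 p ⊗2 ac q r (s ⊗1 t) * (id1 p ⊗2 ac (q ⊗1 r) s t)) :=
    lcomp2_inv p _ _ \o id2 (id1 p) ⊗3 pic q r s t \o lcomp3 p _ _ _ in
  let nat1 : cell2 (x6 * ac p q (r ⊗1 s ⊗1 t))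
      (ac p q (r ⊗1 (s ⊗1 t)) * (id1 (p ⊗1 q) ⊗2 ac r s t)) :=
    (ac p q _ <| phi_id_inv p q ⊗3 id2 (ac r s t))
      \o ac_nat (id1 p) (id1 q) (ac r s t) in
  let nat2 : cell2 (x4 * x3)
      (id1 p ⊗2 (ac q r s ⊗2 id1 t) * ac p (q ⊗1 r ⊗1 s) t) :=
    ac_nat_inv (id1 p) (ac q r s) (id1 t) in
  let nat3 : cell2 (ac (p ⊗1 (q ⊗1 r)) s t * x1)
      (ac p q r ⊗2 id1 (s ⊗1 t) * ac (p ⊗1 q ⊗1 r) s t) :=
    (id2 (ac p q r) ⊗3 phi_id_inv s t |> ac _ s t)
      \o ac_nat_inv (ac p q r) (id1 s) (id1 t) in
  (ac p q (r ⊗1 (s ⊗1 t)) <| pic (p ⊗1 q) r s t)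
    \o assoc _ _ _
    \o front2 nat1 (ac (p ⊗1 q) (r ⊗1 s) t * (ac (p ⊗1 q) r s ⊗2 id1 t))
    \o (x6 <| (assoc _ _ _
                 \o front3 (pic p q (r ⊗1 s) t) (ac (p ⊗1 q) r s ⊗2 id1 t)))
    \o (x6 <| x5 <| x4 <| pi_t)
  = assoc _ _ _
    \o front3 (pic p q r (s ⊗1 t)) (ac (p ⊗1 q ⊗1 r) s t)
    \o (id1 p ⊗2 ac q r (s ⊗1 t) <| ac p (q ⊗1 r) (s ⊗1 t) <| nat3)
    \o (id1 p ⊗2 ac q r (s ⊗1 t)
          <| (assoc _ _ _ \o front3 (pic p (q ⊗1 r) s t) x1))
    \o assoc _ _ _
    \o front3 p_pi (ac p (q ⊗1 r ⊗1 s) t * (x2 * x1))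
    \o (x6 <| x5 <| (assoc _ _ _ \o front2 nat2 (x2 * x1))).

(* Both sides are 3-morphisms to a_{h,g,f} from
   (1 (x) l_{gf}) * (1 (x) a) * a * (a (x) 1) * ((r' (x) 1) (x) 1). *)
Definition left_normalization : Prop :=
  forall (a b c d : X) (h : hom c d) (g : hom b c) (f : hom a b),
  let x5 := id1 h ⊗2 lc (g ⊗1 f) in
  let x4 := id1 h ⊗2 ac (u1 c) g f in
  let x3 := ac h (u1 c ⊗1 g) f in
  let x2 := ac h (u1 c) g ⊗2 id1 f in
  let x1 := rc h ⊗2 id1 g ⊗2 id1 f in
  (* 1_h (x) lambda_{g,f}^{-1} *)
  let h_lam : cell2 (x5 * x4) (id1 h ⊗2 (lc g ⊗2 id1 f)) :=
    id2 (id1 h) ⊗3 lamc_inv g f \o lcomp2 h _ _ in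
  (* mu_{h,g} (x) 1_f *)
  let mu_f : cell2 (id1 h ⊗2 lc g ⊗2 id1 f * (x2 * x1)) (id1 (h ⊗1 g ⊗1 f)) :=
    phi_id_inv (h ⊗1 g) f \o muc h g ⊗3 id2 (id1 f) \o rcomp3 _ _ _ f in
  let nat1 : cell2 (ac (h ⊗1 u1 c) g f * x1) (rc h ⊗2 id1 (g ⊗1 f) * ac h g f) :=
    (id2 (rc h) ⊗3 phi_id_inv g f |> ac h g f)
      \o ac_nat_inv (rc h) (id1 g) (id1 f) in
  let nat2 : cell2 (id1 h ⊗2 (lc g ⊗2 id1 f) * x3)
      (ac h g f * (id1 h ⊗2 lc g ⊗2 id1 f)) :=
    ac_nat (id1 h) (lc g) (id1 f) in
  lunitor (ac h g f)
    \o front3 (muc h (g ⊗1 f)) (ac h g f)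
    \o (x5 <| ac h (u1 c) (g ⊗1 f) <| nat1)
    \o (x5 <| (assoc _ _ _ \o front3 (pic h (u1 c) g f) x1))
  = runitor (ac h g f)
    \o (ac h g f <| mu_f)
    \o assoc _ _ _
    \o front2 nat2 (x2 * x1)
    \o front2 h_lam (x3 * (x2 * x1)).

(* Both sides are 3-morphisms to a_{h,g,f} from
   (1 (x) (1 (x) l_f)) * (1 (x) a) * a * (a (x) 1) * (r'_{hg} (x) 1). *)
Definition right_normalization : Prop :=
  forall (a b c d : X) (h : hom c d) (g : hom b c) (f : hom a b),
  let x5 := id1 h ⊗2 (id1 g ⊗2 lc f) in
  let x4 := id1 h ⊗2 ac g (u1 b) f in
  let x3 := ac h (g ⊗1 u1 b) f in
  let x2 := ac h g (u1 b) ⊗2 id1 f in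
  let x1 := rc (h ⊗1 g) ⊗2 id1 f in
  (* rho_{h,g}^{-1} (x) 1_f *)
  let rho_f : cell2 (x2 * x1) (id1 h ⊗2 rc g ⊗2 id1 f) :=
    rhoc_inv h g ⊗3 id2 (id1 f) \o rcomp2 _ _ f in
  (* 1_h (x) mu_{g,f} *)
  let h_mu : cell2 (x5 * (x4 * (id1 h ⊗2 (rc g ⊗2 id1 f))))
      (id1 (h ⊗1 (g ⊗1 f))) :=
    phi_id_inv h (g ⊗1 f) \o id2 (id1 h) ⊗3 muc g f \o lcomp3 h _ _ _ in
  let nat1 : cell2 (x5 * ac h g (u1 b ⊗1 f))
      (ac h g f * (id1 (h ⊗1 g) ⊗2 lc f)) :=
    (ac h g f <| phi_id_inv h g ⊗3 id2 (lc f))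
      \o ac_nat (id1 h) (id1 g) (lc f) in
  let nat2 : cell2 (x3 * (id1 h ⊗2 rc g ⊗2 id1 f))
      (id1 h ⊗2 (rc g ⊗2 id1 f) * ac h g f) :=
    ac_nat_inv (id1 h) (rc g) (id1 f) in
  runitor (ac h g f)
    \o (ac h g f <| muc (h ⊗1 g) f)
    \o assoc _ _ _
    \o front2 nat1 (ac (h ⊗1 g) (u1 b) f * x1)
    \o (x5 <| (assoc _ _ _ \o front3 (pic h g (u1 b) f) x1))
  = lunitor (ac h g f)
    \o front3 h_mu (ac h g f)
    \o (x5 <| x4 <| (nat2 \o (x3 <| rho_f))).

End TricatLaws.

Class tricat (X : globset3) := Tricat {
  tdata :: tricat_data X;
  tricat_associahedron : associahedron_axiom;
  tricat_left_normalization : left_normalization;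
  tricat_right_normalization : right_normalization }.

Section AdjCells.
Context {G H : globset2} {BG : bicat G} {BH : bicat H} {F E : prefunctor G H}
  (e : adjeq F E).

Inductive adj_cell1 : forall x y : H, cell1 x y -> Prop :=
| adj_cell1_l (x : G) : adj_cell1 (adj_l e x)
| adj_cell1_r (x : G) : adj_cell1 (adj_r e x).

Inductive adj_cell2 : forall (x y : H) (f g : cell1 x y), cell2 f g -> Prop :=
| adj_cell2_l (x y : G) (f : cell1 x y) : adj_cell2 (tnat (adj_l e) f)
| adj_cell2_r (x y : G) (f : cell1 x y) : adj_cell2 (tnat (adj_r e) f)
| adj_cell2_unit (x : G) : adj_cell2 (adj_unit e x)
| adj_cell2_counit (x : G) : adj_cell2 (adj_counit e x).

End AdjCells.

Section Coherence.
Context {X : globset3} {T : tricat X}.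

(* The composition constraint of the functor unt a is not listed below: the unit
   laws of a weak functor express it through phi_unit and the unitors. *)
Inductive constraint2 : forall (a b : X) (f g : hom a b), cell1 f g -> Prop :=
| constraint2_unit (a : X) : constraint2 (u2 a)
| constraint2_asc (a b c d : X) (f g : hom a d) (s : cell1 f g) :
    adj_cell1 (asc a b c d) s -> constraint2 s
| constraint2_lft (a b : X) (f g : hom a b) (s : cell1 f g) :
    adj_cell1 (lft a b) s -> constraint2 s
| constraint2_rgt (a b : X) (f g : hom a b) (s : cell1 f g) :
    adj_cell1 (rgt a b) s -> constraint2 s.

Inductive constraint3 :
    forall (a b : X) (f g : hom a b) (s t : cell1 f g), cell2 s t -> Prop :=
| constraint3_phi_unit (a : X) : constraint3 (phi_unit a)
| constraint3_assoc (a b : X) (f g h k : hom a b)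
    (u : cell1 h k) (t : cell1 g h) (s : cell1 f g) :
    constraint3 (assoc u t s)
| constraint3_lunitor (a b : X) (f g : hom a b) (s : cell1 f g) :
    constraint3 (lunitor s)
| constraint3_runitor (a b : X) (f g : hom a b) (s : cell1 f g) :
    constraint3 (runitor s)
| constraint3_phi (a b c : X) (h h' h'' : hom b c) (f f' f'' : hom a b)
    (s' : cell1 h' h'') (t' : cell1 f' f'')
    (s : cell1 h h') (t : cell1 f f') :
    constraint3 (phi s' t' s t)
| constraint3_phi_id (a b c : X) (g : hom b c) (f : hom a b) :
    constraint3 (phi_id g f)
| constraint3_asc (a b c d : X) (f g : hom a d) (s t : cell1 f g)
    (C : cell2 s t) : adj_cell2 (asc a b c d) C -> constraint3 C
| constraint3_lft (a b : X) (f g : hom a b) (s t : cell1 f g)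
    (C : cell2 s t) : adj_cell2 (lft a b) C -> constraint3 C
| constraint3_rgt (a b : X) (f g : hom a b) (s t : cell1 f g)
    (C : cell2 s t) : adj_cell2 (rgt a b) C -> constraint3 C
| constraint3_pi (a b c d e : X)
    (x : prodg (prodg (prodg (hom d e) (hom c d)) (hom b c)) (hom a b)) :
    constraint3 (pi a b c d e x)
| constraint3_mu (a b c : X) (x : prodg (hom b c) (hom a b)) :
    constraint3 (mu a b c x)
| constraint3_lam (a b c : X) (x : prodg (hom b c) (hom a b)) :
    constraint3 (lam a b c x)
| constraint3_rho (a b c : X) (x : prodg (hom b c) (hom a b)) :
    constraint3 (rho a b c x)
| constraint3_inv (a b : X) (f g : hom a b) (s t : cell1 f g)
    (C : cell2 s t) (D : cell2 t s) :
    constraint3 C -> inverse2 C D -> constraint3 D.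

Inductive coh2 : forall (a b : X) (f g : hom a b), cell1 f g -> Prop :=
| coh2_constraint (a b : X) (f g : hom a b) (s : cell1 f g) :
    constraint2 s -> coh2 s
| coh2_id (a b : X) (f : hom a b) : coh2 (id1 f)
| coh2_comp (a b : X) (f g h : hom a b) (t : cell1 g h) (s : cell1 f g) :
    coh2 t -> coh2 s -> coh2 (t * s)
| coh2_tens (a b c : X) (g g' : hom b c) (f f' : hom a b)
    (s : cell1 g g') (t : cell1 f f') : coh2 s -> coh2 t -> coh2 (s ⊗2 t).

Inductive coh3 :
    forall (a b : X) (f g : hom a b) (s t : cell1 f g), cell2 s t -> Prop :=
| coh3_constraint (a b : X) (f g : hom a b) (s t : cell1 f g)
    (C : cell2 s t) : constraint3 C -> coh3 C
| coh3_id (a b : X) (f g : hom a b) (s : cell1 f g) : coh3 (id2 s)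
| coh3_vcomp (a b : X) (f g : hom a b) (s t u : cell1 f g)
    (D : cell2 t u) (C : cell2 s t) : coh3 D -> coh3 C -> coh3 (D \o C)
| coh3_hcomp (a b : X) (f g h : hom a b) (t t' : cell1 g h)
    (s s' : cell1 f g) (D : cell2 t t') (C : cell2 s s') :
    coh3 D -> coh3 C -> coh3 (D ** C)
| coh3_tens (a b c : X) (g g' : hom b c) (f f' : hom a b)
    (s s' : cell1 g g') (t t' : cell1 f f') (C : cell2 s s')
    (D : cell2 t t') : coh3 C -> coh3 D -> coh3 (C ⊗3 D).

End Coherence.
Arguments coh2 {X T a b f g} s.
Arguments coh3 {X T a b f g s t} C.

Definition semi_free {X : globset3} (T : tricat X) : Prop :=
  forall (a b : X) (f g : hom a b) (s t : cell1 f g), coh2 s -> coh2 t ->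
  exists C : cell2 s t,
    coh3 C /\ invertible2 C /\ forall C' : cell2 s t, coh3 C' -> C' = C.

Definition mor3_collection {X : globset3} (T : tricat X) : Type :=
  forall (a b : X) (f g : hom a b) (s t : cell1 f g), cell2 s t -> Prop.

Definition in3 {X : globset3} {T : tricat X} (C3 : mor3_collection T)
    {a b : X} {f g : hom a b} {s t : cell1 f g} (C : cell2 s t) : Prop :=
  C3 a b f g s t C.

Record coherence3_system {X : globset3} (T : tricat X)
    (C3 : mor3_collection T) : Prop := {
  c3_tens : forall (a b c : X) (g g' : hom b c) (f f' : hom a b)
    (s s' : cell1 g g') (t t' : cell1 f f') (C : cell2 s s') (D : cell2 t t'),
    in3 C3 C -> in3 C3 D -> in3 C3 (C ⊗3 D);
  c3_hcomp : forall (a b : X) (f g h : hom a b) (t t' : cell1 g h)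
    (s s' : cell1 f g) (D : cell2 t t') (C : cell2 s s'),
    in3 C3 D -> in3 C3 C -> in3 C3 (D ** C);
  c3_vcomp : forall (a b : X) (f g : hom a b) (s t u : cell1 f g)
    (D : cell2 t u) (C : cell2 s t),
    in3 C3 D -> in3 C3 C -> in3 C3 (D \o C);
  c3_id : forall (a b : X) (f g : hom a b) (s : cell1 f g),
    in3 C3 (id2 s);
  c3_inv : forall (a b : X) (f g : hom a b) (s t : cell1 f g) (C : cell2 s t),
    in3 C3 C ->
    exists D : cell2 t s, inverse2 C D /\ in3 C3 D;
  c3_parallel : forall (a b : X) (f g : hom a b) (s t : cell1 f g)
    (C D : cell2 s t), in3 C3 C -> in3 C3 D -> C = D }.

Record coherence23_system {X : globset3} (T : tricat X)
    (C3 : mor3_collection T) : Prop := {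
  c23_system : coherence3_system C3;
  c23_coh : forall (a b : X) (f g : hom a b) (s t : cell1 f g) (C : cell2 s t),
    coh2 s -> coh2 t -> coh3 C -> in3 C3 C;
  c23_phi_l : forall (a b c : X) (h h' h'' : hom b c) (f f' f'' : hom a b)
    (s' : cell1 h' h'') (t' : cell1 f' f'') (s : cell1 h h') (t : cell1 f f'),
    coh2 s' -> coh2 t' -> in3 C3 (phi s' t' s t);
  c23_phi_r : forall (a b c : X) (h h' h'' : hom b c) (f f' f'' : hom a b)
    (s' : cell1 h' h'') (t' : cell1 f' f'') (s : cell1 h h') (t : cell1 f f'),
    coh2 s -> coh2 t -> in3 C3 (phi s' t' s t);
  c23_assoc : forall (a b : X) (f g h k : hom a b)
    (u : cell1 h k) (t : cell1 g h) (s : cell1 f g),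
    in3 C3 (assoc u t s);
  c23_lunitor : forall (a b : X) (f g : hom a b) (s : cell1 f g),
    in3 C3 (lunitor s);
  c23_runitor : forall (a b : X) (f g : hom a b) (s : cell1 f g),
    in3 C3 (runitor s) }.

(* A cell together with its boundary.  Equality of such tuples is the equality
   of cells whose boundaries are only provably equal. *)
Record tot1 (G : globset2) := Tot1 {
  src1 : G; tgt1 : G;
  cell_of1 : cell1 src1 tgt1 }.
Arguments Tot1 {G src1 tgt1} cell_of1.

Record tot2 (G : globset2) := Tot2 {
  bot2 : G; top2 : G;
  src2 : cell1 bot2 top2; tgt2 : cell1 bot2 top2;
  cell_of2 : cell2 src2 tgt2 }.
Arguments Tot2 {G bot2 top2 src2 tgt2} cell_of2.

Notation "s =1 t" := (Tot1 s = Tot1 t) (at level 70) : cell_scope.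
Notation "C =2 D" := (Tot2 C = Tot2 D) (at level 70) : cell_scope.

Section Quotient.
Context {X : globset3} {T : tricat X} (C3 : mor3_collection T).

Definition sim1 {a b : X} (f g : hom a b) : Prop :=
  exists c : cell1 f g, coh2 c.

Definition sim2 {a b : X} (s s' : tot1 (hom a b)) : Prop :=
  exists (c : cell1 (tgt1 s) (tgt1 s')) (c' : cell1 (src1 s) (src1 s'))
    (C : cell2 (c * cell_of1 s) (cell_of1 s' * c')),
    coh2 c /\ coh2 c' /\ in3 C3 C.

Definition sim3 {a b : X} (L L' : tot2 (hom a b)) : Prop :=
  exists (c : cell1 (top2 L) (top2 L')) (c' : cell1 (bot2 L) (bot2 L'))
    (C : cell2 (c * tgt2 L) (tgt2 L' * c'))
    (C' : cell2 (c * src2 L) (src2 L' * c')),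
    coh2 c /\ coh2 c' /\ in3 C3 C /\ in3 C3 C' /\
    C \o (c <| cell_of2 L) = (cell_of2 L' |> c') \o C'.

Definition qhom0 (a b : X) : Type :=
  {A : hom a b -> Prop | exists f, A = sim1 f}.

Definition qhom1 {a b : X} (A B : qhom0 a b) : Type :=
  {P : tot1 (hom a b) -> Prop | exists s : tot1 (hom a b),
    proj1_sig A = sim1 (src1 s) /\ proj1_sig B = sim1 (tgt1 s) /\ P = sim2 s}.

Definition qhom2 {a b : X} {A B : qhom0 a b} (P Q : qhom1 A B) : Type :=
  {S : tot2 (hom a b) -> Prop | exists L : tot2 (hom a b),
    proj1_sig P = sim2 (Tot1 (src2 L)) /\ proj1_sig Q = sim2 (Tot1 (tgt2 L)) /\
    S = sim3 L}.

Definition quotient_globset : globset3 :=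
  @Globset3 X (fun a b => @Globset2 (qhom0 a b) qhom1 (@qhom2 a b)).

Definition class0 {a b : X} (f : hom a b) : qhom0 a b :=
  exist _ (sim1 f) (ex_intro _ f eq_refl).

Definition class1 {a b : X} {f g : hom a b} (s : cell1 f g) :
    qhom1 (class0 f) (class0 g) :=
  exist _ (sim2 (Tot1 s))
    (ex_intro _ (Tot1 s) (conj eq_refl (conj eq_refl eq_refl))).

Definition class2 {a b : X} {f g : hom a b} {s t : cell1 f g} (L : cell2 s t) :
    qhom2 (class1 s) (class1 t) :=
  exist _ (sim3 (Tot2 L))
    (ex_intro _ (Tot2 L) (conj eq_refl (conj eq_refl eq_refl))).

Definition rep0 {a b : X} (f : hom a b) (A : qhom0 a b) : Prop :=
  proj1_sig A = sim1 f.

Definition rep1 {a b : X} {f g : hom a b} (s : cell1 f g)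
    {A B : qhom0 a b} (P : qhom1 A B) : Prop :=
  proj1_sig P = sim2 (Tot1 s).

Definition rep2 {a b : X} {f g : hom a b} {s t : cell1 f g} (L : cell2 s t)
    {A B : qhom0 a b} {P Q : qhom1 A B} (S : qhom2 P Q) : Prop :=
  proj1_sig S = sim3 (Tot2 L).

Definition sims_equivalence : Prop :=
  forall a b : X, Equivalence (@sim1 a b) /\ Equivalence (@sim2 a b) /\
    Equivalence (@sim3 a b).

Record quotient_boundaries : Prop := {
  qb_mor2 : forall (a b : X) (A B : qhom0 a b) (P : qhom1 A B) (f g : hom a b)
    (s : cell1 f g), rep1 s P -> rep0 f A /\ rep0 g B;
  qb_mor3 : forall (a b : X) (A B : qhom0 a b) (P Q : qhom1 A B)
    (S : qhom2 P Q) (f g : hom a b) (s t : cell1 f g) (L : cell2 s t),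
    rep2 L S -> rep1 s P /\ rep1 t Q;
  (* representatives of the boundary extend to representatives of the cell, so
     composable classes have composable representatives *)
  qb_lift2 : forall (a b : X) (A B : qhom0 a b) (P : qhom1 A B) (f g : hom a b),
    rep0 f A -> rep0 g B -> exists s : cell1 f g, rep1 s P;
  qb_lift3 : forall (a b : X) (A B : qhom0 a b) (P Q : qhom1 A B)
    (S : qhom2 P Q) (f g : hom a b) (s t : cell1 f g),
    rep1 s P -> rep1 t Q -> exists L : cell2 s t, rep2 L S }.

(* The formulas for the units and the remaining constraint cells are instances
   of the virtual strictness of the class map. *)
Record quotient_operations (Q : tricat quotient_globset) : Prop := {
  qo_tens1 : forall (a b c : X) (g : hom b c) (f : hom a b)
    (B : @hom quotient_globset b c) (A : @hom quotient_globset a b),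
    rep0 g B -> rep0 f A -> rep0 (g ⊗1 f) (B ⊗1 A);
  qo_tens2 : forall (a b c : X) (g g' : hom b c) (f f' : hom a b)
    (s : cell1 g g') (t : cell1 f f')
    (B B' : @hom quotient_globset b c) (A A' : @hom quotient_globset a b)
    (P : cell1 B B') (R : cell1 A A'),
    rep1 s P -> rep1 t R -> rep1 (s ⊗2 t) (P ⊗2 R);
  qo_tens3 : forall (a b c : X) (g g' : hom b c) (f f' : hom a b)
    (s s' : cell1 g g') (t t' : cell1 f f') (L : cell2 s s') (M : cell2 t t')
    (B B' : @hom quotient_globset b c) (A A' : @hom quotient_globset a b)
    (P P' : cell1 B B') (R R' : cell1 A A') (S : cell2 P P') (U : cell2 R R'),
    rep2 L S -> rep2 M U -> rep2 (L ⊗3 M) (S ⊗3 U);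
  qo_comp : forall (a b : X) (f g h : hom a b) (t : cell1 g h) (s : cell1 f g)
    (A B D : @hom quotient_globset a b) (R : cell1 B D) (P : cell1 A B),
    rep1 t R -> rep1 s P -> rep1 (t * s) (R * P);
  qo_hcomp : forall (a b : X) (f g h : hom a b) (t t' : cell1 g h)
    (s s' : cell1 f g) (M : cell2 t t') (L : cell2 s s')
    (A B D : @hom quotient_globset a b) (R R' : cell1 B D) (P P' : cell1 A B)
    (U : cell2 R R') (S : cell2 P P'),
    rep2 M U -> rep2 L S -> rep2 (M ** L) (U ** S);
  qo_vcomp : forall (a b : X) (f g : hom a b) (s t u : cell1 f g)
    (M : cell2 t u) (L : cell2 s t)
    (A B : @hom quotient_globset a b) (P R W : cell1 A B)
    (U : cell2 R W) (S : cell2 P R),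
    rep2 M U -> rep2 L S -> rep2 (M \o L) (U \o S);
  qo_assoc : forall (a b : X) (f g h k : hom a b)
    (u : cell1 h k) (t : cell1 g h) (s : cell1 f g)
    (A B D E : @hom quotient_globset a b)
    (W : cell1 D E) (R : cell1 B D) (P : cell1 A B),
    rep1 u W -> rep1 t R -> rep1 s P -> rep2 (assoc u t s) (assoc W R P);
  qo_phi : forall (a b c : X) (h h' h'' : hom b c) (f f' f'' : hom a b)
    (s' : cell1 h' h'') (t' : cell1 f' f'') (s : cell1 h h') (t : cell1 f f')
    (B B' B'' : @hom quotient_globset b c)
    (A A' A'' : @hom quotient_globset a b)
    (P' : cell1 B' B'') (R' : cell1 A' A'') (P : cell1 B B') (R : cell1 A A'),
    rep1 s' P' -> rep1 t' R' -> rep1 s P -> rep1 t R ->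
    rep2 (phi s' t' s t) (phi P' R' P R) }.

End Quotient.

Section StrictLocal.
Context {G G' H H' : globset2} {BG : bicat G} {BG' : bicat G'}
  {BH : bicat H} {BH' : bicat H'}.

Record strict_functor (K : gmap G G') : Prop := {
  sf_id1 : forall x : G, map1 K (id1 x) = id1 (K x);
  sf_comp1 : forall (x y z : G) (g : cell1 y z) (f : cell1 x y),
    map1 K (g * f) = map1 K g * map1 K f;
  sf_id2 : forall (x y : G) (f : cell1 x y), map2 K (id2 f) = id2 (map1 K f);
  sf_vcomp : forall (x y : G) (f g h : cell1 x y)
    (D : cell2 g h) (C : cell2 f g),
    map2 K (D \o C) = map2 K D \o map2 K C;
  sf_hcomp : forall (x y z : G) (g g' : cell1 y z) (f f' : cell1 x y)
    (D : cell2 g g') (C : cell2 f f'),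
    map2 K (D ** C) =2 map2 K D ** map2 K C;
  sf_assoc : forall (x y z w : G)
    (h : cell1 z w) (g : cell1 y z) (f : cell1 x y),
    map2 K (assoc h g f) =2 assoc (map1 K h) (map1 K g) (map1 K f);
  sf_lunitor : forall (x y : G) (f : cell1 x y),
    map2 K (lunitor f) =2 lunitor (map1 K f);
  sf_runitor : forall (x y : G) (f : cell1 x y),
    map2 K (runitor f) =2 runitor (map1 K f) }.

(* Below, a functor, transformation, ... from G to H is carried to one from G'
   to H' by P on arguments and K on values. *)
Variables (P : gmap G G') (K : gmap H H').

Record preserves_functor (F : prefunctor G H) (F' : prefunctor G' H') :
    Prop := {
  pr_map0 : forall x : G, K (F x) = F' (P x);
  pr_map1 : forall (x y : G) (f : cell1 x y),
    map1 K (map1 F f) =1 map1 F' (map1 P f);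
  pr_map2 : forall (x y : G) (f g : cell1 x y) (C : cell2 f g),
    map2 K (map2 F C) =2 map2 F' (map2 P C);
  pr_fcomp : forall (x y z : G) (g : cell1 y z) (f : cell1 x y),
    map2 K (fcomp F g f) =2 fcomp F' (map1 P g) (map1 P f);
  pr_funit : forall x : G, map2 K (funit F x) =2 funit F' (P x) }.

Record preserves_trans {F E : gmap G H} {F' E' : gmap G' H'}
    (s : pretrans F E) (s' : pretrans F' E') : Prop := {
  pr_tob : forall x : G, map1 K (s x) =1 s' (P x);
  pr_tnat : forall (x y : G) (f : cell1 x y),
    map2 K (tnat s f) =2 tnat s' (map1 P f) }.

Definition preserves_mod {F E : gmap G H} {F' E' : gmap G' H'}
    {s t : pretrans F E} {s' t' : pretrans F' E'}
    (m : imod s t) (m' : imod s' t') : Prop :=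
  forall x : G, map2 K (m x) =2 m' (P x).

Record preserves_adjeq {F E : prefunctor G H} {F' E' : prefunctor G' H'}
    (e : adjeq F E) (e' : adjeq F' E') : Prop := {
  pr_adj_l : preserves_trans (adj_l e) (adj_l e');
  pr_adj_r : preserves_trans (adj_r e) (adj_r e');
  pr_adj_unit : preserves_mod (adj_unit e) (adj_unit e');
  pr_adj_counit : preserves_mod (adj_counit e) (adj_counit e') }.

End StrictLocal.

Record gmap3 (X Y : globset3) := Gmap3 {
  map_obj :> X -> Y;
  map_hom : forall a b : X, gmap (hom a b) (hom (map_obj a) (map_obj b)) }.
Arguments map_hom {X Y} F a b : rename.

(* Preservation of sources and targets is built into [gmap3]. *)
Record virtually_strict {X Y : globset3} (T : tricat X) (U : tricat Y)
    (F : gmap3 X Y) : Prop := {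
  vs_loc : forall a b : X, strict_functor (map_hom F a b);
  vs_tens : forall a b c : X,
    preserves_functor (gprod (map_hom F b c) (map_hom F a b)) (map_hom F a c)
      (tens a b c) (tens (F a) (F b) (F c));
  vs_unit : forall a : X,
    preserves_functor (gid unitg) (map_hom F a a) (unt a) (unt (F a));
  vs_asc : forall a b c d : X,
    preserves_adjeq
      (gprod (gprod (map_hom F c d) (map_hom F b c)) (map_hom F a b))
      (map_hom F a d) (asc a b c d) (asc (F a) (F b) (F c) (F d));
  vs_lft : forall a b : X,
    preserves_adjeq (map_hom F a b) (map_hom F a b)
      (lft a b) (lft (F a) (F b));
  vs_rgt : forall a b : X,
    preserves_adjeq (map_hom F a b) (map_hom F a b)
      (rgt a b) (rgt (F a) (F b));
  vs_pi : forall a b c d e : X,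
    preserves_mod
      (gprod (gprod (gprod (map_hom F d e) (map_hom F c d)) (map_hom F b c))
        (map_hom F a b))
      (map_hom F a e) (pi a b c d e) (pi (F a) (F b) (F c) (F d) (F e));
  vs_mu : forall a b c : X,
    preserves_mod (gprod (map_hom F b c) (map_hom F a b)) (map_hom F a c)
      (mu a b c) (mu (F a) (F b) (F c));
  vs_lam : forall a b c : X,
    preserves_mod (gprod (map_hom F b c) (map_hom F a b)) (map_hom F a c)
      (lam a b c) (lam (F a) (F b) (F c));
  vs_rho : forall a b c : X,
    preserves_mod (gprod (map_hom F b c) (map_hom F a b)) (map_hom F a c)
      (rho a b c) (rho (F a) (F b) (F c)) }.

Definition equivalence1 {G : globset2} {B : bicat G} {x y : G}
    (f : cell1 x y) : Prop :=
  exists g : cell1 y x,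
    (exists C : cell2 (g * f) (id1 x), invertible2 C) /\
    (exists C : cell2 (f * g) (id1 y), invertible2 C).

Definition biequivalence1 {X : globset3} {T : tricat X} {a b : X}
    (f : hom a b) : Prop :=
  exists g : hom b a,
    (exists s : cell1 (g ⊗1 f) (u1 a), equivalence1 s) /\
    (exists s : cell1 (f ⊗1 g) (u1 b), equivalence1 s).

Record strict_biequivalence {G H : globset2} {BG : bicat G} {BH : bicat H}
    (K : gmap G H) : Prop := {
  sb_strict : strict_functor K;
  sb_ob : forall y : H, exists (x : G) (f : cell1 (K x) y), equivalence1 f;
  sb_cell1 : forall (x y : G) (g : cell1 (K x) (K y)),
    exists (f : cell1 x y) (C : cell2 (map1 K f) g), invertible2 C;
  sb_inj : forall (x y : G) (f g : cell1 x y) (C D : cell2 f g),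
    map2 K C = map2 K D -> C = D;
  sb_surj : forall (x y : G) (f g : cell1 x y)
    (D : cell2 (map1 K f) (map1 K g)), exists C : cell2 f g, map2 K C = D }.

Record virtually_strict_triequivalence {X Y : globset3}
    (T : tricat X) (U : tricat Y) (F : gmap3 X Y) : Prop := {
  vst_strict : virtually_strict T U F;
  vst_obj : forall y : Y, exists (a : X) (f : hom (F a) y), biequivalence1 f;
  vst_loc : forall a b : X, strict_biequivalence (map_hom F a b) }.

Definition class_map {X : globset3} {T : tricat X} (C3 : mor3_collection T) :
    gmap3 X (quotient_globset C3) :=
  @Gmap3 X (quotient_globset C3) (fun a => a)
    (fun a b => @Gmap (hom a b) (@hom (quotient_globset C3) a b)
      class0 (@class1 X T C3 a b) (@class2 X T C3 a b)).

(* Main.v *)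
Require Import Defs.
From Stdlib Require Import RelationClasses Morphisms Setoid.
From Stdlib Require Import FunctionalExtensionality PropExtensionality
  ProofIrrelevance IndefiniteDescription.

(* Inside a local bicategory the coherence 2-morphisms and the 3-morphisms of
   C_3 behave like identities: every coherence 2-morphism is invertible up to
   C_3, and parallel elements of C_3 are equal.  Two 2-cells that agree up to
   composition with C_3 can therefore be compared without keeping track of the
   comparison cells, and similarity becomes a congruence for the composites
   along 1- and 2-morphisms.  It is preserved by a functor F whose cells
   F g * F f -> F (g * f) lie in C_3 as soon as g or f is coherent: in the
   associativity law of F, one coherent morphism out of three makes two of the
   four comparison cells trivial, which moves a coherence cell through a
   comparison cell.  The same argument applies to the naturality cells of a
   transformation.

   A cell of the quotient has representatives with any prescribed similar
   boundary, and with a fixed boundary the representative of a 3-cell is unique.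
   Hence a law holds in the quotient once all the variables in it are replaced
   by composable representatives and the law is applied in T. *)

Set Implicit Arguments.
Unset Strict Implicit.
Unset Printing Implicit Defensive.

(** * Thin systems and similarity *)

(** A class between two given classes of 1-morphisms has representatives in T with many different
    boundaries, so a quotient defined by chosen representatives would need transport along
    equalities of boundaries in every law. The quotient is therefore described by a relation between
    cells of T and classes that is total, onto and functional once the boundary of the class is
    fixed. Every operation is specified by one condition, preservation of this relation, and this
    condition is what passes through composites, whiskerings and products.

    Semi-freeness enters where two similarities meet along a common cell: their witnesses come with
    unrelated coherence 2-morphisms in the middle. These are parallel, hence joined by a cell of
    C_3, and so may be taken equal.

    The interchangers of arbitrary 2-morphisms and the naturality cells at arbitrary arguments are
    not assumed to lie in C_3. For them similarity cannot be read off from the boundary and needs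
    the associativity and composition laws. For the other constraint cells similarity of the
    boundary is enough. *)

Lemma inverse2_unique {G : globset2} {B : bicat G} {x y : G} {f g : cell1 x y}
    (C : cell2 f g) (D D' : cell2 g f) :
  inverse2 C D -> inverse2 C D' -> D = D'.
Proof.
intros [_ CD] [D'C _].
rewrite <- (vcomp1l D), <- D'C, vcompA, CD. apply vcomp1r.
Qed.

Lemma inverse2_sym {G : globset2} {B : bicat G} {x y : G} {f g : cell1 x y}
    (C : cell2 f g) (D : cell2 g f) : inverse2 C D -> inverse2 D C.
Proof. intros [DC CD]; split; assumption. Qed.

Lemma inverse2_hcomp {G : globset2} {B : bicat G} {x y z : G}
    {g g' : cell1 y z} {f f' : cell1 x y} (D : cell2 g g') (D' : cell2 g' g)
    (C : cell2 f f') (C' : cell2 f' f) :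
  inverse2 D D' -> inverse2 C C' -> inverse2 (D ** C) (D' ** C').
Proof.
intros [d d'] [c c'].
split; rewrite <- interchange, ?d, ?c, ?d', ?c'; apply hcomp_id.
Qed.

(* [coh] abstracts the coherence 2-morphisms and [thin] the 3-morphisms of C_3,
   so that the same notion applies to products of local bicategories. *)
Record thin_system (G : globset2) (B : bicat G) := ThinSystem {
  coh : forall x y : G, cell1 x y -> Prop;
  thin : forall (x y : G) (f g : cell1 x y), cell2 f g -> Prop;
  coh_id : forall x : G, coh (id1 x);
  coh_comp : forall (x y z : G) (d : cell1 y z) (c : cell1 x y),
    coh d -> coh c -> coh (d * c);
  coh_inv : forall (x y : G) (c : cell1 x y),
    coh c -> exists d : cell1 y x, coh d;
  thin_coh : forall (x y : G) (c d : cell1 x y),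
    coh c -> coh d -> exists C : cell2 c d, thin C;
  thin_id : forall (x y : G) (f : cell1 x y), thin (id2 f);
  thin_vcomp : forall (x y : G) (f g h : cell1 x y)
    (D : cell2 g h) (C : cell2 f g), thin D -> thin C -> thin (D \o C);
  thin_hcomp : forall (x y z : G) (g g' : cell1 y z) (f f' : cell1 x y)
    (D : cell2 g g') (C : cell2 f f'), thin D -> thin C -> thin (D ** C);
  thin_inv : forall (x y : G) (f g : cell1 x y) (C : cell2 f g),
    thin C -> exists D : cell2 g f, inverse2 C D /\ thin D;
  thin_parallel : forall (x y : G) (f g : cell1 x y) (C D : cell2 f g),
    thin C -> thin D -> C = D;
  thin_assoc : forall (x y z w : G)
    (h : cell1 z w) (g : cell1 y z) (f : cell1 x y), thin (assoc h g f);
  thin_lunitor : forall (x y : G) (f : cell1 x y), thin (lunitor f);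
  thin_runitor : forall (x y : G) (f : cell1 x y), thin (runitor f) }.
Arguments coh {G B} S {x y} c : rename.
Arguments thin {G B} S {x y f g} C : rename.
Arguments coh_id {G B} S x : rename.
Arguments thin_id {G B} S {x y} f : rename.

(** * Comparison of cells up to thin cells, and similarity *)

Section Thin.
Context {G : globset2} {B : bicat G} (S : thin_system B).

Definition like1 {x y : G} (f g : cell1 x y) : Prop :=
  exists C : cell2 f g, thin S C.

(** Serves as an equality of 2-cells across thin changes of source and target; with equal boundaries
    it is plain equality, by [like2_eq]. *)
Definition like2 {x y : G} {s t s' t' : cell1 x y}
    (L : cell2 s t) (L' : cell2 s' t') : Prop :=
  exists (C : cell2 t t') (C' : cell2 s s'),
    thin S C /\ thin S C' /\ C \o L = L' \o C'.

Definition sims1 (x y : G) : Prop := exists c : cell1 x y, coh S c.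

Definition sims2 {x y x' y' : G} (s : cell1 x y) (s' : cell1 x' y') : Prop :=
  exists (c : cell1 y y') (c' : cell1 x x'),
    coh S c /\ coh S c' /\ like1 (c * s) (s' * c').

Definition sims3 {x y x' y' : G} {s t : cell1 x y} {s' t' : cell1 x' y'}
    (L : cell2 s t) (L' : cell2 s' t') : Prop :=
  exists (c : cell1 y y') (c' : cell1 x x'),
    coh S c /\ coh S c' /\ like2 (c <| L) (L' |> c').

Lemma thin_inverse {x y : G} {f g : cell1 x y} (C : cell2 f g)
    (D : cell2 g f) : inverse2 C D -> thin S C -> thin S D.
Proof.
intros CD C_thin. destruct (thin_inv C_thin) as (D' & CD' & D'_thin).
rewrite (inverse2_unique CD CD'). exact D'_thin.
Qed.

#[local] Instance like1_equivalence (x y : G) : Equivalence (@like1 x y).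
Proof.
split.
- intros f. exists (id2 f). apply thin_id.
- intros f g (C & h). destruct (thin_inv h) as (D & _ & k). now exists D.
- intros f g h (C & c) (D & d). exists (D \o C). now apply thin_vcomp.
Qed.

#[local] Instance like1_comp (x y z : G) :
  Proper (@like1 y z ==> @like1 x y ==> @like1 x z) (@comp1 G _ x y z).
Proof.
intros g g' (D & d) f f' (C & c). exists (D ** C). now apply thin_hcomp.
Qed.

Lemma like1_assoc {x y z w : G} (h : cell1 z w) (g : cell1 y z)
    (f : cell1 x y) : like1 (h * g * f) (h * (g * f)).
Proof. exists (assoc h g f). apply thin_assoc. Qed.

Lemma like1_lunit {x y : G} (f : cell1 x y) : like1 (id1 y * f) f.
Proof. exists (lunitor f). apply thin_lunitor. Qed.

Lemma like1_runit {x y : G} (f : cell1 x y) : like1 (f * id1 x) f.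
Proof. exists (runitor f). apply thin_runitor. Qed.

Lemma like1_coh {x y : G} (c d : cell1 x y) :
  coh S c -> coh S d -> like1 c d.
Proof. apply thin_coh. Qed.

Lemma like1_coh_id {x : G} (c : cell1 x x) : coh S c -> like1 c (id1 x).
Proof. intros h. apply like1_coh; [exact h | apply coh_id]. Qed.

Lemma like2_refl {x y : G} {s t : cell1 x y} (L : cell2 s t) : like2 L L.
Proof.
exists (id2 t), (id2 s). split; [apply thin_id | split; [apply thin_id |]].
now rewrite vcomp1l, vcomp1r.
Qed.

Lemma like2_sym {x y : G} {s t s' t' : cell1 x y}
    (L : cell2 s t) (L' : cell2 s' t') : like2 L L' -> like2 L' L.
Proof.
intros (C & C' & c & c' & e).
destruct (thin_inv c) as (D & [DC CD] & d).
destruct (thin_inv c') as (D' & [DC' CD'] & d').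
exists D, D'. split; [exact d | split; [exact d' |]].
rewrite <- (vcomp1r L'), <- CD', <- (vcompA L'), <- e, vcompA, <- vcompA, DC.
apply vcomp1l.
Qed.

Lemma like2_trans {x y : G} {s t s' t' s'' t'' : cell1 x y}
    (L : cell2 s t) (L' : cell2 s' t') (L'' : cell2 s'' t'') :
  like2 L L' -> like2 L' L'' -> like2 L L''.
Proof.
intros (C & C' & c & c' & e) (D & D' & d & d' & e').
exists (D \o C), (D' \o C').
split; [now apply thin_vcomp | split; [now apply thin_vcomp |]].
now rewrite vcompA, e, <- vcompA, e', vcompA.
Qed.

(** The two comparison cells are thin endomorphisms, hence parallel to identities and equal to
    them. *)
Lemma like2_eq {x y : G} {s t : cell1 x y} (L L' : cell2 s t) :
  like2 L L' -> L = L'.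
Proof.
intros (C & C' & c & c' & e).
rewrite (thin_parallel c (thin_id S t)), (thin_parallel c' (thin_id S s)) in e.
now rewrite vcomp1l, vcomp1r in e.
Qed.

Lemma like2_hcomp {x y z : G} {g h g' h' : cell1 y z} {s t s' t' : cell1 x y}
    (M : cell2 g h) (M' : cell2 g' h') (L : cell2 s t) (L' : cell2 s' t') :
  like2 M M' -> like2 L L' -> like2 (M ** L) (M' ** L').
Proof.
intros (C & C' & c & c' & e) (D & D' & d & d' & e').
exists (C ** D), (C' ** D').
split; [now apply thin_hcomp | split; [now apply thin_hcomp |]].
now rewrite <- !interchange, e, e'.
Qed.

(** Both hypotheses bring a thin cell [t -> t'] along which the squares are pasted; being parallel,
    the two coincide. *)
Lemma like2_vcomp {x y : G} {s t u s' t' u' : cell1 x y}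
    (M : cell2 t u) (M' : cell2 t' u') (L : cell2 s t) (L' : cell2 s' t') :
  like2 M M' -> like2 L L' -> like2 (M \o L) (M' \o L').
Proof.
intros (C & C' & c & c' & e) (D & D' & d & d' & e').
exists C, D'. split; [exact c | split; [exact d' |]].
now rewrite <- vcompA, e, vcompA, (thin_parallel c' d), e', vcompA.
Qed.

(** A comparison of the sources suffices: thin cells are invertible, so conjugation yields the
    comparison of the targets. *)
Lemma like2_thin {x y : G} {s t s' t' : cell1 x y}
    (L : cell2 s t) (L' : cell2 s' t') :
  thin S L -> thin S L' -> like1 s s' -> like2 L L'.
Proof.
intros l l' (C & c). destruct (thin_inv l) as (M & [ML LM] & m).
exists (L' \o C \o M), C. split; [| split; [exact c |]].
- now repeat apply thin_vcomp.
- now rewrite !vcompA, ML, vcomp1r.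
Qed.

Lemma like2_id {x y : G} (f g : cell1 x y) :
  like1 f g -> like2 (id2 f) (id2 g).
Proof. apply like2_thin; apply thin_id. Qed.

Lemma like2_whiskl {x y z : G} {g g' : cell1 y z} {s t s' t' : cell1 x y}
    (L : cell2 s t) (L' : cell2 s' t') :
  like1 g g' -> like2 L L' -> like2 (g <| L) (g' <| L').
Proof. intros h. apply like2_hcomp. now apply like2_id. Qed.

Lemma like2_whiskr {x y z : G} {f f' : cell1 x y} {s t s' t' : cell1 y z}
    (L : cell2 s t) (L' : cell2 s' t') :
  like1 f f' -> like2 L L' -> like2 (L |> f) (L' |> f').
Proof. intros h k. apply like2_hcomp; [exact k |]. now apply like2_id. Qed.

Lemma like2_thin_l {x y : G} {s t u : cell1 x y}
    (C : cell2 t u) (L : cell2 s t) : thin S C -> like2 (C \o L) L.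
Proof.
intros c. apply like2_sym. exists C, (id2 s).
split; [exact c | split; [apply thin_id |]]. now rewrite vcomp1r.
Qed.

Lemma like2_thin_r {x y : G} {s t u : cell1 x y}
    (L : cell2 t u) (C : cell2 s t) : thin S C -> like2 (L \o C) L.
Proof.
intros c. exists (id2 u), C.
split; [apply thin_id | split; [exact c |]]. now rewrite vcomp1l.
Qed.

Lemma like2_assoc {x y z w : G} {h h' : cell1 z w} {g g' : cell1 y z}
    {f f' : cell1 x y} (E : cell2 h h') (D : cell2 g g') (C : cell2 f f') :
  like2 (E ** D ** C) (E ** (D ** C)).
Proof.
exists (assoc h' g' f'), (assoc h g f).
split; [apply thin_assoc | split; [apply thin_assoc |]]. apply assoc_natural.
Qed.

Lemma like2_lunit {x y : G} {f f' : cell1 x y} (C : cell2 f f') :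
  like2 (id1 y <| C) C.
Proof.
exists (lunitor f'), (lunitor f).
split; [apply thin_lunitor | split; [apply thin_lunitor |]].
apply lunitor_natural.
Qed.

Lemma like2_runit {x y : G} {f f' : cell1 x y} (C : cell2 f f') :
  like2 (C |> id1 x) C.
Proof.
exists (runitor f'), (runitor f).
split; [apply thin_runitor | split; [apply thin_runitor |]].
apply runitor_natural.
Qed.

Lemma like2_inverse {x y : G} {s t s' t' : cell1 x y} (L : cell2 s t)
    (M : cell2 t s) (L' : cell2 s' t') (M' : cell2 t' s') :
  inverse2 L M -> inverse2 L' M' -> like2 L L' -> like2 M M'.
Proof.
intros [ML LM] [ML' LM'] (C & C' & c & c' & e).
exists C', C. split; [exact c' | split; [exact c |]].
rewrite <- (vcomp1l (C' \o M)), <- ML', vcompA, <- (vcompA L'), <- e.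
now rewrite !vcompA, LM, vcomp1r.
Qed.

Lemma like2_transport {x y : G} {s t s' t' : cell1 x y} (L : cell2 s t) :
  like1 s s' -> like1 t t' -> exists L' : cell2 s' t', like2 L L'.
Proof.
intros (C & c) (D & d). destruct (thin_inv c) as (C' & [CC' _] & _).
exists (D \o L \o C'), D, C. split; [exact d | split; [exact c |]].
now rewrite !vcompA, CC', vcomp1r.
Qed.

Lemma sims1_refl (x : G) : sims1 x x.
Proof. exists (id1 x). apply coh_id. Qed.

Lemma sims1_sym {x y : G} : sims1 x y -> sims1 y x.
Proof. intros (c & h). destruct (coh_inv h) as (d & k). now exists d. Qed.

Lemma sims1_trans {x y z : G} : sims1 x y -> sims1 y z -> sims1 x z.
Proof. intros (c & h) (d & k). exists (d * c). now apply coh_comp. Qed.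

(** Parallel coherent morphisms are alike, so the sides of a similarity square may be exchanged for
    any others. This lets two squares with independently chosen sides be pasted. *)
Lemma sims2_any {x y x' y' : G} {s : cell1 x y} {s' : cell1 x' y'}
    {c : cell1 y y'} {c' : cell1 x x'} :
  sims2 s s' -> coh S c -> coh S c' -> like1 (c * s) (s' * c').
Proof.
intros (d & d' & h & h' & l) k k'.
now rewrite (like1_coh k h), l, (like1_coh k' h').
Qed.

Lemma sims2_bd {x y x' y' : G} {s : cell1 x y} {s' : cell1 x' y'} :
  sims2 s s' -> sims1 x x' /\ sims1 y y'.
Proof. intros (c & c' & h & h' & _). split; [now exists c' | now exists c]. Qed.

Lemma sims2_like {x y : G} (s s' : cell1 x y) : like1 s s' -> sims2 s s'.
Proof.
intros l. exists (id1 y), (id1 x).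
split; [apply coh_id | split; [apply coh_id |]].
now rewrite like1_lunit, like1_runit.
Qed.

Lemma sims2_sym {x y x' y' : G} {s : cell1 x y} {s' : cell1 x' y'} :
  sims2 s s' -> sims2 s' s.
Proof.
intros (c & c' & h & h' & l).
destruct (coh_inv h) as (d & k), (coh_inv h') as (d' & k').
exists d, d'. split; [exact k | split; [exact k' |]].
assert (e : like1 (c' * d') (id1 x')) by now apply like1_coh_id, coh_comp.
assert (e' : like1 (d * c) (id1 y)) by now apply like1_coh_id, coh_comp.
now rewrite <- (like1_runit s'), <- e, <- (like1_assoc s'), <- l, like1_assoc,
  <- like1_assoc, e', like1_lunit.
Qed.

Lemma sims2_trans {x y x' y' x'' y'' : G} {s : cell1 x y} {s' : cell1 x' y'}
    {s'' : cell1 x'' y''} : sims2 s s' -> sims2 s' s'' -> sims2 s s''.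
Proof.
intros (c & c' & h & h' & l) (d & d' & k & k' & m).
exists (d * c), (d' * c').
split; [now apply coh_comp | split; [now apply coh_comp |]].
now rewrite like1_assoc, l, <- like1_assoc, m, like1_assoc.
Qed.

Lemma sims2_comp {x y z x' y' z' : G} {t : cell1 y z} {s : cell1 x y}
    {t' : cell1 y' z'} {s' : cell1 x' y'} :
  sims2 t t' -> sims2 s s' -> sims2 (t * s) (t' * s').
Proof.
intros ht (c & c' & h & h' & l). pose proof ht as (d & _ & k & _).
exists d, c'. split; [exact k | split; [exact h' |]].
now rewrite <- like1_assoc, (sims2_any ht k h), like1_assoc, l, like1_assoc.
Qed.

(** A comparison on one end is enough: going back along [c], across, and forth along [c'] gives the
    side at the other end, and both ways around the square are coherent. *)
Lemma sims2_coh {x y x' y' : G} (c : cell1 x y) (c' : cell1 x' y') :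
  coh S c -> coh S c' -> sims1 x x' -> sims2 c c'.
Proof.
intros h h' (d & k). destruct (coh_inv h) as (e & ke).
exists (c' * (d * e)), d.
assert (k' : coh S (c' * (d * e))) by (repeat apply coh_comp; assumption).
split; [exact k' | split; [exact k |]].
apply like1_coh; now apply coh_comp.
Qed.

(** Conjugation by coherent morphisms produces a similar cell with any similar boundary; composable
    representatives come from here. *)
Lemma sims2_transport {x y x' y' : G} (s : cell1 x y) :
  sims1 x x' -> sims1 y y' -> exists s' : cell1 x' y', sims2 s s'.
Proof.
intros (c' & h') (c & h). destruct (coh_inv h') as (d' & k').
exists (c * (s * d')), c, c'. split; [exact h | split; [exact h' |]].
assert (e : like1 (d' * c') (id1 x)) by now apply like1_coh_id, coh_comp.
now rewrite !like1_assoc, e, like1_runit.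
Qed.

Lemma sims3_any {x y x' y' : G} {s t : cell1 x y} {s' t' : cell1 x' y'}
    {L : cell2 s t} {L' : cell2 s' t'} {c : cell1 y y'} {c' : cell1 x x'} :
  sims3 L L' -> coh S c -> coh S c' -> like2 (c <| L) (L' |> c').
Proof.
intros (d & d' & h & h' & l) k k'.
apply (like2_trans (L' := d <| L)).
{ apply like2_whiskl; [now apply like1_coh | apply like2_refl]. }
apply (like2_trans l).
apply like2_whiskr; [now apply like1_coh | apply like2_refl].
Qed.

Lemma sims3_bd {x y x' y' : G} {s t : cell1 x y} {s' t' : cell1 x' y'}
    {L : cell2 s t} {L' : cell2 s' t'} :
  sims3 L L' -> sims2 s s' /\ sims2 t t'.
Proof.
intros (c & c' & h & h' & C & C' & k & k' & _).
split; exists c, c'; (split; [exact h | split; [exact h' |]]);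
  [now exists C' | now exists C].
Qed.

Lemma sims3_like {x y : G} {s t s' t' : cell1 x y}
    (L : cell2 s t) (L' : cell2 s' t') : like2 L L' -> sims3 L L'.
Proof.
intros l. exists (id1 y), (id1 x).
split; [apply coh_id | split; [apply coh_id |]].
apply (like2_trans (like2_lunit L)), (like2_trans l), like2_sym, like2_runit.
Qed.

(** With a common boundary the sides may be taken to be identities, and whiskering by an identity
    changes a cell only by thin unitors. Hence the quotient identifies no two distinct parallel
    3-morphisms. *)
Lemma sims3_eq {x y : G} {s t : cell1 x y} (L L' : cell2 s t) :
  sims3 L L' -> L = L'.
Proof.
intros l. apply like2_eq.
apply (like2_trans (like2_sym (like2_lunit L))).
apply (like2_trans (sims3_any l (coh_id S y) (coh_id S x))), like2_runit.
Qed.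

Lemma sims3_trans {x y x' y' x'' y'' : G} {s t : cell1 x y}
    {s' t' : cell1 x' y'} {s'' t'' : cell1 x'' y''} {L : cell2 s t}
    {L' : cell2 s' t'} {L'' : cell2 s'' t''} :
  sims3 L L' -> sims3 L' L'' -> sims3 L L''.
Proof.
intros (c & c' & h & h' & l) (d & d' & k & k' & m).
exists (d * c), (d' * c').
split; [now apply coh_comp | split; [now apply coh_comp |]].
rewrite <- !hcomp_id.
apply (like2_trans (like2_assoc _ _ _)).
apply (like2_trans (like2_whiskl (reflexivity d) l)).
apply (like2_trans (like2_sym (like2_assoc _ _ _))).
apply (like2_trans (like2_whiskr (reflexivity c') m)), like2_assoc.
Qed.

Lemma sims3_sym {x y x' y' : G} {s t : cell1 x y} {s' t' : cell1 x' y'}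
    {L : cell2 s t} {L' : cell2 s' t'} : sims3 L L' -> sims3 L' L.
Proof.
intros (c & c' & h & h' & l).
destruct (coh_inv h) as (d & k), (coh_inv h') as (d' & k').
exists d, d'. split; [exact k | split; [exact k' |]].
assert (e : like1 (c' * d') (id1 x')) by now apply like1_coh_id, coh_comp.
assert (e' : like1 (d * c) (id1 y)) by now apply like1_coh_id, coh_comp.
apply (like2_trans (L' := d <| (L' |> (c' * d')))).
{ apply like2_whiskl; [reflexivity |].
  apply like2_sym, (like2_trans (like2_whiskr e (like2_refl _))).
  apply like2_runit. }
apply (like2_trans (L' := (d <| (L' |> c')) |> d')).
{ apply like2_sym, (like2_trans (like2_assoc _ _ _)).
  apply like2_whiskl; [reflexivity |].
  apply (like2_trans (like2_assoc _ _ _)). rewrite hcomp_id.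
  apply like2_refl. }
apply like2_whiskr; [reflexivity |].
apply (like2_trans (like2_whiskl (reflexivity d) (like2_sym l))).
apply (like2_trans (like2_sym (like2_assoc _ _ _))). rewrite hcomp_id.
apply (like2_trans (like2_whiskl e' (like2_refl _))), like2_lunit.
Qed.

Lemma sims3_vcomp {x y x' y' : G} {s t u : cell1 x y} {s' t' u' : cell1 x' y'}
    {M : cell2 t u} {M' : cell2 t' u'} {L : cell2 s t} {L' : cell2 s' t'} :
  sims3 M M' -> sims3 L L' -> sims3 (M \o L) (M' \o L').
Proof.
intros hM (c & c' & h & h' & l). exists c, c'.
split; [exact h | split; [exact h' |]].
(* Doubling the identity on each side lets the interchange law split the whiskered composite into
   two whiskered factors. *)
rewrite <- (vcomp1l (id2 c)), <- (vcomp1l (id2 c')), !interchange.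
apply like2_vcomp; [now apply sims3_any | exact l].
Qed.

(** The coherent morphism moves from left to right: past [M] it turns from [d] into [c], past [L]
    from [c] into [c']. Taking the same [c] both times is allowed by [sims3_any]. *)
Lemma sims3_hcomp {x y z x' y' z' : G} {g h : cell1 y z} {g' h' : cell1 y' z'}
    {s t : cell1 x y} {s' t' : cell1 x' y'} {M : cell2 g h} {M' : cell2 g' h'}
    {L : cell2 s t} {L' : cell2 s' t'} :
  sims3 M M' -> sims3 L L' -> sims3 (M ** L) (M' ** L').
Proof.
intros hM (c & c' & k & k' & l). pose proof hM as (d & _ & kd & _).
exists d, c'. split; [exact kd | split; [exact k' |]].
apply (like2_trans (like2_sym (like2_assoc _ _ _))).
apply (like2_trans (like2_hcomp (sims3_any hM kd k) (like2_refl L))).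
apply (like2_trans (like2_assoc _ _ _)).
apply (like2_trans (like2_hcomp (like2_refl M') l)).
apply like2_sym, like2_assoc.
Qed.

(** For thin cells similarity is a condition on the sources alone, which settles all constraint
    cells known to lie in C_3. *)
Lemma sims3_thin {x y x' y' : G} {s t : cell1 x y} {s' t' : cell1 x' y'}
    (L : cell2 s t) (L' : cell2 s' t') :
  thin S L -> thin S L' -> sims2 s s' -> sims3 L L'.
Proof.
intros l l' (c & c' & h & h' & k). exists c, c'.
split; [exact h | split; [exact h' |]].
apply like2_thin; [| | exact k]; apply thin_hcomp; trivial; apply thin_id.
Qed.

Lemma sims3_id {x y x' y' : G} {s : cell1 x y} {s' : cell1 x' y'} :
  sims2 s s' -> sims3 (id2 s) (id2 s').
Proof. apply sims3_thin; apply thin_id. Qed.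

(** Inverse structure cells of functors and transformations are separate data; their
    well-definedness is reduced to that of the cells themselves. *)
Lemma sims3_inverse {x y x' y' : G} {s t : cell1 x y} {s' t' : cell1 x' y'}
    {L : cell2 s t} {M : cell2 t s} {L' : cell2 s' t'} {M' : cell2 t' s'} :
  inverse2 L M -> inverse2 L' M' -> sims3 L L' -> sims3 M M'.
Proof.
intros i i' (c & c' & h & h' & k). exists c, c'.
split; [exact h | split; [exact h' |]].
assert (id2K : forall (x y : G) (f : cell1 x y), inverse2 (id2 f) (id2 f))
  by (intros; split; apply vcomp1l).
refine (like2_inverse _ _ k); now apply inverse2_hcomp.
Qed.

Lemma sims3_transport {x y x' y' : G} {s t : cell1 x y} {s' t' : cell1 x' y'}
    (L : cell2 s t) :
  sims2 s s' -> sims2 t t' -> exists L' : cell2 s' t', sims3 L L'.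
Proof.
intros hs ht. pose proof hs as (c & c' & h & h' & _).
destruct (coh_inv h') as (d' & k').
assert (e : like1 (c' * d') (id1 x')) by now apply like1_coh_id, coh_comp.
assert (e' : like1 (d' * c') (id1 x)) by now apply like1_coh_id, coh_comp.
(* Whiskering [L] with [c] and changing its boundary gives a cell [M : s' * c' -> t' * c'];
   whiskering with the reverse [d'] then removes [c']. *)
destruct (like2_transport (c <| L) (sims2_any hs h h') (sims2_any ht h h'))
  as (M & m).
assert (a : forall r : cell1 x' y', like1 (r * c' * d') r)
  by (intros r; now rewrite like1_assoc, e, like1_runit).
destruct (like2_transport (M |> d') (a s') (a t')) as (L' & l).
exists L', c, c'. split; [exact h | split; [exact h' |]].
apply (like2_trans m). apply like2_sym.
apply (like2_trans (like2_whiskr (reflexivity c') (like2_sym l))).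
apply (like2_trans (like2_assoc _ _ _)). rewrite hcomp_id.
apply (like2_trans (like2_whiskr e' (like2_refl M))), like2_runit.
Qed.

End Thin.

(** * Quotients *)

(* A cell of G is related to a cell of G' when the latter is its class. *)
Record quotient_of (G : globset2) (B : bicat G) (S : thin_system B)
    (G' : globset2) := QuotientOf {
  r0 : G -> G' -> Prop;
  r1 : forall (x y : G) (x' y' : G'), cell1 x y -> cell1 x' y' -> Prop;
  r2 : forall (x y : G) (x' y' : G') (f g : cell1 x y) (f' g' : cell1 x' y'),
    cell2 f g -> cell2 f' g' -> Prop;
  r0_total : forall x, exists x', r0 x x';
  r0_onto : forall x', exists x, r0 x x';
  r0_fun : forall x x' y', r0 x x' -> r0 x y' -> x' = y';
  r0_sims : forall x y x', r0 x x' -> (r0 y x' <-> sims1 S x y);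
  r1_total : forall x y x' y' (f : cell1 x y), r0 x x' -> r0 y y' ->
    exists f' : cell1 x' y', r1 f f';
  r1_onto : forall x' y' (f' : cell1 x' y'),
    exists (x y : G) (f : cell1 x y), r1 f f';
  r1_fun : forall x y x' y' (f : cell1 x y) (f' g' : cell1 x' y'),
    r1 f f' -> r1 f g' -> f' = g';
  r1_bd : forall x y x' y' (f : cell1 x y) (f' : cell1 x' y'),
    r1 f f' -> r0 x x' /\ r0 y y';
  r1_sims : forall x y z w x' y' (f : cell1 x y) (g : cell1 z w)
    (f' : cell1 x' y'), r1 f f' -> (r1 g f' <-> sims2 S f g);
  r2_total : forall x y x' y' (f g : cell1 x y) (f' g' : cell1 x' y')
    (C : cell2 f g), r1 f f' -> r1 g g' -> exists C' : cell2 f' g', r2 C C';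
  r2_onto : forall x' y' (f' g' : cell1 x' y') (C' : cell2 f' g'),
    exists (x y : G) (f g : cell1 x y) (C : cell2 f g), r2 C C';
  r2_fun : forall x y x' y' (f g : cell1 x y) (f' g' : cell1 x' y')
    (C : cell2 f g) (C' D' : cell2 f' g'), r2 C C' -> r2 C D' -> C' = D';
  r2_bd : forall x y x' y' (f g : cell1 x y) (f' g' : cell1 x' y')
    (C : cell2 f g) (C' : cell2 f' g'), r2 C C' -> r1 f f' /\ r1 g g';
  r2_sims : forall x y z w x' y' (f g : cell1 x y) (h k : cell1 z w)
    (f' g' : cell1 x' y') (C : cell2 f g) (D : cell2 h k) (C' : cell2 f' g'),
    r2 C C' -> (r2 D C' <-> sims3 S C D) }.
Arguments r0 {G B S G'} R x x' : rename.
Arguments r1 {G B S G'} R {x y x' y'} f f' : rename.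
Arguments r2 {G B S G'} R {x y x' y' f g f' g'} C C' : rename.
Arguments r0_total {G B S G'} R x : rename.
Arguments r0_onto {G B S G'} R x' : rename.
Arguments r2_fun {G B S G'} R {x y x' y' f g f' g'} C {C' D'} : rename.

Section Lifting.
Context {G : globset2} {B : bicat G} {S : thin_system B} {G' : globset2}
  (R : quotient_of S G').

(** An arbitrary representative is moved to the prescribed endpoints by [sims2_transport]; this
    makes composable classes have composable representatives. *)
Lemma r1_lift {x y : G} {x' y' : G'} (f' : cell1 x' y') :
  r0 R x x' -> r0 R y y' -> exists f : cell1 x y, r1 R f f'.
Proof.
intros hx hy. destruct (r1_onto R f') as (z & w & g & hg).
destruct (r1_bd hg) as [hz hw].
destruct (sims2_transport g (proj1 (r0_sims x hz) hx) (proj1 (r0_sims y hw) hy))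
  as (f & hf).
exists f. now apply (r1_sims f hg).
Qed.

Lemma r2_lift {x y : G} {x' y' : G'} {f g : cell1 x y} {f' g' : cell1 x' y'}
    (C' : cell2 f' g') :
  r1 R f f' -> r1 R g g' -> exists C : cell2 f g, r2 R C C'.
Proof.
intros hf hg. destruct (r2_onto R C') as (z & w & h & k & D & hD).
destruct (r2_bd hD) as [hh hk].
destruct (sims3_transport D (proj1 (r1_sims f hh) hf) (proj1 (r1_sims g hk) hg))
  as (C & hC).
exists C. now apply (r2_sims C hD).
Qed.

Lemma r2_inj {x y : G} {x' y' : G'} {f g : cell1 x y} {f' g' : cell1 x' y'}
    (C D : cell2 f g) (C' : cell2 f' g') : r2 R C C' -> r2 R D C' -> C = D.
Proof. intros hC hD. apply (sims3_eq (S := S)). now apply (r2_sims D hC). Qed.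

(** [r1_fun] needs equal boundaries, but those of the two classes are only provably equal: they are
    identified first, since both are classes of the endpoints of [f]. *)
Lemma r1_tot1 {x y : G} {x' y' x'' y'' : G'} (f : cell1 x y)
    (f' : cell1 x' y') (f'' : cell1 x'' y'') :
  r1 R f f' -> r1 R f f'' -> f' =1 f''.
Proof.
intros h h'. destruct (r1_bd h) as [a b], (r1_bd h') as [a' b'].
destruct (r0_fun a a'), (r0_fun b b'). now destruct (r1_fun h h').
Qed.

Lemma r2_tot2 {x y : G} {x' y' x'' y'' : G'} {f g : cell1 x y}
    {f' g' : cell1 x' y'} {f'' g'' : cell1 x'' y''}
    (C : cell2 f g) (C' : cell2 f' g') (C'' : cell2 f'' g'') :
  r2 R C C' -> r2 R C C'' -> C' =2 C''.
Proof.
intros h h'. destruct (r2_bd h) as [a b], (r2_bd h') as [a' b'].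
destruct (r1_bd a) as [c d], (r1_bd a') as [c' d'].
destruct (r0_fun c c'), (r0_fun d d').
destruct (r1_fun a a'), (r1_fun b b'). now destruct (r2_fun _ _ h h').
Qed.

Lemma r0_sims1 {x y : G} {x' : G'} : r0 R x x' -> r0 R y x' -> sims1 S x y.
Proof. intros h. now apply (r0_sims y h). Qed.

Lemma r1_sims2 {x y z w : G} {x' y' : G'} {f : cell1 x y} {g : cell1 z w}
    {f' : cell1 x' y'} : r1 R f f' -> r1 R g f' -> sims2 S f g.
Proof. intros h. now apply (r1_sims g h). Qed.

Lemma r2_sims3 {x y z w : G} {x' y' : G'} {f g : cell1 x y} {h k : cell1 z w}
    {f' g' : cell1 x' y'} {C : cell2 f g} {D : cell2 h k} {C' : cell2 f' g'} :
  r2 R C C' -> r2 R D C' -> sims3 S C D.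
Proof. intros i. now apply (r2_sims D i). Qed.

End Lifting.

(** * The terminal bicategory and products *)

Section Products.

Definition unit_thin : thin_system unit_bicat.
Proof.
refine (@ThinSystem unitg unit_bicat (fun _ _ _ => True) (fun _ _ _ _ _ => True)
  _ _ _ _ _ _ _ _ _ _ _ _); try (intros; exact I).
- now exists tt.
- now exists tt.
- intros x y f g C _. exists tt. now repeat split.
- intros x y f g C D _ _. now destruct C, D.
Defined.

Definition unit_quotient : quotient_of unit_thin unitg.
Proof.
refine (@QuotientOf unitg unit_bicat unit_thin unitg
  (fun _ _ => True) (fun _ _ _ _ _ _ => True)
  (fun _ _ _ _ _ _ _ _ _ _ => True) _ _ _ _ _ _ _ _ _ _ _ _ _ _);
  try (intros; exact I).
- now exists tt.
- now exists tt.
- intros x [] [] _ _. reflexivity.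
- split; [intros _ | trivial]. now exists tt.
- now exists tt.
- now exists tt, tt, tt.
- intros x y x' y' f f' g' _ _. now destruct f', g'.
- now split.
- split; [intros _ | trivial]. exists tt, tt. repeat split. now exists tt.
- now exists tt.
- now exists tt, tt, tt, tt, tt.
- intros x y x' y' f g f' g' C C' D' _ _. now destruct C', D'.
- now split.
- split; [intros _ | trivial]. exists tt, tt. repeat split.
  exists tt, tt. now repeat split.
Defined.

Context {G H : globset2} {BG : bicat G} {BH : bicat H}
  (SG : thin_system BG) (SH : thin_system BH).

Definition prod_thin : thin_system (prod_bicat BG BH).
Proof.
refine (@ThinSystem (prodg G H) (prod_bicat BG BH)
  (fun _ _ c => coh SG (fst c) /\ coh SH (snd c))
  (fun _ _ _ _ C => thin SG (fst C) /\ thin SH (snd C))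
  _ _ _ _ _ _ _ _ _ _ _ _).
- intros x. split; apply coh_id.
- intros x y z d c [h h'] [k k']. split; now apply coh_comp.
- intros x y c [h h'].
  destruct (coh_inv h) as (d & k), (coh_inv h') as (d' & k'). now exists (d,
    d').
- intros x y c d [h h'] [k k'].
  destruct (thin_coh h k) as (C & l), (thin_coh h' k') as (D & l').
  now exists (C, D).
- intros x y f. split; apply thin_id.
- intros x y f g h D C [d d'] [c c']. split; now apply thin_vcomp.
- intros x y z g g' f f' D C [d d'] [c c']. split; now apply thin_hcomp.
- intros x y f g C [c c'].
  destruct (thin_inv c) as (D & [i j] & d), (thin_inv c') as (D' & [i' j'] &
    d').
  exists (D, D'). split; [| now split].
  split; [exact (f_equal2 pair i i') | exact (f_equal2 pair j j')].
- intros x y f g [C C'] [D D'] [c c'] [d d'].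
  exact (f_equal2 pair (thin_parallel c d) (thin_parallel c' d')).
- intros. split; apply thin_assoc.
- intros. split; apply thin_lunitor.
- intros. split; apply thin_runitor.
Defined.

Lemma prod_sims1 (x y : prodg G H) :
  sims1 prod_thin x y <-> sims1 SG (fst x) (fst y) /\ sims1 SH (snd x) (snd y).
Proof.
split.
- intros (c & h & h'). split; [now exists (fst c) | now exists (snd c)].
- intros [(c & h) (d & k)]. now exists (c, d).
Qed.

Lemma prod_sims2 (x y z w : prodg G H) (f : cell1 x y) (g : cell1 z w) :
  sims2 prod_thin f g <->
  sims2 SG (fst f) (fst g) /\ sims2 SH (snd f) (snd g).
Proof.
split.
- intros (c & d & [h h'] & [k k'] & C & l & l').
  split; [exists (fst c), (fst d) | exists (snd c), (snd d)];
    repeat split; trivial; [now exists (fst C) | now exists (snd C)].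
- intros [(c & d & h & k & C & l) (c' & d' & h' & k' & C' & l')].
  exists (c, c'), (d, d'). repeat split; trivial. now exists (C, C').
Qed.

Lemma prod_sims3 (x y z w : prodg G H) (f g : cell1 x y) (h k : cell1 z w)
    (L : cell2 f g) (M : cell2 h k) :
  sims3 prod_thin L M <->
  sims3 SG (fst L) (fst M) /\ sims3 SH (snd L) (snd M).
Proof.
split.
- intros (c & d & [i i'] & [j j'] & C & D & [l l'] & [m m'] & e).
  split; [exists (fst c), (fst d) | exists (snd c), (snd d)];
    repeat split; trivial;
    [exists (fst C), (fst D) | exists (snd C), (snd D)];
    repeat split; trivial;
    [exact (f_equal fst e) | exact (f_equal snd e)].
- intros [(c & d & i & j & C & D & l & m & e)
    (c' & d' & i' & j' & C' & D' & l' & m' & e')].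
  exists (c, c'), (d, d'). repeat split; trivial.
  exists (C, C'), (D, D'). repeat split; trivial. exact (f_equal2 pair e e').
Qed.

Definition prod_quotient (G' H' : globset2) (RG : quotient_of SG G')
    (RH : quotient_of SH H') : quotient_of prod_thin (prodg G' H').
Proof.
refine (@QuotientOf (prodg G H) _ prod_thin (prodg G' H')
  (fun x x' => r0 RG (fst x) (fst x') /\ r0 RH (snd x) (snd x'))
  (fun _ _ _ _ f f' => r1 RG (fst f) (fst f') /\ r1 RH (snd f) (snd f'))
  (fun _ _ _ _ _ _ _ _ C C' =>
    r2 RG (fst C) (fst C') /\ r2 RH (snd C) (snd C'))
  _ _ _ _ _ _ _ _ _ _ _ _ _ _).
- intros [x y].
  destruct (r0_total RG x) as (x' & h), (r0_total RH y) as (y' & k).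
  now exists (x', y').
- intros [x' y'].
  destruct (r0_onto RG x') as (x & h), (r0_onto RH y') as (y & k).
  now exists (x, y).
- intros x [x1 x2] [y1 y2] [h h'] [k k'].
  exact (f_equal2 pair (r0_fun h k) (r0_fun h' k')).
- intros x y x' [h h'].
  rewrite prod_sims1, (r0_sims (fst y) h), (r0_sims (snd y) h'). reflexivity.
- intros x y x' y' f [h h'] [k k'].
  destruct (r1_total (fst f) h k) as (g & l),
    (r1_total (snd f) h' k') as (g' & l').
  now exists (g, g').
- intros x' y' f'.
  destruct (r1_onto RG (fst f')) as (x & y & f & h),
    (r1_onto RH (snd f')) as (z & w & g & k).
  now exists (x, z), (y, w), (f, g).
- intros x y x' y' f [f1 f2] [g1 g2] [h h'] [k k'].
  exact (f_equal2 pair (r1_fun h k) (r1_fun h' k')).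
- intros x y x' y' f f' [h h'].
  destruct (r1_bd h), (r1_bd h'). now repeat split.
- intros x y z w x' y' f g f' [h h'].
  rewrite prod_sims2, (r1_sims (fst g) h), (r1_sims (snd g) h'). reflexivity.
- intros x y x' y' f g f' g' C [h h'] [k k'].
  destruct (r2_total (fst C) h k) as (D & l),
    (r2_total (snd C) h' k') as (D' & l').
  now exists (D, D').
- intros x' y' f' g' C'.
  destruct (r2_onto RG (fst C')) as (x & y & f & g & C & h),
    (r2_onto RH (snd C')) as (z & w & f1 & g1 & D & k).
  now exists (x, z), (y, w), (f, f1), (g, g1), (C, D).
- intros x y x' y' f g f' g' C [C1 C2] [D1 D2] [h h'] [k k'].
  exact (f_equal2 pair (r2_fun _ _ h k) (r2_fun _ _ h' k')).
- intros x y x' y' f g f' g' C C' [h h'].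
  destruct (r2_bd h), (r2_bd h'). now repeat split.
- intros x y z w x' y' f g h k f' g' C D C' [i i'].
  rewrite prod_sims3, (r2_sims (fst D) i), (r2_sims (snd D) i'). reflexivity.
Defined.

End Products.

(** * Quotient bicategories *)

(** Kept apart from [bicat_rel] because the boundaries of the constraint cells are written with the
    operations, which must be constructed before those cells can be sought. *)
Record ops_rel (G : globset2) (B : bicat G) (S : thin_system B)
    (G' : globset2) (R : quotient_of S G') (O' : bicat_ops G') : Prop := {
  br_id1 : forall x x', r0 R x x' -> r1 R (id1 x) (id1 x');
  br_comp1 : forall x y z x' y' z' (g : cell1 y z) (f : cell1 x y)
    (g' : cell1 y' z') (f' : cell1 x' y'),
    r1 R g g' -> r1 R f f' -> r1 R (g * f) (g' * f');
  br_id2 : forall x y x' y' (f : cell1 x y) (f' : cell1 x' y'),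
    r1 R f f' -> r2 R (id2 f) (id2 f');
  br_vcomp : forall x y x' y' (f g h : cell1 x y) (f' g' h' : cell1 x' y')
    (D : cell2 g h) (C : cell2 f g) (D' : cell2 g' h') (C' : cell2 f' g'),
    r2 R D D' -> r2 R C C' -> r2 R (D \o C) (D' \o C');
  br_hcomp : forall x y z x' y' z' (g h : cell1 y z) (f k : cell1 x y)
    (g' h' : cell1 y' z') (f' k' : cell1 x' y')
    (D : cell2 g h) (C : cell2 f k) (D' : cell2 g' h') (C' : cell2 f' k'),
    r2 R D D' -> r2 R C C' -> r2 R (D ** C) (D' ** C') }.

Record bicat_rel (G : globset2) (B : bicat G) (S : thin_system B)
    (G' : globset2) (R : quotient_of S G') (B' : bicat G') : Prop := {
  br_ops :> ops_rel R bops;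
  br_assoc : forall x y z w x' y' z' w'
    (h : cell1 z w) (g : cell1 y z) (f : cell1 x y)
    (h' : cell1 z' w') (g' : cell1 y' z') (f' : cell1 x' y'),
    r1 R h h' -> r1 R g g' -> r1 R f f' ->
    r2 R (assoc h g f) (assoc h' g' f');
  br_assoc_inv : forall x y z w x' y' z' w'
    (h : cell1 z w) (g : cell1 y z) (f : cell1 x y)
    (h' : cell1 z' w') (g' : cell1 y' z') (f' : cell1 x' y'),
    r1 R h h' -> r1 R g g' -> r1 R f f' ->
    r2 R (assoc_inv h g f) (assoc_inv h' g' f');
  br_lunitor : forall x y x' y' (f : cell1 x y) (f' : cell1 x' y'),
    r1 R f f' -> r2 R (lunitor f) (lunitor f');
  br_lunitor_inv : forall x y x' y' (f : cell1 x y) (f' : cell1 x' y'),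
    r1 R f f' -> r2 R (lunitor_inv f) (lunitor_inv f');
  br_runitor : forall x y x' y' (f : cell1 x y) (f' : cell1 x' y'),
    r1 R f f' -> r2 R (runitor f) (runitor f');
  br_runitor_inv : forall x y x' y' (f : cell1 x y) (f' : cell1 x' y'),
    r1 R f f' -> r2 R (runitor_inv f) (runitor_inv f') }.

(* Replaces every variable cell on the quotient side by a representative. *)
Ltac lift_cells :=
  repeat match goal with
  | R : quotient_of ?S ?G', x' : cell0 ?G' |- _ =>
    lazymatch goal with
    | _ : r0 R _ x' |- _ => fail
    | _ => let x := fresh "x" in let h := fresh "h" in
           destruct (r0_onto R x') as [x h]
    end
  end;
  repeat match goal with
  | R : quotient_of ?S ?G', hx : r0 ?R _ ?x', hy : r0 ?R _ ?y',
    f' : @cell1 ?G' ?x' ?y' |- _ =>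
    lazymatch goal with
    | _ : r1 R _ f' |- _ => fail
    | _ => let f := fresh "f" in let h := fresh "h" in
           destruct (r1_lift f' hx hy) as [f h]
    end
  end;
  repeat match goal with
  | R : quotient_of ?S ?G', hf : r1 ?R _ ?f', hg : r1 ?R _ ?g',
    C' : @cell2 ?G' _ _ ?f' ?g' |- _ =>
    lazymatch goal with
    | _ : r2 R _ C' |- _ => fail
    | _ => let C := fresh "C" in let h := fresh "h" in
           destruct (r2_lift C' hf hg) as [C h]
    end
  end.

Create HintDb rel discriminated.
#[export] Hint Resolve br_id1 br_comp1 br_id2 br_vcomp br_hcomp : rel.

Section ThinInverses.
Context {G : globset2} {B : bicat G} (S : thin_system B).

Lemma thin_assoc_inv {x y z w : G} (h : cell1 z w) (g : cell1 y z)
  (f : cell1 x y) : thin S (assoc_inv h g f).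
Proof. apply (thin_inverse (assocK h g f)), thin_assoc. Qed.

Lemma thin_lunitor_inv {x y : G} (f : cell1 x y) : thin S (lunitor_inv f).
Proof. apply (thin_inverse (lunitorK f)), thin_lunitor. Qed.

Lemma thin_runitor_inv {x y : G} (f : cell1 x y) : thin S (runitor_inv f).
Proof. apply (thin_inverse (runitorK f)), thin_runitor. Qed.

End ThinInverses.

#[export] Hint Resolve thin_assoc_inv thin_lunitor_inv thin_runitor_inv
  coh_id sims2_coh sims2_comp sims3_id sims3_vcomp sims3_hcomp sims3_thin
  thin_id thin_assoc thin_lunitor thin_runitor : sims.
#[export] Hint Extern 1 (sims1 _ _ _) => eapply r0_sims1; eassumption : sims.
#[export] Hint Extern 2 (sims1 _ _ _) =>
  eapply proj1, sims2_bd, r1_sims2; eassumption : sims.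
#[export] Hint Extern 2 (sims1 _ _ _) =>
  eapply proj2, sims2_bd, r1_sims2; eassumption : sims.
#[export] Hint Extern 1 (sims2 _ _ _) => eapply r1_sims2; eassumption : sims.
#[export] Hint Extern 1 (sims3 _ _ _) => eapply r2_sims3; eassumption : sims.

(* For goals [exists k, forall representatives, t is related to k]: the class of
   [t] at one choice of representatives is also its class at any other choice,
   because the construction of [t] respects similarity. *)
Ltac class_of_by solve_rel t :=
  let k := fresh "k" in let hk := fresh "hk" in
  lazymatch goal with
  | R : quotient_of _ ?G' |- exists _ : @cell1 ?G' ?x' ?y', _ =>
    assert (hk : exists k : @cell1 G' x' y', r1 R t k)
      by (eapply r1_total; solve_rel);
    destruct hk as [k hk]; exists k; intros; apply (r1_sims _ hk)
  | R : quotient_of _ ?G' |- exists _ : @cell2 ?G' _ _ ?f' ?g', _ =>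
    assert (hk : exists k : @cell2 G' _ _ f' g', r2 R t k)
      by (eapply r2_total; solve_rel);
    destruct hk as [k hk]; exists k; intros; apply (r2_sims _ hk)
  end; eauto 6 with sims.
Ltac rel_ops := eauto with rel.
Ltac class_of t := class_of_by rel_ops t.

Section Exists.
Context {G : globset2} {B : bicat G} {S : thin_system B} {G' : globset2}
  (R : quotient_of S G').

(** A sigma type, as the class becomes data of the quotient. Representatives exist only
    propositionally, hence the use of indefinite description; the choice is harmless because the
    class is determined by its boundary and any representative. *)
Lemma id1_class (x' : G') :
  {i : cell1 x' x' | forall x, r0 R x x' -> r1 R (id1 x) i}.
Proof.
apply constructive_indefinite_description. lift_cells.
class_of (id1 x).
Qed.

Lemma comp1_class {x' y' z' : G'} (g' : cell1 y' z') (f' : cell1 x' y') :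
  {k : cell1 x' z' | forall x y z (g : cell1 y z) (f : cell1 x y),
    r1 R g g' -> r1 R f f' -> r1 R (g * f) k}.
Proof.
apply constructive_indefinite_description. lift_cells.
class_of (f0 * f).
Qed.

Local Notation q_id1 x := (proj1_sig (id1_class x)).
Local Notation q_comp1 g f := (proj1_sig (comp1_class g f)).
#[local] Hint Extern 2 (r1 _ _ (q_id1 _)) =>
  apply (proj2_sig (id1_class _)) : rel.
#[local] Hint Extern 2 (r1 _ _ (q_comp1 _ _)) =>
  apply (proj2_sig (comp1_class _ _)) : rel.

Lemma id2_class {x' y' : G'} (f' : cell1 x' y') :
  {C' : cell2 f' f' | forall x y (f : cell1 x y),
    r1 R f f' -> r2 R (id2 f) C'}.
Proof.
apply constructive_indefinite_description. lift_cells.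
class_of (id2 f).
Qed.

Lemma vcomp_class {x' y' : G'} {f' g' h' : cell1 x' y'}
    (D' : cell2 g' h') (C' : cell2 f' g') :
  {E' : cell2 f' h' | forall x y (f g h : cell1 x y)
    (D : cell2 g h) (C : cell2 f g),
    r2 R D D' -> r2 R C C' -> r2 R (D \o C) E'}.
Proof.
apply constructive_indefinite_description. lift_cells.
class_of (C0 \o C).
Qed.

Lemma hcomp_class {x' y' z' : G'} {g' h' : cell1 y' z'} {f' k' : cell1 x' y'}
    (D' : cell2 g' h') (C' : cell2 f' k') :
  {E' : cell2 (q_comp1 g' f') (q_comp1 h' k') |
    forall x y z (g h : cell1 y z) (f k : cell1 x y)
    (D : cell2 g h) (C : cell2 f k),
    r2 R D D' -> r2 R C C' -> r2 R (D ** C) E'}.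
Proof.
apply constructive_indefinite_description. lift_cells.
class_of (C0 ** C).
Qed.

Lemma ops_exists : {O' : bicat_ops G' | ops_rel R O'}.
Proof.
exists (@BicatOps G' (fun x => q_id1 x) (fun _ _ _ g f => q_comp1 g f)
  (fun _ _ f => proj1_sig (id2_class f))
  (fun _ _ _ _ _ D C => proj1_sig (vcomp_class D C))
  (fun _ _ _ _ _ _ _ D C => proj1_sig (hcomp_class D C))).
split; cbn.
- intros x x'. apply (proj2_sig (id1_class x')).
- intros. now apply (proj2_sig (comp1_class _ _)).
- intros. now apply (proj2_sig (id2_class _)).
- intros. now apply (proj2_sig (vcomp_class _ _)).
- intros. now apply (proj2_sig (hcomp_class _ _)).
Qed.

Context {O' : bicat_ops G'} (OR : ops_rel R O').

Lemma assoc_class {x' y' z' w' : G'} (h' : cell1 z' w') (g' : cell1 y' z')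
    (f' : cell1 x' y') :
  {C' : cell2 (comp1 (comp1 h' g') f') (comp1 h' (comp1 g' f')) |
    forall x y z w (h : cell1 z w) (g : cell1 y z) (f : cell1 x y),
    r1 R h h' -> r1 R g g' -> r1 R f f' -> r2 R (assoc h g f) C'}.
Proof.
apply constructive_indefinite_description. lift_cells.
class_of (assoc f1 f0 f).
Qed.

Lemma assoc_inv_class {x' y' z' w' : G'} (h' : cell1 z' w')
    (g' : cell1 y' z') (f' : cell1 x' y') :
  {C' : cell2 (comp1 h' (comp1 g' f')) (comp1 (comp1 h' g') f') |
    forall x y z w (h : cell1 z w) (g : cell1 y z) (f : cell1 x y),
    r1 R h h' -> r1 R g g' -> r1 R f f' -> r2 R (assoc_inv h g f) C'}.
Proof.
apply constructive_indefinite_description. lift_cells.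
class_of (assoc_inv f1 f0 f).
Qed.

Lemma lunitor_class {x' y' : G'} (f' : cell1 x' y') :
  {C' : cell2 (comp1 (id1 y') f') f' | forall x y (f : cell1 x y),
    r1 R f f' -> r2 R (lunitor f) C'}.
Proof.
apply constructive_indefinite_description. lift_cells.
class_of (lunitor f).
Qed.

Lemma lunitor_inv_class {x' y' : G'} (f' : cell1 x' y') :
  {C' : cell2 f' (comp1 (id1 y') f') | forall x y (f : cell1 x y),
    r1 R f f' -> r2 R (lunitor_inv f) C'}.
Proof.
apply constructive_indefinite_description. lift_cells.
class_of (lunitor_inv f).
Qed.

Lemma runitor_class {x' y' : G'} (f' : cell1 x' y') :
  {C' : cell2 (comp1 f' (id1 x')) f' | forall x y (f : cell1 x y),
    r1 R f f' -> r2 R (runitor f) C'}.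
Proof.
apply constructive_indefinite_description. lift_cells.
class_of (runitor f).
Qed.

Lemma runitor_inv_class {x' y' : G'} (f' : cell1 x' y') :
  {C' : cell2 f' (comp1 f' (id1 x')) | forall x y (f : cell1 x y),
    r1 R f f' -> r2 R (runitor_inv f) C'}.
Proof.
apply constructive_indefinite_description. lift_cells.
class_of (runitor_inv f).
Qed.

Ltac q_rel :=
  first [ eassumption | lazymatch goal with
  | |- r1 _ _ (id1 _) => eapply (br_id1 OR)
  | |- r1 _ _ (comp1 _ _) => eapply (br_comp1 OR)
  | |- r2 _ _ (id2 _) => eapply (br_id2 OR)
  | |- r2 _ _ (vcomp _ _) => eapply (br_vcomp OR)
  | |- r2 _ _ (hcomp _ _) => eapply (br_hcomp OR)
  | |- r2 _ _ (proj1_sig (assoc_class _ _ _)) =>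
    eapply (proj2_sig (assoc_class _ _ _))
  | |- r2 _ _ (proj1_sig (assoc_inv_class _ _ _)) =>
    eapply (proj2_sig (assoc_inv_class _ _ _))
  | |- r2 _ _ (proj1_sig (lunitor_class _)) =>
    eapply (proj2_sig (lunitor_class _))
  | |- r2 _ _ (proj1_sig (lunitor_inv_class _)) =>
    eapply (proj2_sig (lunitor_inv_class _))
  | |- r2 _ _ (proj1_sig (runitor_class _)) =>
    eapply (proj2_sig (runitor_class _))
  | |- r2 _ _ (proj1_sig (runitor_inv_class _)) =>
    eapply (proj2_sig (runitor_inv_class _))
  end; q_rel ].

Ltac by_law law :=
  intros; lift_cells; eapply (r2_fun R);
  [ q_rel | rewrite law; q_rel ].

Lemma bicat_of_ops : {B' : bicat G' | bicat_rel R B'}.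
Proof.
simple refine (exist _ (@Bicat G' O'
  (fun _ _ _ _ h g f => proj1_sig (assoc_class h g f))
  (fun _ _ _ _ h g f => proj1_sig (assoc_inv_class h g f))
  (fun _ _ f => proj1_sig (lunitor_class f))
  (fun _ _ f => proj1_sig (lunitor_inv_class f))
  (fun _ _ f => proj1_sig (runitor_class f))
  (fun _ _ f => proj1_sig (runitor_inv_class f))
  _ _ _ _ _ _ _ _ _ _ _ _ _) _); cbv beta.
- by_law @vcompA.
- by_law @vcomp1l.
- by_law @vcomp1r.
- by_law @hcomp_id.
- by_law @interchange.
- split; [by_law uconstr:(proj1 (assocK _ _ _))| by_law uconstr:(proj2 (assocK
  _ _ _))].
- split; [by_law uconstr:(proj1 (lunitorK _))| by_law uconstr:(proj2 (lunitorK
  _))].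
- split; [by_law uconstr:(proj1 (runitorK _))| by_law uconstr:(proj2 (runitorK
  _))].
- by_law @assoc_natural.
- by_law @lunitor_natural.
- by_law @runitor_natural.
- by_law @pentagon.
- by_law @triangle.
- split; [exact OR | ..]; cbn; intros; q_rel.
Qed.

End Exists.

Lemma bicat_exists {G : globset2} {B : bicat G} {S : thin_system B}
    {G' : globset2} (R : quotient_of S G') : {B' : bicat G' | bicat_rel R B'}.
Proof. destruct (ops_exists R) as [O' OR]. exact (bicat_of_ops OR). Qed.

Lemma rel_inverse {G : globset2} {B : bicat G} {S : thin_system B}
    {G' : globset2} {R : quotient_of S G'} {B' : bicat G'}
    (br : bicat_rel R B') {x y : G} {x' y' : G'} {f g : cell1 x y}
    {f' g' : cell1 x' y'} {C : cell2 f g} {D : cell2 g f} {C' : cell2 f' g'}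
    {D' : cell2 g' f'} :
  r2 R C C' -> r2 R D D' -> inverse2 C D -> inverse2 C' D'.
Proof.
intros hC hD [DC CD]. destruct (r2_bd hC) as [hf hg].
split; eapply (r2_fun R).
- exact (br_vcomp br hD hC).
- rewrite DC. exact (br_id2 br hf).
- exact (br_vcomp br hC hD).
- rewrite CD. exact (br_id2 br hg).
Qed.

(** * Quotient functors *)

Existing Class bicat_rel.
Existing Class ops_rel.
#[export] Existing Instance br_ops.

#[export] Instance unit_bicat_rel : bicat_rel unit_quotient unit_bicat.
Proof. repeat split. Qed.

#[export] Instance prod_bicat_rel {G H G' H' : globset2} {BG : bicat G}
    {BH : bicat H} {SG : thin_system BG} {SH : thin_system BH}
    (RG : quotient_of SG G') (RH : quotient_of SH H') {BG' : bicat G'}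
    {BH' : bicat H'} (bG : bicat_rel RG BG') (bH : bicat_rel RH BH') :
  bicat_rel (prod_quotient RG RH) (prod_bicat BG' BH').
Proof.
destruct bG as [[]], bH as [[]].
split; [split |..]; cbn; intros;
  repeat match goal with h : _ /\ _ |- _ => destruct h end; auto.
Qed.

Section FunctorRel.
Context {G H G' H' : globset2} {BG : bicat G} {BH : bicat H}
  {SG : thin_system BG} {SH : thin_system BH} (RG : quotient_of SG G')
  (RH : quotient_of SH H').

Record gmap_rel (F : gmap G H) (F' : gmap G' H') : Prop := {
  gr_0 : forall x x', r0 RG x x' -> r0 RH (F x) (F' x');
  gr_1 : forall x y x' y' (f : cell1 x y) (f' : cell1 x' y'),
    r1 RG f f' -> r1 RH (map1 F f) (map1 F' f');
  gr_2 : forall x y x' y' (f g : cell1 x y) (f' g' : cell1 x' y')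
    (C : cell2 f g) (C' : cell2 f' g'),
    r2 RG C C' -> r2 RH (map2 F C) (map2 F' C') }.

Context {BG' : bicat G'} {BH' : bicat H'}.

Record prefunctor_rel (F : prefunctor G H) (F' : prefunctor G' H') : Prop := {
  pfr_gmap :> gmap_rel F F';
  pfr_comp : forall x y z x' y' z' (g : cell1 y z) (f : cell1 x y)
    (g' : cell1 y' z') (f' : cell1 x' y'),
    r1 RG g g' -> r1 RG f f' -> r2 RH (fcomp F g f) (fcomp F' g' f');
  pfr_unit : forall x x', r0 RG x x' -> r2 RH (funit F x) (funit F' x') }.

Record functor_rel (F : functor G H) (F' : functor G' H') : Prop := {
  fr_pre :> prefunctor_rel F F';
  fr_comp_inv : forall x y z x' y' z' (g : cell1 y z) (f : cell1 x y)
    (g' : cell1 y' z') (f' : cell1 x' y'),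
    r1 RG g g' -> r1 RG f f' -> r2 RH (fcomp_inv F g f) (fcomp_inv F' g' f');
  fr_unit_inv : forall x x', r0 RG x x' ->
    r2 RH (funit_inv F x) (funit_inv F' x') }.

End FunctorRel.
Existing Class gmap_rel.
Existing Class prefunctor_rel.
Existing Class functor_rel.
#[export] Existing Instance pfr_gmap.
#[export] Existing Instance fr_pre.

(** * Functors compatible with thin systems *)

Record thin_prefunctor {G H : globset2} {BG : bicat G} {BH : bicat H}
    (SG : thin_system BG) (SH : thin_system BH) (F : prefunctor G H) :
    Prop := {
  tf_coh : forall x y (c : cell1 x y), coh SG c -> coh SH (map1 F c);
  tf_thin : forall x y (f g : cell1 x y) (C : cell2 f g),
    thin SG C -> thin SH (map2 F C);
  tf_comp_l : forall x y z (g : cell1 y z) (f : cell1 x y),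
    coh SG g -> thin SH (fcomp F g f);
  tf_comp_r : forall x y z (g : cell1 y z) (f : cell1 x y),
    coh SG f -> thin SH (fcomp F g f);
  tf_unit : forall x, thin SH (funit F x) }.

Lemma map_sims1 {G H : globset2} {BG : bicat G} {BH : bicat H}
    {SG : thin_system BG} {SH : thin_system BH} {F : prefunctor G H}
    (tF : thin_prefunctor SG SH F) {x y : G} :
  sims1 SG x y -> sims1 SH (F x) (F y).
Proof. intros (c & h). exists (map1 F c). exact (tf_coh tF h). Qed.

Section ThinFunctor.
Context {G H : globset2} {BG : bicat G} {BH : bicat H}
  {SG : thin_system BG} {SH : thin_system BH} (F : functor G H)
  (tF : thin_prefunctor SG SH F).

Lemma map_like1 {x y : G} {f g : cell1 x y} :
  like1 SG f g -> like1 SH (map1 F f) (map1 F g).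
Proof. intros (C & h). exists (map2 F C). exact (tf_thin tF h). Qed.

Lemma map_comp_l {x y z : G} (g : cell1 y z) (f : cell1 x y) :
  coh SG g -> like1 SH (map1 F g * map1 F f) (map1 F (g * f)).
Proof. intros h. exists (fcomp F g f). exact (tf_comp_l tF f h). Qed.

Lemma map_comp_r {x y z : G} (g : cell1 y z) (f : cell1 x y) :
  coh SG f -> like1 SH (map1 F g * map1 F f) (map1 F (g * f)).
Proof. intros h. exists (fcomp F g f). exact (tf_comp_r tF g h). Qed.

#[local] Existing Instance like1_equivalence.
#[local] Existing Instance like1_comp.

(** In a similarity square the coherent factor is on the left in one composite and on the right in
    the other, so both one-sided conditions on the composition cells are used. *)
Lemma map_sims2 {x y z w : G} {f : cell1 x y} {g : cell1 z w} :
  sims2 SG f g -> sims2 SH (map1 F f) (map1 F g).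
Proof.
intros (c & c' & h & h' & l). exists (map1 F c), (map1 F c').
split; [exact (tf_coh tF h) | split; [exact (tf_coh tF h') |]].
rewrite (map_comp_l f h), (map_comp_r g h'). exact (map_like1 l).
Qed.

Lemma map_like2 {x y : G} {f g f' g' : cell1 x y} {L : cell2 f g}
    {L' : cell2 f' g'} :
  like2 SG L L' -> like2 SH (map2 F L) (map2 F L').
Proof.
intros (C & C' & c & c' & e). exists (map2 F C), (map2 F C').
split; [exact (tf_thin tF c) | split; [exact (tf_thin tF c') |]].
now rewrite <- !map2_vcomp, e.
Qed.

Lemma map_sims3 {x y z w : G} {f g : cell1 x y} {h k : cell1 z w}
    {L : cell2 f g} {M : cell2 h k} :
  sims3 SG L M -> sims3 SH (map2 F L) (map2 F M).
Proof.
intros (c & c' & i & i' & l). exists (map1 F c), (map1 F c').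
split; [exact (tf_coh tF i) | split; [exact (tf_coh tF i') |]].
(* The composition cells at a coherent argument are thin, so naturality of [fcomp] says exactly that
   whiskering commutes with [F] up to thin cells. *)
rewrite <- !map2_id. apply (like2_trans (L' := map2 F (c <| L))).
{ exists (fcomp F c g), (fcomp F c f).
  split; [exact (tf_comp_l tF g i) | split; [exact (tf_comp_l tF f i) |]].
  apply fcomp_natural. }
apply (like2_trans (map_like2 l)). apply like2_sym.
exists (fcomp F k c'), (fcomp F h c').
split; [exact (tf_comp_r tF k i') | split; [exact (tf_comp_r tF h i') |]].
apply fcomp_natural.
Qed.

Lemma fcomp_like2 {x y z : G} {g g' : cell1 y z} {f f' : cell1 x y} :
  like1 SG g g' -> like1 SG f f' -> like2 SH (fcomp F g f) (fcomp F g' f').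
Proof.
intros (D & d) (C & c). exists (map2 F (D ** C)), (map2 F D ** map2 F C).
split; [now apply (tf_thin tF), thin_hcomp |].
split; [apply thin_hcomp; now apply (tf_thin tF) |].
symmetry. apply fcomp_natural.
Qed.

Section Associativity.
Context {x y z w : G} (h : cell1 z w) (g : cell1 y z) (f : cell1 x y).

(** The associativity law with its two associators absorbed as thin comparison cells. *)
Lemma fcomp_assoc_like2 :
  like2 SH (fcomp F (h * g) f \o (fcomp F h g |> map1 F f))
    (fcomp F h (g * f) \o (map1 F h <| fcomp F g f)).
Proof.
exists (map2 F (assoc h g f)), (assoc (map1 F h) (map1 F g) (map1 F f)).
split; [apply (tf_thin tF), thin_assoc | split; [apply thin_assoc |]].
rewrite vcompA. apply fcomp_assoc.
Qed.

(* One of the three morphisms being coherence makes two of the four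
   interchangers in [fcomp_assoc] thin. *)
Lemma fcomp_coh1 :
  coh SG h -> like2 SH (map1 F h <| fcomp F g f) (fcomp F (h * g) f).
Proof.
intros c.
apply (like2_trans (like2_sym (like2_thin_l _ (tf_comp_l tF (g * f) c)))).
apply (like2_trans (like2_sym fcomp_assoc_like2)).
apply like2_thin_r, thin_hcomp; [now apply (tf_comp_l tF) | apply thin_id].
Qed.

Lemma fcomp_coh2 :
  coh SG g -> like2 SH (fcomp F (h * g) f) (fcomp F h (g * f)).
Proof.
intros c.
apply (like2_trans (L' := fcomp F (h * g) f \o (fcomp F h g |> map1 F f))).
{ apply like2_sym, like2_thin_r, thin_hcomp;
    [now apply (tf_comp_r tF) | apply thin_id]. }
apply (like2_trans fcomp_assoc_like2).
apply like2_thin_r, thin_hcomp; [apply thin_id | now apply (tf_comp_l tF)].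
Qed.

Lemma fcomp_coh3 :
  coh SG f -> like2 SH (fcomp F h g |> map1 F f) (fcomp F h (g * f)).
Proof.
intros c.
apply (like2_trans (like2_sym (like2_thin_l _ (tf_comp_r tF (h * g) c)))).
apply (like2_trans fcomp_assoc_like2).
apply like2_thin_r, thin_hcomp; [apply thin_id | now apply (tf_comp_r tF)].
Qed.

End Associativity.

(** With [φ] for [fcomp F], the chain is [F d <| φ(g, f)], [φ(d * g, f)], [φ(g' * c, f)],
    [φ(g', c * f)], [φ(g', f' * c')], [φ(g', f') |> F c']. The coherent morphism enters at the left,
    crosses the middle and leaves at the right. *)
Lemma fcomp_sims3 {x y z x' y' z' : G} {g : cell1 y z} {f : cell1 x y}
    {g' : cell1 y' z'} {f' : cell1 x' y'} :
  sims2 SG g g' -> sims2 SG f f' -> sims3 SH (fcomp F g f) (fcomp F g' f').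
Proof.
intros hg (c & c' & h & h' & l). pose proof hg as (d & _ & k & _).
exists (map1 F d), (map1 F c').
split; [exact (tf_coh tF k) | split; [exact (tf_coh tF h') |]].
apply (like2_trans (fcomp_coh1 g f k)).
apply (like2_trans (fcomp_like2 (sims2_any hg k h) (reflexivity f))).
apply (like2_trans (fcomp_coh2 g' f h)).
apply (like2_trans (fcomp_like2 (reflexivity g') l)).
apply like2_sym. exact (fcomp_coh3 g' f' h').
Qed.

Lemma fcomp_inv_sims3 {x y z x' y' z' : G} {g : cell1 y z} {f : cell1 x y}
    {g' : cell1 y' z'} {f' : cell1 x' y'} :
  sims2 SG g g' -> sims2 SG f f' ->
  sims3 SH (fcomp_inv F g f) (fcomp_inv F g' f').
Proof.
intros hg hf. refine (sims3_inverse _ _ (fcomp_sims3 hg hf)); apply fcompK.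
Qed.

Lemma funit_sims3 {x y : G} :
  sims1 SG x y -> sims3 SH (funit F x) (funit F y).
Proof.
intros h. apply sims3_thin; try apply (tf_unit tF).
apply sims2_coh; try apply coh_id. now apply (map_sims1 tF).
Qed.

Lemma funit_inv_sims3 {x y : G} :
  sims1 SG x y -> sims3 SH (funit_inv F x) (funit_inv F y).
Proof.
intros h. refine (sims3_inverse _ _ (funit_sims3 h)); apply funitK.
Qed.

End ThinFunctor.

(* A law on the quotient side follows from the law for representatives, since
   [rel] relates both of its sides to the corresponding expressions in
   representatives. *)
Ltac rel_hook := fail.
Ltac rel :=
  first [ eassumption | lazymatch goal with
  | |- r1 _ _ (id1 _) => eapply br_id1
  | |- r1 _ _ (comp1 _ _) => eapply br_comp1
  | |- r2 _ _ (id2 _) => eapply br_id2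
  | |- r2 _ _ (vcomp _ _) => eapply br_vcomp
  | |- r2 _ _ (hcomp _ _) => eapply br_hcomp
  | |- r2 _ _ (assoc _ _ _) => eapply br_assoc
  | |- r2 _ _ (assoc_inv _ _ _) => eapply br_assoc_inv
  | |- r2 _ _ (lunitor _) => eapply br_lunitor
  | |- r2 _ _ (lunitor_inv _) => eapply br_lunitor_inv
  | |- r2 _ _ (runitor _) => eapply br_runitor
  | |- r2 _ _ (runitor_inv _) => eapply br_runitor_inv
  | |- r0 _ _ (map0 _ _) => notypeclasses refine (gr_0 _ _)
  | |- r1 _ _ (map1 _ _) => notypeclasses refine (gr_1 _ _)
  | |- r2 _ _ (map2 _ _) => notypeclasses refine (gr_2 _ _)
  | |- r2 _ _ (fcomp _ _ _) => notypeclasses refine (pfr_comp _ _ _)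
  | |- r2 _ _ (funit _ _) => notypeclasses refine (pfr_unit _ _)
  | |- r2 _ _ (fcomp_inv _ _ _) => notypeclasses refine (fr_comp_inv _ _ _)
  | |- r2 _ _ (funit_inv _ _) => notypeclasses refine (fr_unit_inv _ _)
  | |- bicat_rel _ _ => typeclasses eauto
  | |- ops_rel _ _ => typeclasses eauto
  | |- gmap_rel _ _ _ _ => typeclasses eauto
  | |- prefunctor_rel _ _ _ _ => typeclasses eauto
  | |- functor_rel _ _ _ _ => typeclasses eauto
  | |- _ => rel_hook
  end; rel ].

Ltac rel_or_hyp := first [ solve [rel] | eauto ].
Ltac class_of t ::= class_of_by rel_or_hyp t.

Ltac by_law law :=
  intros; lift_cells;
  match goal with
  | R : quotient_of _ ?G' |- @eq (@cell2 ?G' _ _ _ _) _ _ => eapply (r2_fun R)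
  end; [ rel | rewrite law; rel ].

Section FunctorExists.
Context {G H G' H' : globset2} {BG : bicat G} {BH : bicat H}
  {SG : thin_system BG} {SH : thin_system BH} (RG : quotient_of SG G')
  (RH : quotient_of SH H') {BG' : bicat G'} {BH' : bicat H'}
  {bG : bicat_rel RG BG'} {bH : bicat_rel RH BH'}
  (F : functor G H) (tF : thin_prefunctor SG SH F).

Hint Resolve map_sims2 map_sims3 fcomp_sims3 fcomp_inv_sims3 funit_sims3
  funit_inv_sims3 : sims.

Lemma map0_class (x' : G') :
  {y' : H' | forall x, r0 RG x x' -> r0 RH (F x) y'}.
Proof.
apply constructive_indefinite_description. lift_cells.
destruct (r0_total RH (F x)) as (y' & hy). exists y'. intros z hz.
apply (r0_sims _ hy), (map_sims1 tF). now apply (r0_sims1 h).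
Qed.

Local Notation q0 x := (proj1_sig (map0_class x)).

Lemma map1_class {x' y' : G'} (f' : cell1 x' y') :
  {g' : cell1 (q0 x') (q0 y') | forall x y (f : cell1 x y),
    r1 RG f f' -> r1 RH (map1 F f) g'}.
Proof.
pose proof (proj2_sig (map0_class x')) as hx.
pose proof (proj2_sig (map0_class y')) as hy. cbn in hx, hy.
apply constructive_indefinite_description. lift_cells.
class_of (map1 F f).
Qed.

Lemma map2_class {x' y' : G'} {f' g' : cell1 x' y'} (C' : cell2 f' g') :
  {D' : cell2 (proj1_sig (map1_class f')) (proj1_sig (map1_class g')) |
    forall x y (f g : cell1 x y) (C : cell2 f g),
    r2 RG C C' -> r2 RH (map2 F C) D'}.
Proof.
pose proof (proj2_sig (map1_class f')) as hf.
pose proof (proj2_sig (map1_class g')) as hg. cbn in hf, hg.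
apply constructive_indefinite_description. lift_cells.
class_of (map2 F C).
Qed.

Lemma gmap_exists : {F' : gmap G' H' | gmap_rel RG RH F F'}.
Proof.
exists (@Gmap G' H' (fun x => q0 x) (fun _ _ f => proj1_sig (map1_class f))
  (fun _ _ _ _ C => proj1_sig (map2_class C))).
split; cbn; intros.
- now apply (proj2_sig (map0_class _)).
- now apply (proj2_sig (map1_class _)).
- now apply (proj2_sig (map2_class _)).
Qed.

Context {F' : gmap G' H'} {rF : gmap_rel RG RH F F'}.

Lemma fcomp_class {x' y' z' : G'} (g' : cell1 y' z') (f' : cell1 x' y') :
  {C' : cell2 (map1 F' g' * map1 F' f') (map1 F' (g' * f')) |
    forall x y z (g : cell1 y z) (f : cell1 x y),
    r1 RG g g' -> r1 RG f f' -> r2 RH (fcomp F g f) C'}.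
Proof.
apply constructive_indefinite_description. lift_cells.
class_of (fcomp F f0 f).
Qed.

Lemma fcomp_inv_class {x' y' z' : G'} (g' : cell1 y' z') (f' : cell1 x' y') :
  {C' : cell2 (map1 F' (g' * f')) (map1 F' g' * map1 F' f') |
    forall x y z (g : cell1 y z) (f : cell1 x y),
    r1 RG g g' -> r1 RG f f' -> r2 RH (fcomp_inv F g f) C'}.
Proof.
apply constructive_indefinite_description. lift_cells.
class_of (fcomp_inv F f0 f).
Qed.

Lemma funit_class (x' : G') :
  {C' : cell2 (id1 (F' x')) (map1 F' (id1 x')) |
    forall x, r0 RG x x' -> r2 RH (funit F x) C'}.
Proof.
apply constructive_indefinite_description. lift_cells.
class_of (funit F x).
Qed.

Lemma funit_inv_class (x' : G') :
  {C' : cell2 (map1 F' (id1 x')) (id1 (F' x')) |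
    forall x, r0 RG x x' -> r2 RH (funit_inv F x) C'}.
Proof.
apply constructive_indefinite_description. lift_cells.
class_of (funit_inv F x).
Qed.

End FunctorExists.

Section FunctorLaws.
Context {G H G' H' : globset2} {BG : bicat G} {BH : bicat H}
  {SG : thin_system BG} {SH : thin_system BH} (RG : quotient_of SG G')
  (RH : quotient_of SH H') {BG' : bicat G'} {BH' : bicat H'}
  {bG : bicat_rel RG BG'} {bH : bicat_rel RH BH'}
  (F : functor G H).

(** The laws need only relatedness of the data, not how the data were chosen; separating them from
    the construction keeps the chosen witnesses opaque in the proofs. *)
Lemma functor_of_data (F' : prefunctor G' H')
    {rF : prefunctor_rel RG RH F F'}
    (inv : forall (x y z : G') (g : cell1 y z) (f : cell1 x y),
      cell2 (map1 F' (g * f)) (map1 F' g * map1 F' f))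
    (uinv : forall x : G', cell2 (map1 F' (id1 x)) (id1 (F' x))) :
  (forall x y z x' y' z' (g : cell1 y z) (f : cell1 x y)
    (g' : cell1 y' z') (f' : cell1 x' y'), r1 RG g g' -> r1 RG f f' ->
    r2 RH (fcomp_inv F g f) (inv _ _ _ g' f')) ->
  (forall x x', r0 RG x x' -> r2 RH (funit_inv F x) (uinv x')) ->
  {F1 : functor G' H' | functor_rel RG RH F F1}.
Proof.
intros h h'.
simple refine (exist _ (@Functor G' H' _ _ F' inv uinv _ _ _ _ _ _ _ _) _);
  cbv beta.
- intros. lift_cells. eapply (rel_inverse bH); [rel | eauto | apply fcompK].
- intros. lift_cells. eapply (rel_inverse bH); [rel | eauto | apply funitK].
- by_law @map2_id.
- by_law @map2_vcomp.
- by_law @fcomp_natural.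
- by_law @fcomp_assoc.
- by_law @fcomp_lunit.
- by_law @fcomp_runit.
- now split.
Qed.

Lemma functor_exists (tF : thin_prefunctor SG SH F) :
  {F' : functor G' H' | functor_rel RG RH F F'}.
Proof.
destruct (gmap_exists RG RH tF) as [F0 rF].
assert (rF' : prefunctor_rel RG RH F (Prefunctor F0
  (fun _ _ _ g f => proj1_sig (fcomp_class tF g f))
  (fun x => proj1_sig (funit_class tF x)))).
{ split; [exact rF | ..]; cbn; intros.
  - now apply (proj2_sig (fcomp_class tF _ _)).
  - now apply (proj2_sig (funit_class tF _)). }
apply (functor_of_data (F' := Prefunctor F0 _ _)
  (inv := fun _ _ _ g f => proj1_sig (fcomp_inv_class tF g f))
  (uinv := fun x => proj1_sig (funit_inv_class tF x))); cbn; intros.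
- now apply (proj2_sig (fcomp_inv_class tF _ _)).
- now apply (proj2_sig (funit_inv_class tF _)).
Qed.

End FunctorLaws.

(** * Quotient transformations and modifications *)

Section TransRel.
Context {G H G' H' : globset2} {BG : bicat G} {BH : bicat H}
  {SG : thin_system BG} {SH : thin_system BH} (RG : quotient_of SG G')
  (RH : quotient_of SH H') {BG' : bicat G'} {BH' : bicat H'}.

Record pretrans_rel {F E : gmap G H} {F' E' : gmap G' H'}
    (s : pretrans F E) (s' : pretrans F' E') : Prop := {
  tr_ob : forall x x', r0 RG x x' -> r1 RH (s x) (s' x');
  tr_nat : forall x y x' y' (f : cell1 x y) (f' : cell1 x' y'),
    r1 RG f f' -> r2 RH (tnat s f) (tnat s' f') }.

Record trans_rel {F E : prefunctor G H} {F' E' : prefunctor G' H'}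
    (s : trans F E) (s' : trans F' E') : Prop := {
  tr_pre :> pretrans_rel s s';
  tr_nat_inv : forall x y x' y' (f : cell1 x y) (f' : cell1 x' y'),
    r1 RG f f' -> r2 RH (tnat_inv s f) (tnat_inv s' f') }.

Record imod_rel {F E : gmap G H} {F' E' : gmap G' H'}
    {s t : pretrans F E} {s' t' : pretrans F' E'}
    (m : imod s t) (m' : imod s' t') : Prop := {
  mr_ob : forall x x', r0 RG x x' -> r2 RH (m x) (m' x');
  mr_ob_inv : forall x x', r0 RG x x' -> r2 RH (mob_inv m x) (mob_inv m' x') }.

Record adjeq_rel {F E : prefunctor G H} {F' E' : prefunctor G' H'}
    (e : adjeq F E) (e' : adjeq F' E') : Prop := {
  ar_l : trans_rel (adj_l e) (adj_l e');
  ar_r : trans_rel (adj_r e) (adj_r e');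
  ar_unit : imod_rel (adj_unit e) (adj_unit e');
  ar_counit : imod_rel (adj_counit e) (adj_counit e') }.

End TransRel.
Existing Class pretrans_rel.
Existing Class trans_rel.
Existing Class imod_rel.
Existing Class adjeq_rel.
#[export] Existing Instances tr_pre ar_l ar_r ar_unit ar_counit.

Ltac rel_hook ::= lazymatch goal with
  | |- r1 _ _ (tob _ _) => notypeclasses refine (tr_ob _ _)
  | |- r2 _ _ (tnat _ _) => notypeclasses refine (tr_nat _ _)
  | |- r2 _ _ (tnat_inv _ _) => notypeclasses refine (tr_nat_inv _ _)
  | |- r2 _ (mob ?m _) (mob ?m' _) =>
    notypeclasses refine (mr_ob (m := m) (m' := m') _ _)
  | |- r2 _ (mob_inv ?m _) (mob_inv ?m' _) =>
    notypeclasses refine (mr_ob_inv (m := m) (m' := m') _ _)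
  | |- pretrans_rel _ _ _ _ => typeclasses eauto
  | |- trans_rel _ _ _ _ => typeclasses eauto
  | |- imod_rel _ _ _ _ => typeclasses eauto
  end.

(** The cell of T used in [r2_fun] is fixed by the given instance of the law instead of being
    inferred from the goal. *)
Ltac by_law_at law :=
  let e := fresh "e" in pose proof law as e;
  match goal with
  | R : quotient_of _ ?G' |- @eq (@cell2 ?G' _ _ _ _) _ _ =>
    lazymatch type of e with ?l = _ => apply (r2_fun R l) end
  end; [ rel | rewrite e; rel ].

(** * Transformations compatible with thin systems *)

Record thin_trans {G H : globset2} {BG : bicat G} {BH : bicat H}
    (SG : thin_system BG) (SH : thin_system BH) {F E : gmap G H}
    (s : pretrans F E) : Prop := {
  tt_ob : forall x, coh SH (s x);
  tt_nat : forall x y (f : cell1 x y), coh SG f -> thin SH (tnat s f) }.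

Record thin_adjeq {G H : globset2} {BG : bicat G} {BH : bicat H}
    (SG : thin_system BG) (SH : thin_system BH) {F E : prefunctor G H}
    (e : adjeq F E) : Prop := {
  ta_l : thin_trans SG SH (adj_l e);
  ta_r : thin_trans SG SH (adj_r e);
  ta_unit : forall x, thin SH (adj_unit e x);
  ta_counit : forall x, thin SH (adj_counit e x) }.

Section ThinTrans.
Context {G H : globset2} {BG : bicat G} {BH : bicat H}
  {SG : thin_system BG} {SH : thin_system BH} {F E : prefunctor G H}
  (tF : thin_prefunctor SG SH F) (tE : thin_prefunctor SG SH E)
  (s : trans F E) (ts : thin_trans SG SH s).

Lemma tob_sims2 {x y : G} : sims1 SG x y -> sims2 SH (s x) (s y).
Proof. intros h. apply sims2_coh; try apply (tt_ob ts). now apply (map_sims1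
  tF). Qed.

Lemma tnat_like2 {x y : G} {f g : cell1 x y} :
  like1 SG f g -> like2 SH (tnat s f) (tnat s g).
Proof.
intros (C & c). exists (s y <| map2 F C), (map2 E C |> s x).
split; [apply thin_hcomp; [apply thin_id | now apply (tf_thin tF)] |].
split; [apply thin_hcomp; [now apply (tf_thin tE) | apply thin_id] |].
symmetry. apply tnat_natural.
Qed.

(** Coherence of [g] makes [tnat s g] and the composition cells of [F] and [E] in [tnat_comp] thin;
    besides associators only the whiskered [tnat s f] is left. *)
Lemma tnat_coh_l {x y z : G} (g : cell1 y z) (f : cell1 x y) :
  coh SG g -> like2 SH (tnat s (g * f)) (map1 E g <| tnat s f).
Proof.
intros c.
apply (like2_trans (L' := tnat s (g * f) \o (fcomp E g f |> s x))).
{ apply like2_sym, like2_thin_r, thin_hcomp;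
    [now apply (tf_comp_l tE) | apply thin_id]. }
rewrite tnat_comp.
apply (like2_trans (like2_thin_l _ (thin_hcomp (thin_id SH _)
  (tf_comp_l tF f c)))).
apply (like2_trans (like2_thin_l _ (thin_assoc _ _ _ _))).
apply (like2_trans (like2_thin_l _ (thin_hcomp (tt_nat ts c)
  (thin_id SH _)))).
apply (like2_trans (like2_thin_l _ (thin_assoc_inv _ _ _ _))).
apply like2_thin_r, thin_assoc.
Qed.

Lemma tnat_coh_r {x y z : G} (g : cell1 y z) (f : cell1 x y) :
  coh SG f -> like2 SH (tnat s (g * f)) (tnat s g |> map1 F f).
Proof.
intros c.
apply (like2_trans (L' := tnat s (g * f) \o (fcomp E g f |> s x))).
{ apply like2_sym, like2_thin_r, thin_hcomp;
    [now apply (tf_comp_r tE) | apply thin_id]. }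
rewrite tnat_comp.
apply (like2_trans (like2_thin_l _ (thin_hcomp (thin_id SH _)
  (tf_comp_r tF g c)))).
apply (like2_trans (like2_thin_l _ (thin_assoc _ _ _ _))).
apply like2_thin_r.
apply thin_vcomp; [apply thin_assoc_inv |].
apply thin_vcomp; [| apply thin_assoc].
apply thin_hcomp; [apply thin_id | exact (tt_nat ts c)].
Qed.

(** The chain is [E c <| s_f], [s_(c * f)], [s_(g * c')], [s_g |> F c'], where [s_f] stands for
    [tnat s f]. *)
Lemma tnat_sims3 {x y z w : G} {f : cell1 x y} {g : cell1 z w} :
  sims2 SG f g -> sims3 SH (tnat s f) (tnat s g).
Proof.
intros (c & c' & h & h' & l). exists (map1 E c), (map1 F c').
split; [exact (tf_coh tE h) | split; [exact (tf_coh tF h') |]].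
apply (like2_trans (like2_sym (tnat_coh_l f h))).
apply (like2_trans (tnat_like2 l)). exact (tnat_coh_r g h').
Qed.

Lemma tnat_inv_sims3 {x y z w : G} {f : cell1 x y} {g : cell1 z w} :
  sims2 SG f g -> sims3 SH (tnat_inv s f) (tnat_inv s g).
Proof.
intros h. refine (sims3_inverse _ _ (tnat_sims3 h)); apply tnatK.
Qed.

End ThinTrans.

Section TransExists.
Context {G H G' H' : globset2} {BG : bicat G} {BH : bicat H}
  {SG : thin_system BG} {SH : thin_system BH} (RG : quotient_of SG G')
  (RH : quotient_of SH H') {BG' : bicat G'} {BH' : bicat H'}
  {bG : bicat_rel RG BG'} {bH : bicat_rel RH BH'}
  {F E : prefunctor G H} (tF : thin_prefunctor SG SH F)
  (tE : thin_prefunctor SG SH E) {F' E' : prefunctor G' H'}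
  {rF : prefunctor_rel RG RH F F'} {rE : prefunctor_rel RG RH E E'}.

Section Trans.
Context (s : trans F E) (ts : thin_trans SG SH s).
Hint Resolve tnat_sims3 tnat_inv_sims3 : sims.

Lemma tob_class (x' : G') :
  {f' : cell1 (F' x') (E' x') | forall x, r0 RG x x' -> r1 RH (s x) f'}.
Proof.
apply constructive_indefinite_description. lift_cells.
class_of (s x). apply (tob_sims2 tF ts). now apply (r0_sims1 h).
Qed.

Lemma tob_class_rel (x : G) (x' : G') :
  r0 RG x x' -> r1 RH (s x) (proj1_sig (tob_class x')).
Proof. apply (proj2_sig (tob_class x')). Qed.

Lemma tnat_class {x' y' : G'} (f' : cell1 x' y') :
  {C' : cell2 (map1 E' f' * proj1_sig (tob_class x'))
      (proj1_sig (tob_class y') * map1 F' f') |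
    forall x y (f : cell1 x y), r1 RG f f' -> r2 RH (tnat s f) C'}.
Proof.
apply constructive_indefinite_description. lift_cells.
pose proof (tob_class_rel h) as hx. pose proof (tob_class_rel h0) as hy.
class_of (tnat s f).
Qed.

Lemma pretrans_exists : {s' : pretrans F' E' | pretrans_rel RG RH s s'}.
Proof.
exists (@Pretrans G' H' _ F' E' (fun x => proj1_sig (tob_class x))
  (fun _ _ f => proj1_sig (tnat_class f))).
split; cbn; intros.
- now apply tob_class_rel.
- now apply (proj2_sig (tnat_class _)).
Qed.

Context {s' : pretrans F' E'} {rs : pretrans_rel RG RH s s'}.

Lemma tnat_inv_class {x' y' : G'} (f' : cell1 x' y') :
  {C' : cell2 (s' y' * map1 F' f') (map1 E' f' * s' x') |
    forall x y (f : cell1 x y), r1 RG f f' -> r2 RH (tnat_inv s f) C'}.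
Proof.
apply constructive_indefinite_description. lift_cells.
class_of (tnat_inv s f).
Qed.

Lemma trans_of_pretrans : {s1 : trans F' E' | trans_rel RG RH s s1}.
Proof.
simple refine (exist _ (@Trans G' H' _ _ F' E' s'
  (fun _ _ f => proj1_sig (tnat_inv_class f)) _ _ _ _) _); cbv beta.
- intros. lift_cells. eapply (rel_inverse bH); [rel | | apply tnatK].
  now apply (proj2_sig (tnat_inv_class _)).
- by_law @tnat_natural.
- by_law @tnat_comp.
- by_law @tnat_unit.
- split; [exact rs |]. intros. now apply (proj2_sig (tnat_inv_class _)).
Qed.

End Trans.

Lemma trans_exists (s : trans F E) : thin_trans SG SH s ->
  {s' : trans F' E' | trans_rel RG RH s s'}.
Proof.
intros ts. destruct (pretrans_exists ts) as [s' rs].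
exact (trans_of_pretrans ts (rs := rs)).
Qed.

End TransExists.

Section ImodExists.
Context {G H G' H' : globset2} {BG : bicat G} {BH : bicat H}
  {SG : thin_system BG} {SH : thin_system BH} (RG : quotient_of SG G')
  (RH : quotient_of SH H') {BG' : bicat G'} {BH' : bicat H'}
  {bG : bicat_rel RG BG'} {bH : bicat_rel RH BH'}
  {F E : gmap G H} {F' E' : gmap G' H'}
  {rF : gmap_rel RG RH F F'} {rE : gmap_rel RG RH E E'}
  {s t : pretrans F E} {s' t' : pretrans F' E'}
  {rs : pretrans_rel RG RH s s'} {rt : pretrans_rel RG RH t t'}
  (m : imod s t) (tm : forall x, thin SH (m x)).

Lemma mob_class (x' : G') :
  {C' : cell2 (s' x') (t' x') | forall x, r0 RG x x' -> r2 RH (m x) C'}.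
Proof.
apply constructive_indefinite_description. lift_cells.
class_of (m x). apply sims3_thin; trivial.
apply (r1_sims2 (tr_ob rs h)). eapply (tr_ob rs); eassumption.
Qed.

Lemma mob_inv_class (x' : G') :
  {C' : cell2 (t' x') (s' x') | forall x, r0 RG x x' -> r2 RH (mob_inv m x) C'}.
Proof.
apply constructive_indefinite_description. lift_cells.
class_of (mob_inv m x).
apply sims3_thin; try exact (thin_inverse (mobK m _) (tm _)).
apply (r1_sims2 (tr_ob rt h)). eapply (tr_ob rt); eassumption.
Qed.

(** No counterpart of the interchanger argument is needed here: all components are thin, so their
    similarity follows from that of their boundaries. *)
Lemma imod_exists : {m' : imod s' t' | imod_rel RG RH m m'}.
Proof.
simple refine (exist _ (@Imod G' H' _ F' E' s' t'
  (fun x => proj1_sig (mob_class x)) (fun x => proj1_sig (mob_inv_class x))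
  _ _) _); cbv beta.
- intros. lift_cells.
  apply (rel_inverse bH (C := m x0) (D := mob_inv m x0)); [| | apply mobK].
  + now apply (proj2_sig (mob_class _)).
  + now apply (proj2_sig (mob_inv_class _)).
- intros. lift_cells.
  pose proof (proj2_sig (mob_class x) _ h0) as hx.
  pose proof (proj2_sig (mob_class y) _ h) as hy. cbn in hx, hy.
  eapply (r2_fun RH); [rel | rewrite mob_natural; rel].
- split; cbn; intros.
  + now apply (proj2_sig (mob_class _)).
  + now apply (proj2_sig (mob_inv_class _)).
Qed.

End ImodExists.

Ltac rel_components :=
  repeat match goal with h : _ /\ _ |- _ => destruct h end;
  repeat split; rel.

(** * Relatedness of composites, whiskerings and products *)

Section Composites.
Context {A G H K A' G' H' K' : globset2} {BA : bicat A} {BG : bicat G}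
  {BH : bicat H} {BK : bicat K}
  {SA : thin_system BA} {SG : thin_system BG} {SH : thin_system BH}
  {SK : thin_system BK}
  (RA : quotient_of SA A') (RG : quotient_of SG G') (RH : quotient_of SH H')
  (RK : quotient_of SK K').

(** This and the following facts are instances because the boundaries of the constraints are deeply
    nested composites; the search follows their syntax. *)
#[export] Instance gid_rel : gmap_rel RG RG (gid G) (gid G').
Proof. now split. Qed.

#[export] Instance gcomp_rel {F : gmap G H} {F' : gmap G' H'} {E : gmap A G}
    {E' : gmap A' G'} :
  gmap_rel RG RH F F' -> gmap_rel RA RG E E' ->
  gmap_rel RA RH (gcomp F E) (gcomp F' E').
Proof. intros rF rE. split; cbn; intros; rel. Qed.

#[export] Instance gprod_rel {F : gmap A H} {F' : gmap A' H'} {E : gmap G K}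
    {E' : gmap G' K'} :
  gmap_rel RA RH F F' -> gmap_rel RG RK E E' ->
  gmap_rel (prod_quotient RA RG) (prod_quotient RH RK)
    (gprod F E) (gprod F' E').
Proof. intros rF rE. split; cbn; intros; rel_components. Qed.

#[export] Instance gpair_rel {F : gmap G H} {F' : gmap G' H'} {E : gmap G K}
    {E' : gmap G' K'} :
  gmap_rel RG RH F F' -> gmap_rel RG RK E E' ->
  gmap_rel RG (prod_quotient RH RK) (gpair F E) (gpair F' E').
Proof. intros rF rE. split; cbn; intros; rel_components. Qed.

#[export] Instance greassoc_rel :
  gmap_rel (prod_quotient (prod_quotient RG RH) RK)
    (prod_quotient RG (prod_quotient RH RK))
    (greassoc G H K) (greassoc G' H' K').
Proof. split; cbn; intros; rel_components. Qed.

#[export] Instance gbang_rel : gmap_rel RG unit_quotient (gbang G) (gbang G').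
Proof. now split. Qed.

Context {BA' : bicat A'} {BG' : bicat G'} {BH' : bicat H'} {BK' : bicat K'}
  {bA : bicat_rel RA BA'} {bG : bicat_rel RG BG'} {bH : bicat_rel RH BH'}
  {bK : bicat_rel RK BK'}.

#[export] Instance pf_id_rel : prefunctor_rel RG RG (pf_id G) (pf_id G').
Proof. split; [exact _ | ..]; cbn; intros; rel. Qed.

#[export] Instance pf_comp_rel {F : prefunctor G H} {F' : prefunctor G' H'}
    {E : prefunctor A G} {E' : prefunctor A' G'} :
  prefunctor_rel RG RH F F' -> prefunctor_rel RA RG E E' ->
  prefunctor_rel RA RH (pf_comp F E) (pf_comp F' E').
Proof. intros rF rE. split; [cbn; exact _ | ..]; cbn; intros; rel. Qed.

#[export] Instance pf_prod_rel {F : prefunctor A H} {F' : prefunctor A' H'}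
    {E : prefunctor G K} {E' : prefunctor G' K'} :
  prefunctor_rel RA RH F F' -> prefunctor_rel RG RK E E' ->
  prefunctor_rel (prod_quotient RA RG) (prod_quotient RH RK)
    (pf_prod F E) (pf_prod F' E').
Proof. intros rF rE. split; [cbn; exact _ | ..]; cbn; intros; rel_components.
  Qed.

#[export] Instance pf_pair_rel {F : prefunctor G H} {F' : prefunctor G' H'}
    {E : prefunctor G K} {E' : prefunctor G' K'} :
  prefunctor_rel RG RH F F' -> prefunctor_rel RG RK E E' ->
  prefunctor_rel RG (prod_quotient RH RK) (pf_pair F E) (pf_pair F' E').
Proof. intros rF rE. split; [cbn; exact _ | ..]; cbn; intros; rel_components.
  Qed.

#[export] Instance pf_reassoc_rel :
  prefunctor_rel (prod_quotient (prod_quotient RG RH) RK)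
    (prod_quotient RG (prod_quotient RH RK))
    (pf_reassoc G H K) (pf_reassoc G' H' K').
Proof. split; [cbn; exact _ | ..]; cbn; intros; rel_components. Qed.

#[export] Instance pf_bang_rel :
  prefunctor_rel RG unit_quotient (pf_bang G) (pf_bang G').
Proof. now repeat split. Qed.

#[export] Instance tid_rel {F : gmap G H} {F' : gmap G' H'} :
  gmap_rel RG RH F F' -> pretrans_rel RG RH (tid F) (tid F').
Proof. intros rF. split; cbn; intros; rel. Qed.

#[export] Instance tcomp_rel {F E D : gmap G H} {F' E' D' : gmap G' H'}
    {t : pretrans E D} {t' : pretrans E' D'} {s : pretrans F E}
    {s' : pretrans F' E'} :
  gmap_rel RG RH F F' -> gmap_rel RG RH E E' -> gmap_rel RG RH D D' ->
  pretrans_rel RG RH t t' -> pretrans_rel RG RH s s' ->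
  pretrans_rel RG RH (tcomp t s) (tcomp t' s').
Proof.
intros rF rE rD rt rs.
split; cbn; intros;
  (* The naturality cell of a composite also mentions components at the endpoints of [f]; their
     relatedness is recovered from that of [f]. *)
  try match goal with h : r1 RG _ _ |- _ => pose proof (r1_bd h) as [] end; rel.
Qed.

#[export] Instance whiskR_rel {F E : gmap G H} {F' E' : gmap G' H'}
    {s : pretrans F E} {s' : pretrans F' E'} {P : gmap A G} {P' : gmap A' G'} :
  pretrans_rel RG RH s s' -> gmap_rel RA RG P P' ->
  pretrans_rel RA RH (whiskR s P) (whiskR s' P').
Proof. intros rs rP. split; cbn; intros; rel. Qed.

#[export] Instance whiskL_rel {T : functor G H} {T' : functor G' H'}
    {F E : gmap A G} {F' E' : gmap A' G'} {s : pretrans F E}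
    {s' : pretrans F' E'} :
  functor_rel RG RH T T' -> gmap_rel RA RG F F' -> gmap_rel RA RG E E' ->
  pretrans_rel RA RG s s' ->
  pretrans_rel RA RH (whiskL T s) (whiskL T' s').
Proof.
intros rT rF rE rs.
split; cbn; intros;
  try match goal with h : r1 RA _ _ |- _ => pose proof (r1_bd h) as [] end; rel.
Qed.

#[export] Instance tprod_rel {F E : gmap A H} {F' E' : gmap A' H'}
    {D I : gmap G K} {D' I' : gmap G' K'} {s : pretrans F E}
    {s' : pretrans F' E'} {t : pretrans D I} {t' : pretrans D' I'} :
  pretrans_rel RA RH s s' -> pretrans_rel RG RK t t' ->
  pretrans_rel (prod_quotient RA RG) (prod_quotient RH RK)
    (tprod s t) (tprod s' t').
Proof. intros rs rt. split; cbn; intros; rel_components. Qed.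

End Composites.

(** * Thinness of composite functors *)

Section ThinComposites.
Context {A G H K : globset2} {BA : bicat A} {BG : bicat G}
  {BH : bicat H} {BK : bicat K}
  (SA : thin_system BA) (SG : thin_system BG) (SH : thin_system BH)
  (SK : thin_system BK).

Lemma pf_id_thin : thin_prefunctor SG SG (pf_id G).
Proof. split; cbn; trivial; intros; apply thin_id. Qed.

Lemma pf_comp_thin {F : prefunctor G H} {E : prefunctor A G} :
  thin_prefunctor SG SH F -> thin_prefunctor SA SG E ->
  thin_prefunctor SA SH (pf_comp F E).
Proof.
intros tF tE. split; cbn; intros.
- now apply (tf_coh tF), (tf_coh tE).
- now apply (tf_thin tF), (tf_thin tE).
- apply thin_vcomp;
    [now apply (tf_thin tF), (tf_comp_l tE)
    | now apply (tf_comp_l tF), (tf_coh tE)].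
- apply thin_vcomp;
    [now apply (tf_thin tF), (tf_comp_r tE)
    | now apply (tf_comp_r tF), (tf_coh tE)].
- apply thin_vcomp; [apply (tf_thin tF), (tf_unit tE) | apply (tf_unit tF)].
Qed.

Lemma pf_prod_thin {F : prefunctor A H} {E : prefunctor G K} :
  thin_prefunctor SA SH F -> thin_prefunctor SG SK E ->
  thin_prefunctor (prod_thin SA SG) (prod_thin SH SK) (pf_prod F E).
Proof.
intros [] []. split; cbn; intros;
  repeat match goal with h : _ /\ _ |- _ => destruct h end; auto.
Qed.

Lemma pf_pair_thin {F : prefunctor G H} {E : prefunctor G K} :
  thin_prefunctor SG SH F -> thin_prefunctor SG SK E ->
  thin_prefunctor SG (prod_thin SH SK) (pf_pair F E).
Proof. intros [] []. split; cbn; auto. Qed.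

Lemma pf_reassoc_thin :
  thin_prefunctor (prod_thin (prod_thin SG SH) SK)
    (prod_thin SG (prod_thin SH SK)) (pf_reassoc G H K).
Proof.
split; cbn; intros;
  repeat match goal with h : _ /\ _ |- _ => destruct h end;
  repeat split; trivial; apply thin_id.
Qed.

Lemma pf_bang_thin : thin_prefunctor SG unit_thin (pf_bang G).
Proof. now split. Qed.

End ThinComposites.

Section AdjeqExists.
Context {G H G' H' : globset2} {BG : bicat G} {BH : bicat H}
  {SG : thin_system BG} {SH : thin_system BH} (RG : quotient_of SG G')
  (RH : quotient_of SH H') {BG' : bicat G'} {BH' : bicat H'}
  {bG : bicat_rel RG BG'} {bH : bicat_rel RH BH'}
  {F E : prefunctor G H} (tF : thin_prefunctor SG SH F)
  (tE : thin_prefunctor SG SH E) {F' E' : prefunctor G' H'}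
  {rF : prefunctor_rel RG RH F F'} {rE : prefunctor_rel RG RH E E'}.

Lemma adjeq_exists (e : adjeq F E) : thin_adjeq SG SH e ->
  {e' : adjeq F' E' | adjeq_rel RG RH e e'}.
Proof.
intros te.
destruct (trans_exists (rF := rF) (rE := rE) tF tE (ta_l te)) as [l rl].
destruct (trans_exists (rF := rE) (rE := rF) tE tF (ta_r te)) as [r rr].
destruct (imod_exists (s' := tid F') (t' := tcomp r l) (RG := RG) (RH := RH)
  (ta_unit te))
  as [u ru].
destruct (imod_exists (s' := tcomp l r) (t' := tid E') (RG := RG) (RH := RH)
  (ta_counit te))
  as [c rc].
simple refine (exist _ (@Adjeq G' H' _ _ F' E' l r u c _ _) _); cbv beta.
- intros. lift_cells. by_law_at (adj_triangle_l e x0).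
- intros. lift_cells. by_law_at (adj_triangle_r e x0).
- now split.
Qed.

End AdjeqExists.

(** * Classes of coherence in a tricategory *)

Lemma proj1_sig_inj {A : Type} {P : A -> Prop} (p q : sig P) :
  proj1_sig p = proj1_sig q -> p = q.
Proof.
destruct p as [x h], q as [y k]; cbn. intros e. destruct e.
f_equal. apply proof_irrelevance.
Qed.

(** Classes are encoded as predicates, so extensionality turns similarity of representatives into
    equality of classes. *)
Lemma equivalence_class_eq {A : Type} (R : A -> A -> Prop)
    {E : Equivalence R} (x y : A) : R x = R y <-> R x y.
Proof.
split; intros h.
- rewrite h. reflexivity.
- extensionality z. apply propositional_extensionality. now rewrite h.
Qed.

Section Base.
Context {X : globset3} {T : tricat X} (C3 : mor3_collection T)
  (hT : semi_free T) (hC3 : coherence23_system C3).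

(** A coherence 2-morphism in the opposite direction suffices, since semi-freeness makes both
    composites isomorphic to identities. On constraints the two adjoints are exchanged, and [u2 a]
    is already an endomorphism. *)
Lemma coh2_inv (a b : X) (f g : hom a b) (c : cell1 f g) :
  coh2 c -> exists d : cell1 g f, coh2 d.
Proof.
intros h. induction h as [a b f g s h | a b f | a b f g h t s _ IHt _ IHs
  | a b c g g' f f' s t _ IHs _ IHt].
- destruct h as [a | a b c d f g s h | a b f g s h | a b f g s h].
  + exists (u2 a). apply coh2_constraint, constraint2_unit.
  + destruct h as [x | x]; eexists; eapply coh2_constraint, constraint2_asc;
      [apply adj_cell1_r | apply adj_cell1_l].
  + destruct h as [x | x]; eexists; eapply coh2_constraint, constraint2_lft;
      [apply adj_cell1_r | apply adj_cell1_l].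
  + destruct h as [x | x]; eexists; eapply coh2_constraint, constraint2_rgt;
      [apply adj_cell1_r | apply adj_cell1_l].
- exists (id1 f). apply coh2_id.
- destruct IHt as [t' ht], IHs as [s' hs]. exists (s' * t').
  now apply coh2_comp.
- destruct IHt as [t' ht], IHs as [s' hs]. exists (s' ⊗2 t').
  now apply coh2_tens.
Qed.

Definition hom_thin (a b : X) : thin_system (@loc X _ a b).
Proof.
pose proof (c23_system hC3) as h3.
refine (@ThinSystem (hom a b) _ (fun _ _ c => coh2 c)
  (fun _ _ _ _ C => in3 C3 C) _ _ _ _ _ _ _ _ _ _ _ _).
- intros. apply coh2_id.
- intros. now apply coh2_comp.
- intros x y c. apply coh2_inv.
(* Semi-freeness supplies a coherence 3-morphism, and condition (2) on C_3 puts it into C_3. *)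
- intros x y c d hc hd. destruct (hT hc hd) as (C & h & _).
  exists C. now apply (c23_coh hC3).
- intros. now apply c3_id.
- intros. now apply c3_vcomp.
- intros. now apply c3_hcomp.
- intros x y f g C. apply (c3_inv h3).
- intros x y f g C D. apply (c3_parallel h3).
- intros. apply (c23_assoc hC3).
- intros. apply (c23_lunitor hC3).
- intros. apply (c23_runitor hC3).
Defined.

Lemma sim2_sims2 {a b : X} {f g f' g' : hom a b} (s : cell1 f g)
    (s' : cell1 f' g') :
  sim2 C3 (Tot1 s) (Tot1 s') <-> sims2 (hom_thin a b) s s'.
Proof.
split.
- intros (c & c' & C & h & h' & k). exists c, c'. repeat split; trivial.
  now exists C.
- intros (c & c' & h & h' & C & k). now exists c, c', C.
Qed.

Lemma sim3_sims3 {a b : X} {f g f' g' : hom a b} {s t : cell1 f g}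
    {s' t' : cell1 f' g'} (L : cell2 s t) (L' : cell2 s' t') :
  sim3 C3 (Tot2 L) (Tot2 L') <-> sims3 (hom_thin a b) L L'.
Proof.
split.
- intros (c & c' & C & C' & h & h' & k & k' & e). exists c, c'.
  repeat split; trivial. now exists C, C'.
- intros (c & c' & h & h' & C & C' & k & k' & e). now exists c, c', C, C'.
Qed.

#[local] Instance sim1_equivalence (a b : X) : Equivalence (@sim1 X T a b).
Proof.
split.
- exact (sims1_refl (hom_thin a b)).
- exact (@sims1_sym _ _ (hom_thin a b)).
- exact (@sims1_trans _ _ (hom_thin a b)).
Qed.

#[local] Instance sim2_equivalence (a b : X) : Equivalence (@sim2 X T C3 a b).
Proof.
split.
- intros [f g s]. apply sim2_sims2, sims2_like, like1_equivalence.
- intros [f g s] [f' g' s']. rewrite !sim2_sims2. apply sims2_sym.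
- intros [f g s] [f' g' s'] [f'' g'' s'']. rewrite !sim2_sims2.
  apply sims2_trans.
Qed.

#[local] Instance sim3_equivalence (a b : X) : Equivalence (@sim3 X T C3 a b).
Proof.
split.
- intros [f g s t L]. apply sim3_sims3, sims3_like, like2_refl.
- intros [f g s t L] [f' g' s' t' L']. rewrite !sim3_sims3. apply sims3_sym.
- intros [f g s t L] [f' g' s' t' L'] [f'' g'' s'' t'' L''].
  rewrite !sim3_sims3. apply sims3_trans.
Qed.

Lemma sim1_eq {a b : X} (f g : hom a b) : sim1 f = sim1 g <-> sim1 f g.
Proof. apply equivalence_class_eq, sim1_equivalence. Qed.

Lemma sim2_eq {a b : X} {f g f' g' : hom a b} (s : cell1 f g)
    (s' : cell1 f' g') :
  sim2 C3 (Tot1 s) = sim2 C3 (Tot1 s') <-> sims2 (hom_thin a b) s s'.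
Proof.
rewrite <- sim2_sims2. apply equivalence_class_eq, sim2_equivalence.
Qed.

Lemma sim3_eq {a b : X} {f g f' g' : hom a b} {s t : cell1 f g}
    {s' t' : cell1 f' g'} (L : cell2 s t) (L' : cell2 s' t') :
  sim3 C3 (Tot2 L) = sim3 C3 (Tot2 L') <-> sims3 (hom_thin a b) L L'.
Proof.
rewrite <- sim3_sims3. apply equivalence_class_eq, sim3_equivalence.
Qed.

Lemma rep1_bd (a b : X) (A B : qhom0 a b) (P : qhom1 C3 A B) (f g : hom a b)
    (s : cell1 f g) : rep1 s P -> rep0 f A /\ rep0 g B.
Proof.
destruct P as (P & [f0 g0 s0] & hA & hB & hP). unfold rep1, rep0. cbn in *.
intros e. rewrite hP in e. rewrite hA, hB, !sim1_eq.
apply sim2_eq in e. exact (sims2_bd e).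
Qed.

Lemma rep2_bd (a b : X) (A B : qhom0 a b) (P Q : qhom1 C3 A B)
    (U : qhom2 P Q) (f g : hom a b) (s t : cell1 f g) (L : cell2 s t) :
  rep2 L U -> rep1 s P /\ rep1 t Q.
Proof.
destruct U as (U & [f0 g0 s0 t0 L0] & hP & hQ & hU). unfold rep2, rep1.
cbn in *. intros e. rewrite hU in e. rewrite hP, hQ, !sim2_eq.
apply sim3_eq in e. exact (sims3_bd e).
Qed.

Definition hom_quotient (a b : X) :
  quotient_of (hom_thin a b) (@hom (quotient_globset C3) a b).
Proof.
refine (@QuotientOf (hom a b) _ (hom_thin a b) (@hom (quotient_globset C3) a b)
  (fun f A => rep0 f A) (fun _ _ _ _ s P => rep1 s P)
  (fun _ _ _ _ _ _ _ _ L U => rep2 L U) _ _ _ _ _ _ _ _ _ _ _ _ _ _).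
- intros f. now exists (class0 f).
- intros (A & f & h). now exists f.
- intros f A B h k. apply proj1_sig_inj. exact (eq_trans h (eq_sym k)).
- intros f g A h. unfold rep0 in *. rewrite h. apply sim1_eq.
(* [class1 s] runs between [class0 f] and [class0 g], which are only provably equal to [A] and [B];
   the same predicate is packed with [A] and [B] instead. *)
- intros f g A B s hA hB.
  now exists (exist _ (sim2 C3 (Tot1 s))
    (ex_intro _ (Tot1 s) (conj hA (conj hB eq_refl)))).
- intros A B (P & [f g s] & hA & hB & hP). now exists f, g, s.
- intros f g A B s P Q h k. apply proj1_sig_inj. exact (eq_trans h (eq_sym k)).
- intros f g A B s P h. exact (rep1_bd h).
- intros f g f' g' A B s s' P h. unfold rep1 in *.
  rewrite h. apply sim2_eq.
- intros f g A B s t P Q L hP hQ.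
  now exists (exist _ (sim3 C3 (Tot2 L))
    (ex_intro _ (Tot2 L) (conj hP (conj hQ eq_refl)))).
- intros A B P Q (U & [f g s t L] & hP & hQ & hU). now exists f, g, s, t, L.
- intros f g A B s t P Q L U V h k. apply proj1_sig_inj.
  exact (eq_trans h (eq_sym k)).
- intros f g A B s t P Q L U h. exact (rep2_bd h).
- intros f g f' g' A B s t s' t' P Q L L' U h. unfold rep2 in *.
  rewrite h. apply sim3_eq.
Defined.

Lemma sims_equivalence_holds : sims_equivalence C3.
Proof. intros a b. repeat split; apply _. Qed.

Lemma quotient_boundaries_hold : quotient_boundaries C3.
Proof.
split.
- exact rep1_bd.
- exact rep2_bd.
- intros a b A B P f g hA hB. exact (r1_lift (R := hom_quotient a b) P hA hB).
- intros a b A B P Q U f g s t hP hQ.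
  exact (r2_lift (R := hom_quotient a b) U hP hQ).
Qed.

End Base.

(** * The data of the quotient tricategory *)

(** Choice for sigma types, which needs no axiom; it turns objectwise existence results into the
    families that form the data of a tricategory. *)
Lemma sig_fun {A : Type} {B : A -> Type} {P : forall x, B x -> Prop} :
  (forall x, {y : B x | P x y}) -> {f : forall x, B x | forall x, P x (f x)}.
Proof.
intros h. exists (fun x => proj1_sig (h x)). intros x. exact (proj2_sig (h x)).
Qed.

(* The boundaries of the modifications pi, mu, lam, rho of [tricat_data], as
   functions of the preceding data. *)
Section Boundaries.
Context {I : Type} {C : I -> I -> globset2} {B : forall a b, bicat (C a b)}
  (tensor : forall a b c, functor (prodg (C b c) (C a b)) (C a c))
  (unit : forall a, functor unitg (C a a))
  (asc : forall a b c d,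
    adjeq
      (pf_comp (tensor a b d) (pf_prod (tensor b c d) (pf_id (C a b))))
      (pf_comp (tensor a c d)
        (pf_comp (pf_prod (pf_id (C c d)) (tensor a b c))
          (pf_reassoc (C c d) (C b c) (C a b)))))
  (lft : forall a b,
    adjeq (pf_comp (tensor a b b)
        (pf_pair (pf_comp (unit b) (pf_bang (C a b))) (pf_id (C a b))))
      (pf_id (C a b)))
  (rgt : forall a b,
    adjeq (pf_comp (tensor a a b)
        (pf_pair (pf_id (C a b)) (pf_comp (unit a) (pf_bang (C a b)))))
      (pf_id (C a b))).

Definition pi_source (a b c d e : I) :=
  tcomp
    (whiskR
      (whiskL (tensor a d e) (tprod (tid (gid (C d e))) (asc a b c d)))
      (gcomp (greassoc _ _ _) (gprod (greassoc _ _ _) (gid (C a b)))))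
    (tcomp
      (whiskR (asc a b d e)
        (gprod (gcomp (gprod (gid (C d e)) (tensor b c d))
          (greassoc _ _ _)) (gid (C a b))))
      (whiskL (tensor a b e) (tprod (asc b c d e) (tid (gid (C a b)))))).

Definition pi_target (a b c d e : I) :=
  tcomp
    (whiskR (asc a c d e)
      (gcomp (gprod (gid (prodg (C d e) (C c d))) (tensor a b c))
        (greassoc _ _ _)))
    (whiskR (asc a b c e)
      (gprod (gprod (tensor c d e) (gid (C b c))) (gid (C a b)))).

Definition mu_source (a b c : I) :=
  tcomp
    (whiskL (tensor a b c) (tprod (tid (gid (C b c))) (lft a b)))
    (tcomp
      (whiskR (asc a b b c)
        (gprod (gpair (gid (C b c)) (gcomp (unit b) (gbang (C b c))))
          (gid (C a b))))
      (whiskL (tensor a b c)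
        (tprod (adj_r (rgt b c)) (tid (gid (C a b)))))).

Definition mu_target (a b c : I) :=
  tid (gcomp (tensor a b c) (gprod (gid (C b c)) (gid (C a b)))).

Definition lam_source (a b c : I) :=
  whiskL (tensor a b c) (tprod (lft b c) (tid (gid (C a b)))).

Definition lam_target (a b c : I) :=
  tcomp
    (whiskR (lft a c)
      (gcomp (tensor a b c) (gprod (gid (C b c)) (gid (C a b)))))
    (whiskR (asc a b c c)
      (gprod (gpair (gcomp (unit c) (gbang (C b c))) (gid (C b c)))
        (gid (C a b)))).

Definition rho_source (a b c : I) :=
  whiskL (tensor a b c) (tprod (tid (gid (C b c))) (adj_r (rgt a b))).

Definition rho_target (a b c : I) :=
  tcomp
    (whiskR (asc a a b c)
      (gpair (gprod (gid (C b c)) (gid (C a b)))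
        (gcomp (unit a) (gbang (prodg (C b c) (C a b))))))
    (whiskR (adj_r (rgt a c))
      (gcomp (tensor a b c) (gprod (gid (C b c)) (gid (C a b))))).

End Boundaries.

(* The boundaries of a composite may agree only up to conversion, so the
   components are passed explicitly. *)
Ltac boundary_rel :=
  lazymatch goal with
  | |- pretrans_rel _ _ (tcomp ?t ?s) (tcomp ?t' ?s') =>
    notypeclasses refine (tcomp_rel (t := t) (t' := t') (s := s) (s' := s')
      _ _ _ _ _); boundary_rel
  | |- pretrans_rel _ _ (whiskR ?s ?P) (whiskR ?s' ?P') =>
    notypeclasses refine (whiskR_rel (s := s) (s' := s') (P := P) (P' := P')
      _ _); boundary_rel
  | |- pretrans_rel _ _ (whiskL ?F ?s) (whiskL ?F' ?s') =>
    notypeclasses refine (whiskL_rel (T := F) (T' := F') (s := s) (s' := s')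
      _ _ _ _); boundary_rel
  | |- pretrans_rel _ _ (tprod ?s ?t) (tprod ?s' ?t') =>
    notypeclasses refine (tprod_rel (s := s) (s' := s') (t := t) (t' := t')
      _ _); boundary_rel
  | |- pretrans_rel _ _ (tid ?F) (tid ?F') =>
    notypeclasses refine (tid_rel (F := F) (F' := F') _); boundary_rel
  | |- _ => typeclasses eauto
  end.

Record thin_tricat {X : globset3} {T : tricat_data X}
    (S : forall a b : X, thin_system (loc a b)) : Prop := {
  th_tens : forall a b c,
    thin_prefunctor (prod_thin (S b c) (S a b)) (S a c) (tens a b c);
  th_unt : forall a, thin_prefunctor unit_thin (S a a) (unt a);
  th_asc : forall a b c d,
    thin_adjeq (prod_thin (prod_thin (S c d) (S b c)) (S a b)) (S a d)
      (asc a b c d);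
  th_lft : forall a b, thin_adjeq (S a b) (S a b) (lft a b);
  th_rgt : forall a b, thin_adjeq (S a b) (S a b) (rgt a b);
  th_pi : forall a b c d e x, thin (S a e) (pi a b c d e x);
  th_mu : forall a b c x, thin (S a c) (mu a b c x);
  th_lam : forall a b c x, thin (S a c) (lam a b c x);
  th_rho : forall a b c x, thin (S a c) (rho a b c x) }.

(** * Thinness of the functors bounding the constraints *)

Section ThinBoundaries.
Context {X : globset3} {T : tricat_data X}
  {S : forall a b : X, thin_system (loc a b)}
  (tensT : forall a b c,
    thin_prefunctor (prod_thin (S b c) (S a b)) (S a c) (tens a b c))
  (untT : forall a, thin_prefunctor unit_thin (S a a) (unt a)).

(** The construction of a quotient transformation uses thinness of both boundary functors, because
    their composition cells enter [tnat_comp]. *)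
Lemma asc_source_thin (a b c d : X) :
  thin_prefunctor (prod_thin (prod_thin (S c d) (S b c)) (S a b)) (S a d)
    (pf_comp (tens a b d) (pf_prod (tens b c d) (pf_id (hom a b)))).
Proof.
eapply pf_comp_thin; [apply tensT |].
apply pf_prod_thin; [apply tensT | apply pf_id_thin].
Qed.

Lemma asc_target_thin (a b c d : X) :
  thin_prefunctor (prod_thin (prod_thin (S c d) (S b c)) (S a b)) (S a d)
    (pf_comp (tens a c d)
      (pf_comp (pf_prod (pf_id (hom c d)) (tens a b c))
        (pf_reassoc (hom c d) (hom b c) (hom a b)))).
Proof.
eapply pf_comp_thin; [apply tensT |].
eapply pf_comp_thin; [| apply pf_reassoc_thin].
apply pf_prod_thin; [apply pf_id_thin | apply tensT].
Qed.

Lemma lft_source_thin (a b : X) :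
  thin_prefunctor (S a b) (S a b)
    (pf_comp (tens a b b)
      (pf_pair (pf_comp (unt b) (pf_bang (hom a b))) (pf_id (hom a b)))).
Proof.
eapply pf_comp_thin; [apply tensT |].
apply pf_pair_thin; [| apply pf_id_thin].
eapply pf_comp_thin; [apply untT | apply pf_bang_thin].
Qed.

Lemma rgt_source_thin (a b : X) :
  thin_prefunctor (S a b) (S a b)
    (pf_comp (tens a a b)
      (pf_pair (pf_id (hom a b)) (pf_comp (unt a) (pf_bang (hom a b))))).
Proof.
eapply pf_comp_thin; [apply tensT |].
apply pf_pair_thin; [apply pf_id_thin |].
eapply pf_comp_thin; [apply untT | apply pf_bang_thin].
Qed.

End ThinBoundaries.

Section Data.
Context {X : globset3} {T : tricat_data X}
  (S : forall a b : X, thin_system (loc a b)) {hom' : X -> X -> globset2}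
  (R : forall a b : X, quotient_of (S a b) (hom' a b)).

Record tricat_rel (T' : tricat_data (Globset3 hom')) : Prop := {
  tr_loc : forall a b : X,
    bicat_rel (R a b) (@loc (Globset3 hom') T' a b);
  tr_tens : forall a b c : X,
    functor_rel (prod_quotient (R b c) (R a b)) (R a c) (tens a b c)
      (@tens (Globset3 hom') T' a b c);
  tr_unt : forall a : X,
    functor_rel unit_quotient (R a a) (unt a) (@unt (Globset3 hom') T' a);
  tr_asc : forall a b c d : X,
    adjeq_rel (prod_quotient (prod_quotient (R c d) (R b c)) (R a b)) (R a d)
      (asc a b c d) (@asc (Globset3 hom') T' a b c d);
  tr_lft : forall a b : X,
    adjeq_rel (R a b) (R a b) (lft a b) (@lft (Globset3 hom') T' a b);
  tr_rgt : forall a b : X,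
    adjeq_rel (R a b) (R a b) (rgt a b) (@rgt (Globset3 hom') T' a b);
  tr_pi : forall a b c d e : X,
    imod_rel (prod_quotient (prod_quotient (prod_quotient (R d e) (R c d))
      (R b c)) (R a b)) (R a e) (pi a b c d e)
      (@pi (Globset3 hom') T' a b c d e);
  tr_mu : forall a b c : X,
    imod_rel (prod_quotient (R b c) (R a b)) (R a c) (mu a b c)
      (@mu (Globset3 hom') T' a b c);
  tr_lam : forall a b c : X,
    imod_rel (prod_quotient (R b c) (R a b)) (R a c) (lam a b c)
      (@lam (Globset3 hom') T' a b c);
  tr_rho : forall a b c : X,
    imod_rel (prod_quotient (R b c) (R a b)) (R a c) (rho a b c)
      (@rho (Globset3 hom') T' a b c) }.

Context (th : thin_tricat S).

Section Modifications.
Context {B' : forall a b, bicat (hom' a b)}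
  {rB : forall a b, bicat_rel (R a b) (B' a b)}
  (tens' : forall a b c, functor (prodg (hom' b c) (hom' a b)) (hom' a c))
  {rtens : forall a b c, functor_rel (prod_quotient (R b c) (R a b)) (R a c)
    (tens a b c) (tens' a b c)}
  (unt' : forall a, functor unitg (hom' a a))
  {runt : forall a, functor_rel unit_quotient (R a a) (unt a) (unt' a)}.

Lemma asc_exists (a b c d : X) :
  {e' : adjeq
      (pf_comp (tens' a b d) (pf_prod (tens' b c d) (pf_id (hom' a b))))
      (pf_comp (tens' a c d)
        (pf_comp (pf_prod (pf_id (hom' c d)) (tens' a b c))
          (pf_reassoc (hom' c d) (hom' b c) (hom' a b)))) |
    adjeq_rel (prod_quotient (prod_quotient (R c d) (R b c)) (R a b)) (R a d)
      (asc a b c d) e'}.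
Proof.
exact (adjeq_exists (asc_source_thin (th_tens th) a b c d)
  (asc_target_thin (th_tens th) a b c d) (th_asc th a b c d)).
Qed.

Lemma lft_exists (a b : X) :
  {e' : adjeq (pf_comp (tens' a b b)
        (pf_pair (pf_comp (unt' b) (pf_bang (hom' a b))) (pf_id (hom' a b))))
      (pf_id (hom' a b)) |
    adjeq_rel (R a b) (R a b) (lft a b) e'}.
Proof.
exact (adjeq_exists (lft_source_thin (th_tens th) (th_unt th) a b)
  (pf_id_thin (S a b)) (th_lft th a b)).
Qed.

Lemma rgt_exists (a b : X) :
  {e' : adjeq (pf_comp (tens' a a b)
        (pf_pair (pf_id (hom' a b)) (pf_comp (unt' a) (pf_bang (hom' a b)))))
      (pf_id (hom' a b)) |
    adjeq_rel (R a b) (R a b) (rgt a b) e'}.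
Proof.
exact (adjeq_exists (rgt_source_thin (th_tens th) (th_unt th) a b)
  (pf_id_thin (S a b)) (th_rgt th a b)).
Qed.

Context (asc' : forall a b c d : X, adjeq
      (pf_comp (tens' a b d) (pf_prod (tens' b c d) (pf_id (hom' a b))))
      (pf_comp (tens' a c d)
        (pf_comp (pf_prod (pf_id (hom' c d)) (tens' a b c))
          (pf_reassoc (hom' c d) (hom' b c) (hom' a b)))))
  {rasc : forall a b c d, adjeq_rel
    (prod_quotient (prod_quotient (R c d) (R b c)) (R a b)) (R a d)
      (asc a b c d) (asc' a b c d)}
  (lft' : forall a b : X, adjeq (pf_comp (tens' a b b)
        (pf_pair (pf_comp (unt' b) (pf_bang (hom' a b))) (pf_id (hom' a b))))
      (pf_id (hom' a b)))
  {rlft : forall a b, adjeq_rel (R a b) (R a b) (lft a b) (lft' a b)}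
  (rgt' : forall a b : X, adjeq (pf_comp (tens' a a b)
        (pf_pair (pf_id (hom' a b)) (pf_comp (unt' a) (pf_bang (hom' a b)))))
      (pf_id (hom' a b)))
  {rrgt : forall a b, adjeq_rel (R a b) (R a b) (rgt a b) (rgt' a b)}.

Lemma pi_source_rel (a b c d e : X) :
  pretrans_rel (prod_quotient (prod_quotient (prod_quotient (R d e) (R c d))
      (R b c)) (R a b)) (R a e)
    (pi_source (@asc X T) a b c d e) (pi_source asc' a b c d e).
Proof. unfold pi_source. boundary_rel. Qed.

Lemma pi_target_rel (a b c d e : X) :
  pretrans_rel (prod_quotient (prod_quotient (prod_quotient (R d e) (R c d))
      (R b c)) (R a b)) (R a e)
    (pi_target (@asc X T) a b c d e) (pi_target asc' a b c d e).
Proof. unfold pi_target. boundary_rel. Qed.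

Lemma pi_exists (a b c d e : X) :
  {m' : imod (pi_source asc' a b c d e)
      (pi_target asc' a b c d e) |
    imod_rel (prod_quotient (prod_quotient (prod_quotient (R d e) (R c d))
      (R b c)) (R a b)) (R a e) (pi a b c d e) m'}.
Proof.
(* The boundary of [pi] is [pi_source] and [pi_target] only up to conversion, so their relatedness
   is passed by name. *)
notypeclasses refine (imod_exists (rs := pi_source_rel a b c d e)
  (rt := pi_target_rel a b c d e) (fun x => th_pi th x)); exact _.
Qed.

Lemma mu_source_rel (a b c : X) :
  pretrans_rel (prod_quotient (R b c) (R a b)) (R a c)
    (mu_source (@asc X T) (@lft X T) (@rgt X T) a b c) (mu_source asc' lft'
      rgt' a b c).
Proof. unfold mu_source. boundary_rel. Qed.

Lemma mu_target_rel (a b c : X) :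
  pretrans_rel (prod_quotient (R b c) (R a b)) (R a c)
    (mu_target (@tens X T) a b c) (mu_target tens' a b c).
Proof. unfold mu_target. boundary_rel. Qed.

Lemma mu_exists (a b c : X) :
  {m' : imod (mu_source asc' lft' rgt' a b c)
      (mu_target tens' a b c) |
    imod_rel (prod_quotient (R b c) (R a b)) (R a c) (mu a b c) m'}.
Proof.
notypeclasses refine (imod_exists (rs := mu_source_rel a b c)
  (rt := mu_target_rel a b c) (fun x => th_mu th x)); exact _.
Qed.

Lemma lam_source_rel (a b c : X) :
  pretrans_rel (prod_quotient (R b c) (R a b)) (R a c)
    (lam_source (@lft X T) a b c) (lam_source lft' a b c).
Proof. unfold lam_source. boundary_rel. Qed.

Lemma lam_target_rel (a b c : X) :
  pretrans_rel (prod_quotient (R b c) (R a b)) (R a c)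
    (lam_target (@asc X T) (@lft X T) a b c) (lam_target asc' lft' a b c).
Proof. unfold lam_target. boundary_rel. Qed.

Lemma lam_exists (a b c : X) :
  {m' : imod (lam_source lft' a b c)
      (lam_target asc' lft' a b c) |
    imod_rel (prod_quotient (R b c) (R a b)) (R a c) (lam a b c) m'}.
Proof.
notypeclasses refine (imod_exists (rs := lam_source_rel a b c)
  (rt := lam_target_rel a b c) (fun x => th_lam th x)); exact _.
Qed.

Lemma rho_source_rel (a b c : X) :
  pretrans_rel (prod_quotient (R b c) (R a b)) (R a c)
    (rho_source (@rgt X T) a b c) (rho_source rgt' a b c).
Proof. unfold rho_source. boundary_rel. Qed.

Lemma rho_target_rel (a b c : X) :
  pretrans_rel (prod_quotient (R b c) (R a b)) (R a c)
    (rho_target (@asc X T) (@rgt X T) a b c) (rho_target asc' rgt' a b c).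
Proof. unfold rho_target. boundary_rel. Qed.

Lemma rho_exists (a b c : X) :
  {m' : imod (rho_source rgt' a b c)
      (rho_target asc' rgt' a b c) |
    imod_rel (prod_quotient (R b c) (R a b)) (R a c) (rho a b c) m'}.
Proof.
notypeclasses refine (imod_exists (rs := rho_source_rel a b c)
  (rt := rho_target_rel a b c) (fun x => th_rho th x)); exact _.
Qed.

End Modifications.

(** The order of the choices is forced: the boundary of each datum is written with the preceding
    ones, and each existence result consumes their relatedness to T. *)
Lemma tricat_data_exists :
  {T' : tricat_data (Globset3 hom') | tricat_rel T'}.
Proof.
destruct (sig_fun (fun a => sig_fun (fun b => bicat_exists (R a b))))
  as [B' rB].
destruct (sig_fun (fun a => sig_fun (fun b => sig_fun (fun c =>
  functor_exists (RG := prod_quotient (R b c) (R a b)) (RH := R a c)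
    (th_tens th a b c)))))
  as [tens' rtens].
destruct (sig_fun (fun a => functor_exists (RG := unit_quotient)
  (RH := R a a) (th_unt th a)))
  as [unt' runt].
destruct (sig_fun (fun a => sig_fun (fun b => sig_fun (fun c => sig_fun (
  asc_exists (rtens := rtens) a b c))))) as [asc' rasc].
destruct (sig_fun (fun a => sig_fun (
  lft_exists (rtens := rtens) (runt := runt) a)))
  as [lft' rlft].
destruct (sig_fun (fun a => sig_fun (
  rgt_exists (rtens := rtens) (runt := runt) a)))
  as [rgt' rrgt].
pose (T' := @TricatData (Globset3 hom') B' tens' unt' asc' lft' rgt'
  (fun a b c d e => proj1_sig (pi_exists (rasc := rasc) a b c d e))
  (fun a b c => proj1_sig (mu_exists (rasc := rasc) (rlft := rlft)
    (rrgt := rrgt) a b c))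
  (fun a b c => proj1_sig (lam_exists (rasc := rasc) (rlft := rlft) a b c))
  (fun a b c => proj1_sig (rho_exists (rasc := rasc) (rrgt := rrgt) a b c))).
exists T'.
split; [exact rB | exact rtens | exact runt | exact rasc | exact rlft
  | exact rrgt | intros ..].
- exact (proj2_sig (pi_exists (rasc := rasc) a b c d e)).
- exact (proj2_sig (mu_exists (rasc := rasc) (rlft := rlft)
    (rrgt := rrgt) a b c)).
- exact (proj2_sig (lam_exists (rasc := rasc) (rlft := rlft) a b c)).
- exact (proj2_sig (rho_exists (rasc := rasc) (rrgt := rrgt) a b c)).
Qed.

End Data.

(** * The axioms of the quotient tricategory *)

Existing Class tricat_rel.
#[export] Existing Instance tr_loc.

(** * Relatedness of the named components of a tricategory *)

Section Components.
Context {X : globset3} {T : tricat_data X}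
  {S : forall a b : X, thin_system (loc a b)} {hom' : X -> X -> globset2}
  {R : forall a b : X, quotient_of (S a b) (hom' a b)}
  {T' : tricat_data (Globset3 hom')} {rT : tricat_rel R T'}.

Local Notation Y := (Globset3 hom').

(** The named components apply structure maps to tuples. The tuples are supplied here once, so that
    the axioms can be treated without unfolding the components. *)
Lemma tens1_rel {a b c : X} {g : hom b c} {f : hom a b} {g' : @hom Y b c}
    {f' : @hom Y a b} :
  r0 (R b c) g g' -> r0 (R a b) f f' -> r0 (R a c) (g ⊗1 f) (g' ⊗1 f').
Proof. intros h k. exact (gr_0 (tr_tens rT a b c) (x := (g, f)) (x' := (g',
  f')) (conj h k)). Qed.

Lemma tens2_rel {a b c : X} {g k : hom b c} {f h : hom a b}
    {g' k' : @hom Y b c} {f' h' : @hom Y a b} {s : cell1 g k} {t : cell1 f h}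
    {s' : cell1 g' k'} {t' : cell1 f' h'} :
  r1 (R b c) s s' -> r1 (R a b) t t' -> r1 (R a c) (s ⊗2 t) (s' ⊗2 t').
Proof.
intros hs ht.
exact (gr_1 (tr_tens rT a b c) (x := (g, f)) (y := (k, h))
  (x' := (g', f')) (y' := (k', h')) (f := (s, t)) (f' := (s', t')) (conj hs
    ht)).
Qed.

Lemma tens3_rel {a b c : X} {g k : hom b c} {f h : hom a b}
    {g' k' : @hom Y b c} {f' h' : @hom Y a b} {s u : cell1 g k}
    {t v : cell1 f h} {s' u' : cell1 g' k'} {t' v' : cell1 f' h'}
    {L : cell2 s u} {M : cell2 t v} {L' : cell2 s' u'} {M' : cell2 t' v'} :
  r2 (R b c) L L' -> r2 (R a b) M M' -> r2 (R a c) (L ⊗3 M) (L' ⊗3 M').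
Proof.
intros hL hM.
exact (gr_2 (tr_tens rT a b c) (x := (g, f)) (y := (k, h))
  (x' := (g', f')) (y' := (k', h')) (f := (s, t)) (g := (u, v))
  (f' := (s', t')) (g' := (u', v')) (C := (L, M)) (C' := (L', M')) (conj hL
    hM)).
Qed.

Lemma u1_rel (a : X) : r0 (R a a) (u1 a) (@u1 Y T' a).
Proof. exact (gr_0 (tr_unt rT a) (x := tt) (x' := tt) I). Qed.

Section Phi.
Context {a b c : X} {h k l : hom b c} {f g i : hom a b}
  {s : cell1 k l} {t : cell1 g i} {u : cell1 h k} {v : cell1 f g}
  {h' k' l' : @hom Y b c} {f' g' i' : @hom Y a b}
  {s' : cell1 k' l'} {t' : cell1 g' i'} {u' : cell1 h' k'} {v' : cell1 f' g'}
  (hs : r1 (R b c) s s') (ht : r1 (R a b) t t') (hu : r1 (R b c) u u')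
  (hv : r1 (R a b) v v').

Lemma phi_rel : r2 (R a c) (phi s t u v) (phi s' t' u' v').
Proof.
exact (pfr_comp (tr_tens rT a b c) (x := (h, f)) (y := (k, g))
  (z := (l, i)) (x' := (h', f')) (y' := (k', g')) (z' := (l', i')) (g := (s,
    t)) (f := (u, v))
  (g' := (s', t')) (f' := (u', v')) (conj hs ht) (conj hu hv)).
Qed.

Lemma phi_inv_rel : r2 (R a c) (phi_inv s t u v) (phi_inv s' t' u' v').
Proof.
exact (fr_comp_inv (tr_tens rT a b c) (x := (h, f)) (y := (k, g))
  (z := (l, i)) (x' := (h', f')) (y' := (k', g')) (z' := (l', i')) (g := (s,
    t)) (f := (u, v))
  (g' := (s', t')) (f' := (u', v')) (conj hs ht) (conj hu hv)).
Qed.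

End Phi.

Lemma phi_id_inv_rel {a b c : X} {g : hom b c} {f : hom a b}
    {g' : @hom Y b c} {f' : @hom Y a b} :
  r0 (R b c) g g' -> r0 (R a b) f f' ->
  r2 (R a c) (phi_id_inv g f) (phi_id_inv g' f').
Proof. intros h k. exact (fr_unit_inv (tr_tens rT a b c) (x := (g, f)) (x' :=
  (g', f'))
  (conj h k)). Qed.

Section Constraints.
Context {a b c d e : X} {k : hom d e} {h : hom c d} {g : hom b c} {f : hom a b}
  {k' : @hom Y d e} {h' : @hom Y c d} {g' : @hom Y b c} {f' : @hom Y a b}
  (hk : r0 (R d e) k k') (hh : r0 (R c d) h h') (hg : r0 (R b c) g g')
  (hf : r0 (R a b) f f').

Lemma ac_rel : r1 (R a d) (ac h g f) (ac h' g' f').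
Proof. exact (tr_ob (ar_l (tr_asc rT a b c d)) (x := (h, g, f)) (x' := (h', g',
  f'))
  (conj (conj hh hg) hf)). Qed.

Lemma lc_rel : r1 (R a b) (lc f) (lc f').
Proof. exact (tr_ob (ar_l (tr_lft rT a b)) hf). Qed.

Lemma rc_rel : r1 (R a b) (rc f) (rc f').
Proof. exact (tr_ob (ar_r (tr_rgt rT a b)) hf). Qed.

Lemma pic_rel : r2 (R a e) (pic k h g f) (pic k' h' g' f').
Proof.
exact (mr_ob (tr_pi rT a b c d e) (x := (k, h, g, f)) (x' := (k', h', g', f'))
  (conj (conj (conj hk hh) hg) hf)).
Qed.

Lemma muc_rel : r2 (R a c) (muc g f) (muc g' f').
Proof. exact (mr_ob (tr_mu rT a b c) (x := (g, f)) (x' := (g', f')) (conj hg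
  hf)). Qed.

Lemma lamc_inv_rel : r2 (R a c) (lamc_inv g f) (lamc_inv g' f').
Proof. exact (mr_ob_inv (tr_lam rT a b c) (x := (g, f)) (x' := (g', f')) (conj
  hg hf)). Qed.

Lemma rhoc_inv_rel : r2 (R a c) (rhoc_inv g f) (rhoc_inv g' f').
Proof. exact (mr_ob_inv (tr_rho rT a b c) (x := (g, f)) (x' := (g', f')) (conj
  hg hf)). Qed.

End Constraints.

Section Naturality.
Context {a b c d : X} {h k : hom c d} {g i : hom b c} {f j : hom a b}
  {s : cell1 h k} {t : cell1 g i} {u : cell1 f j}
  {h' k' : @hom Y c d} {g' i' : @hom Y b c} {f' j' : @hom Y a b}
  {s' : cell1 h' k'} {t' : cell1 g' i'} {u' : cell1 f' j'}
  (hs : r1 (R c d) s s') (ht : r1 (R b c) t t') (hu : r1 (R a b) u u').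

Lemma ac_nat_rel : r2 (R a d) (ac_nat s t u) (ac_nat s' t' u').
Proof.
exact (tr_nat (ar_l (tr_asc rT a b c d)) (x := (h, g, f)) (y := (k, i, j))
  (x' := (h', g', f')) (y' := (k', i', j')) (f := (s, t, u)) (f' := (s', t',
    u'))
  (conj (conj hs ht) hu)).
Qed.

Lemma ac_nat_inv_rel : r2 (R a d) (ac_nat_inv s t u) (ac_nat_inv s' t' u').
Proof.
exact (tr_nat_inv (ar_l (tr_asc rT a b c d)) (x := (h, g, f)) (y := (k, i, j))
  (x' := (h', g', f')) (y' := (k', i', j')) (f := (s, t, u))
  (f' := (s', t', u')) (conj (conj hs ht) hu)).
Qed.

End Naturality.
End Components.

Ltac tricat_rel_step := lazymatch goal with
  | |- r0 _ _ (tens1 _ _) => eapply tens1_rel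
  | |- r0 _ _ (u1 _) => eapply u1_rel
  | |- r1 _ _ (tens2 _ _) => eapply tens2_rel
  | |- r2 _ _ (tens3 _ _) => eapply tens3_rel
  | |- r2 _ _ (phi _ _ _ _) => eapply phi_rel
  | |- r2 _ _ (phi_inv _ _ _ _) => eapply phi_inv_rel
  | |- r2 _ _ (phi_id_inv _ _) => eapply phi_id_inv_rel
  | |- r1 _ _ (ac _ _ _) => eapply ac_rel
  | |- r1 _ _ (lc _) => eapply lc_rel
  | |- r1 _ _ (rc _) => eapply rc_rel
  | |- r2 _ _ (pic _ _ _ _) => eapply pic_rel
  | |- r2 _ _ (muc _ _) => eapply muc_rel
  | |- r2 _ _ (lamc_inv _ _) => eapply lamc_inv_rel
  | |- r2 _ _ (rhoc_inv _ _) => eapply rhoc_inv_rel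
  | |- r2 _ _ (ac_nat _ _ _) => eapply ac_nat_rel
  | |- r2 _ _ (ac_nat_inv _ _ _) => eapply ac_nat_inv_rel
  | |- tricat_rel _ _ => typeclasses eauto
  end.
Ltac rel_hook ::= tricat_rel_step.

(** * Relatedness of pastings and one-sided comparison cells *)

Section Pasting.
Context {G : globset2} {B : bicat G} {S : thin_system B} {G' : globset2}
  {R : quotient_of S G'} {B' : bicat G'} {bR : bicat_rel R B'}
  {v x y z t : G} {v' x' y' z' t' : G'}.

Lemma front2_rel {g : cell1 y z} {f : cell1 x y} {u : cell1 x z}
    {g' : cell1 y' z'} {f' : cell1 x' y'} {u' : cell1 x' z'}
    {C : cell2 (g * f) u} {w : cell1 v x}
    {C' : cell2 (g' * f') u'} {w' : cell1 v' x'} :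
  r1 R g g' -> r1 R f f' -> r2 R C C' -> r1 R w w' ->
  r2 R (front2 C w) (front2 C' w').
Proof. intros. unfold front2. rel. Qed.

Lemma front3_rel {h : cell1 z t} {g : cell1 y z} {f : cell1 x y}
    {u : cell1 x t} {h' : cell1 z' t'} {g' : cell1 y' z'} {f' : cell1 x' y'}
    {u' : cell1 x' t'} {C : cell2 (h * (g * f)) u} {w : cell1 v x}
    {C' : cell2 (h' * (g' * f')) u'} {w' : cell1 v' x'} :
  r1 R h h' -> r1 R g g' -> r1 R f f' -> r2 R C C' -> r1 R w w' ->
  r2 R (front3 C w) (front3 C' w').
Proof. intros. unfold front3. rel. Qed.

End Pasting.

Section OneSidedRel.
Context {X : globset3} {T : tricat_data X}
  {S : forall a b : X, thin_system (loc a b)} {hom' : X -> X -> globset2}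
  {R : forall a b : X, quotient_of (S a b) (hom' a b)}
  {T' : tricat_data (Globset3 hom')} {rT : tricat_rel R T'} {a b c : X}.

Local Notation Y := (Globset3 hom').

Section Right.
Context {g1 g2 g3 g4 : hom b c} {g1' g2' g3' g4' : @hom Y b c}
  {s1 : cell1 g1 g2} {s2 : cell1 g2 g3} {s3 : cell1 g3 g4}
  {s1' : cell1 g1' g2'} {s2' : cell1 g2' g3'} {s3' : cell1 g3' g4'}
  {f : hom a b} {f' : @hom Y a b}
  (h1 : r1 (R b c) s1 s1') (h2 : r1 (R b c) s2 s2') (h3 : r1 (R b c) s3 s3')
  (hf : r0 (R a b) f f').

Lemma rcomp2_rel : r2 (R a c) (rcomp2 s2 s1 f) (rcomp2 s2' s1' f').
Proof. unfold rcomp2. rel. Qed.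

Lemma rcomp2_inv_rel : r2 (R a c) (rcomp2_inv s2 s1 f) (rcomp2_inv s2' s1' f').
Proof. unfold rcomp2_inv. rel. Qed.

Lemma rcomp3_rel : r2 (R a c) (rcomp3 s3 s2 s1 f) (rcomp3 s3' s2' s1' f').
Proof. unfold rcomp3, rcomp2. rel. Qed.

End Right.

Section Left.
Context {f1 f2 f3 f4 : hom a b} {f1' f2' f3' f4' : @hom Y a b}
  {s1 : cell1 f1 f2} {s2 : cell1 f2 f3} {s3 : cell1 f3 f4}
  {s1' : cell1 f1' f2'} {s2' : cell1 f2' f3'} {s3' : cell1 f3' f4'}
  {k : hom b c} {k' : @hom Y b c}
  (h1 : r1 (R a b) s1 s1') (h2 : r1 (R a b) s2 s2') (h3 : r1 (R a b) s3 s3')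
  (hk : r0 (R b c) k k').

Lemma lcomp2_rel : r2 (R a c) (lcomp2 k s2 s1) (lcomp2 k' s2' s1').
Proof. unfold lcomp2. rel. Qed.

Lemma lcomp2_inv_rel : r2 (R a c) (lcomp2_inv k s2 s1) (lcomp2_inv k' s2' s1').
Proof. unfold lcomp2_inv. rel. Qed.

Lemma lcomp3_rel : r2 (R a c) (lcomp3 k s3 s2 s1) (lcomp3 k' s3' s2' s1').
Proof. unfold lcomp3, lcomp2. rel. Qed.

End Left.
End OneSidedRel.

Ltac rel_hook ::= lazymatch goal with
  | |- r2 _ _ (rcomp2 _ _ _) => eapply rcomp2_rel
  | |- r2 _ _ (rcomp2_inv _ _ _) => eapply rcomp2_inv_rel
  | |- r2 _ _ (rcomp3 _ _ _ _) => eapply rcomp3_rel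
  | |- r2 _ _ (lcomp2 _ _ _) => eapply lcomp2_rel
  | |- r2 _ _ (lcomp2_inv _ _ _) => eapply lcomp2_inv_rel
  | |- r2 _ _ (lcomp3 _ _ _ _) => eapply lcomp3_rel
  | |- r2 _ _ (front2 _ _) => eapply front2_rel
  | |- r2 _ _ (front3 _ _) => eapply front3_rel
  | |- _ => tricat_rel_step
  end.

Section TricatLaws.
Context {X : globset3} {T : tricat X}
  {S : forall a b : X, thin_system (loc a b)} {hom' : X -> X -> globset2}
  {R : forall a b : X, quotient_of (S a b) (hom' a b)}
  {T' : tricat_data (Globset3 hom')} {rT : tricat_rel R T'}.

Local Notation Y := (Globset3 hom').

Lemma left_normalization_transport : @left_normalization Y T'.
Proof.
intros a b c d h' g' f'.
destruct (r0_onto (R c d) h') as [h hh], (r0_onto (R b c) g') as [g hg],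
  (r0_onto (R a b) f') as [f hf].
pose proof (tricat_left_normalization h g f) as law.
(* Expanding the local abbreviations lets [rel] follow the syntax of both sides. The left side of
   the law for representatives is then given to [r2_fun] as their common representative. *)
cbv zeta in law |- *.
lazymatch type of law with ?l = _ => apply (r2_fun (R a d) l) end.
- rel.
- rewrite law. rel.
Qed.

Lemma right_normalization_transport : @right_normalization Y T'.
Proof.
intros a b c d h' g' f'.
destruct (r0_onto (R c d) h') as [h hh], (r0_onto (R b c) g') as [g hg],
  (r0_onto (R a b) f') as [f hf].
pose proof (tricat_right_normalization h g f) as law.
cbv zeta in law |- *.
lazymatch type of law with ?l = _ => apply (r2_fun (R a d) l) end.
- rel.
- rewrite law. rel.
Qed.

Lemma associahedron_transport : @associahedron_axiom Y T'.
Proof.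
intros a0 a1 a2 a3 a4 a5 p' q' r' s' t'.
destruct (r0_onto (R a4 a5) p') as [p hp], (r0_onto (R a3 a4) q') as [q hq],
  (r0_onto (R a2 a3) r') as [r hr], (r0_onto (R a1 a2) s') as [s hs],
  (r0_onto (R a0 a1) t') as [t ht].
pose proof (tricat_associahedron p q r s t) as law.
cbv zeta in law |- *.
lazymatch type of law with ?l = _ => apply (r2_fun (R a0 a5) l) end.
- rel.
- rewrite law. rel.
Qed.

End TricatLaws.

(** * The class map *)

(** Says that [P] sends each cell to its class. As the relation is functional, whatever is related
    to its quotient counterpart is then preserved strictly by [P]. *)
Record graph_of {G : globset2} {B : bicat G} {S : thin_system B}
    {G' : globset2} (R : quotient_of S G') (P : gmap G G') : Prop := {
  gf_0 : forall x, r0 R x (P x);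
  gf_1 : forall x y (f : cell1 x y), r1 R f (map1 P f);
  gf_2 : forall x y (f g : cell1 x y) (C : cell2 f g), r2 R C (map2 P C) }.
Existing Class graph_of.

#[export] Instance unit_graph : graph_of unit_quotient (gid unitg).
Proof. now split. Qed.

#[export] Instance prod_graph {G H G' H' : globset2} {BG : bicat G}
    {BH : bicat H} {SG : thin_system BG} {SH : thin_system BH}
    {RG : quotient_of SG G'} {RH : quotient_of SH H'} {P : gmap G G'}
    {K : gmap H H'} :
  graph_of RG P -> graph_of RH K -> graph_of (prod_quotient RG RH) (gprod P K).
Proof. intros [] []. split; cbn; intros; split; auto. Qed.

Section Preservation.
Context {G H G' H' : globset2} {BG : bicat G} {BH : bicat H}
  {SG : thin_system BG} {SH : thin_system BH} {RG : quotient_of SG G'}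
  {RH : quotient_of SH H'} {BG' : bicat G'} {BH' : bicat H'}
  {P : gmap G G'} {K : gmap H H'} {gP : graph_of RG P} {gK : graph_of RH K}.

Lemma rel_strict_functor {bH : bicat_rel RH BH'} : strict_functor K.
Proof.
assert (K0 := gf_0 gK). assert (K1 := gf_1 gK). assert (K2 := gf_2 gK).
split; intros.
- refine (r1_fun (K1 _ _ _) _). now apply (br_id1 bH).
- refine (r1_fun (K1 _ _ _) _). now apply (br_comp1 bH).
- refine (r2_fun RH _ (K2 _ _ _ _ _) _). now apply (br_id2 bH).
- refine (r2_fun RH _ (K2 _ _ _ _ _) _). now apply (br_vcomp bH).
- refine (r2_tot2 (K2 _ _ _ _ _) _). now apply (br_hcomp bH).
- refine (r2_tot2 (K2 _ _ _ _ _) _). now apply (br_assoc bH).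
- refine (r2_tot2 (K2 _ _ _ _ _) _). now apply (br_lunitor bH).
- refine (r2_tot2 (K2 _ _ _ _ _) _). now apply (br_runitor bH).
Qed.

Lemma rel_preserves_functor {F : prefunctor G H} {F' : prefunctor G' H'} :
  prefunctor_rel RG RH F F' -> preserves_functor P K F F'.
Proof.
intros rF. split; intros.
- exact (r0_fun (gf_0 gK _) (gr_0 rF (gf_0 gP _))).
- exact (r1_tot1 (gf_1 gK _) (gr_1 rF (gf_1 gP _))).
- exact (r2_tot2 (gf_2 gK _) (gr_2 rF (gf_2 gP _))).
- exact (r2_tot2 (gf_2 gK _) (pfr_comp rF (gf_1 gP _) (gf_1 gP _))).
- exact (r2_tot2 (gf_2 gK _) (pfr_unit rF (gf_0 gP _))).
Qed.

Lemma rel_preserves_trans {F E : gmap G H} {F' E' : gmap G' H'}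
    {s : pretrans F E} {s' : pretrans F' E'} :
  pretrans_rel RG RH s s' -> preserves_trans P K s s'.
Proof.
intros rs. split; intros.
- exact (r1_tot1 (gf_1 gK _) (tr_ob rs (gf_0 gP _))).
- exact (r2_tot2 (gf_2 gK _) (tr_nat rs (gf_1 gP _))).
Qed.

Lemma rel_preserves_mod {F E : gmap G H} {F' E' : gmap G' H'}
    {s t : pretrans F E} {s' t' : pretrans F' E'} {m : imod s t}
    {m' : imod s' t'} : imod_rel RG RH m m' -> preserves_mod P K m m'.
Proof. intros rm x. exact (r2_tot2 (gf_2 gK _) (mr_ob rm (gf_0 gP _))). Qed.

Lemma rel_preserves_adjeq {F E : prefunctor G H} {F' E' : prefunctor G' H'}
    {e : adjeq F E} {e' : adjeq F' E'} :
  adjeq_rel RG RH e e' -> preserves_adjeq P K e e'.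
Proof.
intros [rl rr ru rc].
split; [apply rel_preserves_trans, rl | apply rel_preserves_trans, rr
  | exact (rel_preserves_mod ru) | exact (rel_preserves_mod rc)].
Qed.

End Preservation.

(** * Thinness of the constraints of a semi-free tricategory *)

Section ThinTricat.
Context {X : globset3} {T : tricat X} {C3 : mor3_collection T}
  (hT : semi_free T) (hC3 : coherence23_system C3).

Local Notation S := (hom_thin hT hC3).

Lemma thin_cancel_r {G : globset2} {B : bicat G} {S : thin_system B} {x y : G}
    {f g h : cell1 x y} (D : cell2 g h) (C : cell2 f g) :
  thin S (D \o C) -> thin S C -> thin S D.
Proof.
intros k c. destruct (thin_inv c) as (C' & [_ CC'] & c').
rewrite <- (vcomp1r D), <- CC', <- vcompA. now apply thin_vcomp.
Qed.

Lemma ac_coh2 {a b c d : X} (h : hom c d) (g : hom b c) (f : hom a b) :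
  coh2 (ac h g f).
Proof.
exact (coh2_constraint (constraint2_asc (adj_cell1_l (asc a b c d) (h, g, f)))).
Qed.

Lemma lc_coh2 {a b : X} (f : hom a b) : coh2 (lc f).
Proof. exact (coh2_constraint (constraint2_lft (adj_cell1_l (lft a b) f))). Qed.

Lemma rc_coh2 {a b : X} (f : hom a b) : coh2 (rc f).
Proof. exact (coh2_constraint (constraint2_rgt (adj_cell1_r (rgt a b) f))). Qed.

Lemma u2_coh2 (a : X) : coh2 (u2 a).
Proof. apply coh2_constraint, constraint2_unit. Qed.

Ltac coherent :=
  repeat first [ apply ac_coh2 | apply lc_coh2 | apply rc_coh2
    | apply u2_coh2 | apply coh2_id | assumption
    | apply coh2_comp | apply coh2_tens ].

(** Reduces membership in C_3 to coherence of the boundary, which [coherent] checks by its shape. *)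
Lemma coh3_thin {a b : X} {f g : hom a b} {s t : cell1 f g} (C : cell2 s t) :
  coh2 s -> coh2 t -> constraint3 C -> thin (S a b) C.
Proof. intros hs ht h. exact (c23_coh hC3 hs ht (coh3_constraint h)). Qed.

Lemma tens_thin (a b c : X) :
  thin_prefunctor (prod_thin (S b c) (S a b)) (S a c) (tens a b c).
Proof.
split.
- intros [g f] [g' f'] [s t] [hs ht]. exact (coh2_tens hs ht).
- intros [g f] [g' f'] [s t] [s' t'] [C D] [hC hD].
  exact (c3_tens (c23_system hC3) hC hD).
- intros [h f] [h' f'] [h'' f''] [s' t'] [s t] [hs ht].
  exact (c23_phi_l hC3 s t hs ht).
- intros [h f] [h' f'] [h'' f''] [s' t'] [s t] [hs ht].
  exact (c23_phi_r hC3 s' t' hs ht).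
- intros [g f].
  apply (coh3_thin (C := phi_id g f)); [coherent | coherent |].
  apply constraint3_phi_id.
Qed.

Lemma phi_unit_thin (a : X) : thin (S a a) (phi_unit a).
Proof. apply coh3_thin; [coherent | coherent | apply constraint3_phi_unit]. Qed.

(* The left unit law determines the composition constraint of the unit. *)
Lemma unt_comp_thin (a : X) :
  thin (S a a) (fcomp (unt a) (x := tt) (y := tt) (z := tt) tt tt).
Proof.
pose proof (fcomp_lunit (unt a) (x := tt) (y := tt) tt) as e.
pose proof (map2_id (unt a) (x := tt) (y := tt) tt) as i.
refine (thin_cancel_r (C := phi_unit a |> u2 a) _ _).
2: exact (thin_hcomp (phi_unit_thin a) (thin_id _ (u2 a))).
(* In the terminal bicategory the unitor of [tt] is its identity, so [map2_id] removes the first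
   factor of the unit law. *)
assert (e' : lunitor (u2 a) =
  fcomp (unt a) (x := tt) (y := tt) (z := tt) tt tt \o (phi_unit a |> u2 a)).
{ refine (eq_trans (eq_sym e) (eq_trans _ (vcomp1l _))).
  exact (f_equal (fun C => C \o _) i). }
exact (eq_ind _ (fun C => thin (S a a) C) (thin_lunitor _ (u2 a)) _ e').
Qed.

Lemma unt_thin (a : X) : thin_prefunctor unit_thin (S a a) (unt a).
Proof.
split.
- intros [] [] [] _. exact (u2_coh2 a).
- intros [] [] [] [] [] _. exact (eq_ind_r (fun C => thin (S a a) C)
    (thin_id _ (u2 a)) (map2_id (unt a) (x := tt) (y := tt) tt)).
- intros [] [] [] [] [] _. apply unt_comp_thin.
- intros [] [] [] [] [] _. apply unt_comp_thin.
- intros []. apply phi_unit_thin.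
Qed.

(** The boundary of a naturality cell contains the images of its argument under both functors; it is
    coherent when the argument is, and this is the case that [thin_trans] asks for. *)
Lemma coherent_adjeq {G : globset2} {BG : bicat G} {SG : thin_system BG}
    {a b : X} {F E : prefunctor G (hom a b)}
    (tF : thin_prefunctor SG (S a b) F) (tE : thin_prefunctor SG (S a b) E)
    (e : adjeq F E) :
  (forall (f g : hom a b) (s : cell1 f g), adj_cell1 e s -> coh2 s) ->
  (forall (f g : hom a b) (s t : cell1 f g) (C : cell2 s t),
    adj_cell2 e C -> constraint3 C) ->
  thin_adjeq SG (S a b) e.
Proof.
intros h1 h2. split; [split | split | |]; intros.
- apply h1, adj_cell1_l.
- apply coh3_thin; [| | apply h2, adj_cell2_l]; apply coh2_comp;
    first [apply h1, adj_cell1_l | now apply (tf_coh tE) | now apply (tf_coh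
      tF)].
- apply h1, adj_cell1_r.
- apply coh3_thin; [| | apply h2, adj_cell2_r]; apply coh2_comp;
    first [apply h1, adj_cell1_r | now apply (tf_coh tE) | now apply (tf_coh
      tF)].
- apply coh3_thin; [apply coh2_id | | apply h2, adj_cell2_unit].
  apply coh2_comp; [apply h1, adj_cell1_r | apply h1, adj_cell1_l].
- apply coh3_thin; [| apply coh2_id | apply h2, adj_cell2_counit].
  apply coh2_comp; [apply h1, adj_cell1_l | apply h1, adj_cell1_r].
Qed.

Lemma hom_thin_tricat : thin_tricat S.
Proof.
split.
- exact tens_thin.
- exact unt_thin.
- intros a b c d. apply coherent_adjeq.
  + exact (asc_source_thin tens_thin a b c d).
  + exact (asc_target_thin tens_thin a b c d).
  + intros f g s h. exact (coh2_constraint (constraint2_asc h)).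
  + intros f g s t C. apply constraint3_asc.
- intros a b. apply coherent_adjeq.
  + exact (lft_source_thin tens_thin unt_thin a b).
  + exact (pf_id_thin (S a b)).
  + intros f g s h. exact (coh2_constraint (constraint2_lft h)).
  + intros f g s t C. apply constraint3_lft.
- intros a b. apply coherent_adjeq.
  + exact (rgt_source_thin tens_thin unt_thin a b).
  + exact (pf_id_thin (S a b)).
  + intros f g s h. exact (coh2_constraint (constraint2_rgt h)).
  + intros f g s t C. apply constraint3_rgt.
- intros a b c d e [[[k h] g] f].
  apply (coh3_thin (C := pic k h g f)); [coherent | coherent |].
  exact (constraint3_pi (k, h, g, f)).
- intros a b c [g f].
  apply (coh3_thin (C := muc g f)); [coherent | coherent |].
  exact (constraint3_mu (g, f)).
- intros a b c [g f].
  (* The boundary is restated, up to conversion, in named components so that its coherence is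
     visible. *)
  apply (coh3_thin (s := lc g ⊗2 id1 f) (t := lc (g ⊗1 f) * ac (u1 c) g f)
    (C := lam a b c (g, f))); [coherent | coherent |].
  exact (constraint3_lam (g, f)).
- intros a b c [g f].
  apply (coh3_thin (s := id1 g ⊗2 rc f) (t := ac g f (u1 a) * rc (g ⊗1 f))
    (C := rho a b c (g, f))); [coherent | coherent |].
  exact (constraint3_rho (g, f)).
Qed.

End ThinTricat.

(** * Equivalences from the unit constraints, and the class map *)

Lemma lc_equivalence {X : globset3} {T : tricat X} {a b : X} (f : hom a b) :
  equivalence1 (lc f).
Proof.
exists (adj_r (lft a b) f). split.
- exists (mob_inv (adj_unit (lft a b)) f). exists (adj_unit (lft a b) f).
  exact (inverse2_sym (mobK (adj_unit (lft a b)) f)).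
- exists (adj_counit (lft a b) f). exists (mob_inv (adj_counit (lft a b)) f).
  exact (mobK (adj_counit (lft a b)) f).
Qed.

(** The unit is its own inverse: both composites are [u1 a ⊗1 u1 a], and the left unit constraint at
    [u1 a] takes them to [u1 a]. *)
Lemma u1_biequivalence {X : globset3} {T : tricat X} (a : X) :
  biequivalence1 (u1 a).
Proof. exists (u1 a). split; exists (lc (u1 a)); apply lc_equivalence. Qed.

Lemma id1_equivalence {G : globset2} {B : bicat G} (x : G) :
  equivalence1 (id1 x).
Proof.
exists (id1 x). split; exists (lunitor (id1 x)), (lunitor_inv (id1 x));
  apply lunitorK.
Qed.

Section ClassMap.
Context {X : globset3} {T : tricat X} {C3 : mor3_collection T}
  (hT : semi_free T) (hC3 : coherence23_system C3).

Local Notation R := (hom_quotient hT hC3).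
Local Notation K := (map_hom (class_map C3)).

#[local] Instance class_graph (a b : X) : graph_of (R a b) (K a b).
Proof. now split. Qed.

(** Stronger than required on 1- and 2-morphisms: every class is literally the image of a
    representative, so identities serve as the equivalence and the isomorphism. Injectivity on
    3-morphisms is uniqueness of the representative with fixed boundary. *)
Lemma class_strict_biequivalence (a b : X)
    {B' : bicat (@hom (quotient_globset C3) a b)} :
  bicat_rel (R a b) B' -> strict_biequivalence (K a b).
Proof.
intros rB. pose proof (class_graph a b) as [K0 K1 K2]. split.
- exact (rel_strict_functor (RH := R a b)).
- intros A. destruct (r0_onto (R a b) A) as [f h].
  exists f. destruct (r0_fun (K0 f) h).
  exists (id1 (K a b f)). apply id1_equivalence.
- intros f g P. destruct (r1_lift P (K0 f) (K0 g)) as [s h].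
  exists s. destruct (r1_fun (K1 _ _ s) h). exists (id2 _), (id2 _).
  split; apply vcomp1l.
- intros f g s t L M e. apply (r2_inj (R := R a b) (C' := map2 (K a b) L)).
  + apply K2.
  + rewrite e. apply K2.
- intros f g s t U. destruct (r2_lift U (K1 _ _ s) (K1 _ _ t)) as [L h].
  exists L. exact (r2_fun (R a b) L (K2 _ _ _ _ L) h).
Qed.

Context {Q : tricat (quotient_globset C3)}
  (rQ : tricat_rel R (@tdata _ Q : tricat_data (Globset3 _))).

Lemma class_quotient_operations : quotient_operations Q.
Proof.
split.
- intros a b c g f B A hg hf. exact (tens1_rel (rT := rQ) hg hf).
- intros a b c g g' f f' s t B B' A A' P U hs ht.
  exact (tens2_rel (rT := rQ) hs ht).
- intros a b c g g' f f' s s' t t' L M B B' A A' P P' U U' V W hL hM.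
  exact (tens3_rel (rT := rQ) hL hM).
- intros a b f g h t s A B D U P ht hs.
  exact (br_comp1 (tr_loc rQ a b) ht hs).
- intros a b f g h t t' s s' M L A B D U U' P P' V W hM hL.
  exact (br_hcomp (tr_loc rQ a b) hM hL).
- intros a b f g s t u M L A B P U W V Z hM hL.
  exact (br_vcomp (tr_loc rQ a b) hM hL).
- intros a b f g h k u t s A B D E W U P hu ht hs.
  exact (br_assoc (tr_loc rQ a b) hu ht hs).
- intros a b c h h' h'' f f' f'' s' t' s t B B' B'' A A' A'' P' U' P U
    hs' ht' hs ht.
  exact (phi_rel (rT := rQ) hs' ht' hs ht).
Qed.

Lemma class_virtually_strict : virtually_strict T Q (class_map C3).
Proof.
split; intros.
- exact (rel_strict_functor (bH := tr_loc rQ a b)).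
- exact (rel_preserves_functor (tr_tens rQ a b c)).
- exact (rel_preserves_functor (tr_unt rQ a)).
- exact (rel_preserves_adjeq (tr_asc rQ a b c d)).
- exact (rel_preserves_adjeq (tr_lft rQ a b)).
- exact (rel_preserves_adjeq (tr_rgt rQ a b)).
- exact (rel_preserves_mod (tr_pi rQ a b c d e)).
- exact (rel_preserves_mod (tr_mu rQ a b c)).
- exact (rel_preserves_mod (tr_lam rQ a b c)).
- exact (rel_preserves_mod (tr_rho rQ a b c)).
Qed.

Lemma class_triequivalence :
  virtually_strict_triequivalence T Q (class_map C3).
Proof.
split.
- exact class_virtually_strict.
(* The quotient keeps the objects of T, so the unit of the quotient tricategory is the required
   biequivalence. *)
- intros a. exists a, (u1 a). apply u1_biequivalence.
- intros a b. exact (class_strict_biequivalence (tr_loc rQ a b)).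
Qed.

End ClassMap.

Theorem proposition3p7p11 (X : globset3) (T : tricat X)
    (C3 : mor3_collection T) (hT : semi_free T) (hC3 : coherence23_system C3) :
  sims_equivalence C3 /\
  quotient_boundaries C3 /\
  exists Q : tricat (quotient_globset C3),
    quotient_operations Q /\
    virtually_strict_triequivalence T Q (class_map C3).
Proof.
split; [exact (sims_equivalence_holds hT hC3) |].
split; [exact (quotient_boundaries_hold hT hC3) |].
destruct (tricat_data_exists (hom_quotient hT hC3) (hom_thin_tricat hT hC3))
  as [T' rT].
pose (Q := @Tricat (quotient_globset C3) T'
  (associahedron_transport (rT := rT))
  (left_normalization_transport (rT := rT))
  (right_normalization_transport (rT := rT))).
exists Q. split.
- exact (class_quotient_operations (Q := Q) rT).
- exact (class_triequivalence (Q := Q) rT).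
Qed.
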